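(* Let $1/2<\alpha<1$, let $a\in C^{1,\alpha}_0(\overline\Omega)$ be real valued with $a>0$ in $\Omega$, let ${\bf F}\in C^{1,\alpha}_0(\overline\Omega;\mathbb R^2)$ be a real valued vector field and $f\in C^{1,\alpha}_0(\overline\Omega)$ a real valued function. Suppose there is $g\in C^\alpha(\Gamma;C^{1,\alpha}(\mathbf S^1))$ with $g\in D_a{\bf F}\cap R_af$ (the attenuated Doppler data of ${\bf F}$ equals the attenuated $X$-ray data of $f$, with the same attenuation $a$). Then ${\bf F}$ is a gradient field, namely ${\bf F}=-\nabla(f/a)$ in $\Omega$.
   Context: $\Omega\subset\mathbb R^2$ is a bounded strictly convex domain with smooth boundary $\Gamma$; $\theta=(\cos\varphi,\sin\varphi)\in\mathbf S^1$. $C^{1,\alpha}_0(\overline\Omega)$ denotes $C^{1,\alpha}$ functions (or vector fields) on $\overline\Omega$ vanishing on $\Gamma$. For $(x,\theta)\in\overline\Omega\times\mathbf S^1$, $\tau_\pm(x,\theta)$ is the distance from $x$ to $\Gamma$ in direction $\pm\theta$ and $x^\pm_\theta=x\pm\tau_\pm(x,\theta)\theta$. With $a$ extended by zero, $Da(x,\theta)=\int_0^\infty a(x+t\theta)dt$. Attenuated $X$-ray data: $R_af$ is the set of functions $g$ on $\Gamma\times\mathbf S^1$ with $$g(x^+_\theta,\theta)-e^{-Da(x^-_\theta,\theta)}g(x^-_\theta,\theta)=\int_{-\tau_-(x,\theta)}^{\tau_+(x,\theta)}f(x+t\theta)e^{-Da(x+t\theta,\theta)}dt\quad\forall(x,\theta)\in\overline\Omega\times\mathbf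 S^1$$ (equivalently, traces of solutions $w$ of $\theta\cdot\nabla w+aw=f$). Attenuated Doppler data: $D_a{\bf F}$ is the set of $g$ satisfying the same identity with $f$ replaced by $\theta\cdot{\bf F}$ (equivalently, traces of solutions $u$ of $\theta\cdot\nabla u+au=\theta\cdot{\bf F}$). *)

(* Defs.v *)
From Stdlib Require Import Reals Lra ClassicalEpsilon.
Open Scope R_scope.

Definition pt := (R * R)%type.
Definition padd (p q : pt) : pt := (fst p + fst q, snd p + snd q).
Definition pscal (s : R) (p : pt) : pt := (s * fst p, s * snd p).
Definition pnorm (p : pt) : R := sqrt (fst p ^ 2 + snd p ^ 2).
Definition pdist (p q : pt) : R := pnorm (fst p - fst q, snd p - snd q).
Definition dir (phi : R) : pt := (cos phi, sin phi).

Definition closure (Om : pt -> Prop) (p : pt) : Prop :=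
  forall eps, 0 < eps -> exists q, Om q /\ pdist p q < eps.
Definition boundary (Om : pt -> Prop) (p : pt) : Prop := closure Om p /\ ~ Om p.

Definition cont2 (f : pt -> R) : Prop :=
  forall p eps, 0 < eps -> exists del, 0 < del /\
    forall q, pdist p q < del -> Rabs (f q - f p) < eps.

Fixpoint Ck (k : nat) (f : pt -> R) : Prop :=
  match k with
  | O => cont2 f
  | S k => cont2 f /\ exists f1 f2 : pt -> R,
      (forall p, derivable_pt_lim (fun t => f (t, snd p)) (fst p) (f1 p)) /\
      (forall p, derivable_pt_lim (fun t => f (fst p, t)) (snd p) (f2 p)) /\
      Ck k f1 /\ Ck k f2
  end.
Definition smooth (f : pt -> R) : Prop := forall k, Ck k f.

Definition smooth_strictly_convex_domain (Om : pt -> Prop) : Prop :=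
  (exists p, Om p) /\
  (exists M, forall p, Om p -> pnorm p <= M) /\
  (exists rho : pt -> R, smooth rho /\ (forall p, Om p <-> rho p < 0) /\
     forall p, rho p = 0 -> exists d1 d2,
       derivable_pt_lim (fun t => rho (t, snd p)) (fst p) d1 /\
       derivable_pt_lim (fun t => rho (fst p, t)) (snd p) d2 /\
       (d1 <> 0 \/ d2 <> 0)) /\
  (forall p q, closure Om p -> closure Om q -> p <> q ->
     forall s, 0 < s < 1 -> Om (padd (pscal (1 - s) p) (pscal s q))).

Definition hpow (x a : R) : R := if Rle_dec x 0 then 0 else Rpower x a.

(* u in C^{1,alpha}_0(closure Om), extended by zero outside Om *)
Definition C1a0 (alpha : R) (Om : pt -> Prop) (u : pt -> R) : Prop :=
  (forall p, ~ Om p -> u p = 0) /\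
  (forall p, closure Om p -> forall eps, 0 < eps -> exists del, 0 < del /\
     forall q, closure Om q -> pdist p q < del -> Rabs (u q - u p) < eps) /\
  exists (d1 d2 : pt -> R) (C : R),
    (forall p, Om p -> derivable_pt_lim (fun t => u (t, snd p)) (fst p) (d1 p)) /\
    (forall p, Om p -> derivable_pt_lim (fun t => u (fst p, t)) (snd p) (d2 p)) /\
    (forall p q, Om p -> Om q ->
       Rabs (d1 p - d1 q) <= C * hpow (pdist p q) alpha /\
       Rabs (d2 p - d2 q) <= C * hpow (pdist p q) alpha).

(* g in C^alpha(Gamma; C^{1,alpha}(S^1)); g x phi stands for g(x, (cos phi, sin phi)) *)
Definition Ca_C1a (alpha : R) (Om : pt -> Prop) (g : pt -> R -> R) : Prop :=
  (forall x phi, boundary Om x -> g x (phi + 2 * PI) = g x phi) /\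
  exists (dg : pt -> R -> R) (C : R),
    (forall x phi, boundary Om x -> derivable_pt_lim (g x) phi (dg x phi)) /\
    (forall x phi, boundary Om x -> Rabs (g x phi) <= C /\ Rabs (dg x phi) <= C) /\
    (forall x phi psi, boundary Om x ->
       Rabs (dg x phi - dg x psi) <= C * hpow (Rabs (phi - psi)) alpha) /\
    (forall x y phi, boundary Om x -> boundary Om y ->
       Rabs (g x phi - g y phi) <= C * hpow (pdist x y) alpha /\
       Rabs (dg x phi - dg y phi) <= C * hpow (pdist x y) alpha) /\
    (forall x y phi psi, boundary Om x -> boundary Om y ->
       Rabs ((dg x phi - dg y phi) - (dg x psi - dg y psi))
         <= C * hpow (pdist x y) alpha * hpow (Rabs (phi - psi)) alpha).

Definition Rint (f : R -> R) (a b : R) : R :=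
  match excluded_middle_informative (inhabited (Riemann_integrable f a b)) with
  | left H => RiemannInt (epsilon H (fun _ => True))
  | right _ => 0
  end.

Definition Rint0inf (f : R -> R) : R :=
  epsilon (inhabits 0) (fun L => forall eps, 0 < eps -> exists T0, forall T,
     T0 <= T -> Rabs (Rint f 0 T - L) < eps).

Definition Dtr (a : pt -> R) (x : pt) (phi : R) : R :=
  Rint0inf (fun t => a (padd x (pscal t (dir phi)))).

Definition tau (Om : pt -> Prop) (x v : pt) : R :=
  epsilon (inhabits 0) (fun t => 0 <= t /\ closure Om (padd x (pscal t v)) /\
     forall s, 0 <= s -> closure Om (padd x (pscal s v)) -> s <= t).
Definition tau_plus (Om : pt -> Prop) (x : pt) (phi : R) : R := tau Om x (dir phi).
Definition tau_minus (Om : pt -> Prop) (x : pt) (phi : R) : R :=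
  tau Om x (pscal (-1) (dir phi)).
Definition x_plus (Om : pt -> Prop) (x : pt) (phi : R) : pt :=
  padd x (pscal (tau_plus Om x phi) (dir phi)).
Definition x_minus (Om : pt -> Prop) (x : pt) (phi : R) : pt :=
  padd x (pscal (- tau_minus Om x phi) (dir phi)).

Definition att_data (Om : pt -> Prop) (a : pt -> R) (h : pt -> R -> R)
  (g : pt -> R -> R) : Prop :=
  forall x phi, closure Om x ->
    g (x_plus Om x phi) phi
      - exp (- Dtr a (x_minus Om x phi) phi) * g (x_minus Om x phi) phi
    = Rint (fun t => h (padd x (pscal t (dir phi))) phi
                     * exp (- Dtr a (padd x (pscal t (dir phi))) phi))
           (- tau_minus Om x phi) (tau_plus Om x phi).

Definition in_Ra (Om : pt -> Prop) (a f : pt -> R) (g : pt -> R -> R) : Prop :=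
  att_data Om a (fun p _ => f p) g.
Definition in_Da (Om : pt -> Prop) (a F1 F2 : pt -> R) (g : pt -> R -> R) : Prop :=
  att_data Om a (fun p phi => cos phi * F1 p + sin phi * F2 p) g.

(* Main.v *)
Require Import Defs.
From Stdlib Require Import Reals Lra Lia FunctionalExtensionality ClassicalEpsilon.
From Coquelicot Require Import Coquelicot.
Open Scope R_scope.

(** Subtracting the two identities, every line integral of (f - theta.F) e^{-Da} vanishes,
    so the solution u of theta.grad u + a u = f - theta.F that starts from 0 is Lipschitz and
    compactly supported. Replace e^{i phi} by lam = r e^{i phi} with r < 1 in
    theta.grad = lam d_z + lam^{-1} d_zbar. The resulting operator X_lam is elliptic and has an
    inverse T_lam, which is holomorphic in lam and in polar coordinates has the bounded kernel
    mu / (1 - mu^2), mu = lam e^{-i omega}. With h = T_lam a one gets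
    X_lam (e^h u) = e^h (f - theta.F) + O(1 - r); |Re h| is bounded independently of r, since
    the real part of the kernel is dominated by a Poisson kernel, whereas T_lam itself costs
    only (1 - r)^{-1/2}. Hence u is the uniform limit of the functions
    e^{-h} T_lam (e^h (f - theta.F)), which are holomorphic in lam. Holomorphic functions satisfy
    mean (psi^2) = (mean psi)^2 on circles, so the real function phi |-> u (z, phi) has zero
    variance. Thus u does not depend on theta; the transport equation for theta and -theta gives
    f = a u, and then grad u = - F. Derivatives are only taken after mollification at scale 1 - r. *)

(** * Complex-valued functions and integrals *)

(** Two rates compete. Passing from theta to lam and from u to its mollification changes the
    equation by O(1 - r), while inverting X_lam loses at most (1 - r)^{-1/2}, so a factor (1 -
    r)^{1/2} survives, uniformly in phi. The same loss inside an exponent would ruin this, which is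
    why the integrating factor is controlled through Re h alone; that bound uses that a is real. For
    |lam| < 1 the operator X_lam also differentiates across theta, where the transport equation says
    nothing: there only the Lipschitz bound on u is available, and it enters multiplied by 1 - r.
    Mollification makes the inversion formula T_lam X_lam V = V applicable; the second-order bounds,
    which blow up, never enter the error. Holomorphy is handled without power series or contour
    integrals: the class consists of uniform limits of polynomials in r e^{it}, which is closed
    under products, geometric series, exponentials and integrals over a parameter. The continuation
    of theta.F has a pole at lam = 0; the kernel of T_lam has a simple zero there, which cancels
    it. *)

Lemma Cmod_minus_sym (z w : C) : Cmod (z - w) = Cmod (w - z).
Proof. rewrite <- Cmod_opp. f_equal. ring. Qed.

Lemma Cmod_triangle_minus (z w : C) : Cmod (z - w) <= Cmod z + Cmod w.
Proof. unfold Cminus. rewrite <- (Cmod_opp w). apply Cmod_triangle. Qed.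

Lemma Cmod_dist_triangle (u v w : C) : Cmod (u - w) <= Cmod (u - v) + Cmod (v - w).
Proof. replace (u - w)%C with ((u - v) + (v - w))%C by ring. apply Cmod_triangle. Qed.

Lemma Cmod_le_sum (z : C) : Cmod z <= Rabs (fst z) + Rabs (snd z).
Proof.
  replace z with (RtoC (fst z) + RtoC (snd z) * Ci)%C at 1
    by (destruct z; apply injective_projections; simpl; ring).
  eapply Rle_trans; [apply Cmod_triangle|].
  rewrite Cmod_mult, !Cmod_R, Cmod_Ci. lra.
Qed.

Lemma fst_le_Cmod (z : C) : Rabs (fst z) <= Cmod z.
Proof. apply re_le_Cmod. Qed.

Lemma snd_le_Cmod (z : C) : Rabs (snd z) <= Cmod z.
Proof. eapply Rle_trans; [apply Rmax_r | apply Rmax_Cmod]. Qed.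

Lemma Cmod_mult_diff (a b c d : C) :
  Cmod (a * b - c * d) <= Cmod (a - c) * Cmod b + Cmod c * Cmod (b - d).
Proof.
  replace (a * b - c * d)%C with ((a - c) * b + c * (b - d))%C by ring.
  eapply Rle_trans; [apply Cmod_triangle|]. rewrite !Cmod_mult. lra.
Qed.

Lemma Rabs_cos_diff (s t : R) : Rabs (cos s - cos t) <= Rabs (s - t).
Proof.
  destruct (MVT_gen cos t s (fun x => - sin x)) as [c [_ Hc]].
  - intros. apply is_derive_Reals, derivable_pt_lim_cos.
  - intros. apply continuity_cos.
  - rewrite Hc, Rabs_mult, Rabs_Ropp.
    assert (Rabs (sin c) <= 1) by (apply Rabs_le; apply SIN_bound).
    pose proof (Rabs_pos (s - t)). nra.
Qed.

Lemma Rabs_sin_diff (s t : R) : Rabs (sin s - sin t) <= Rabs (s - t).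
Proof.
  destruct (MVT_gen sin t s cos) as [c [_ Hc]].
  - intros. apply is_derive_Reals, derivable_pt_lim_sin.
  - intros. apply continuity_sin.
  - rewrite Hc, Rabs_mult.
    assert (Rabs (cos c) <= 1) by (apply Rabs_le; apply COS_bound).
    pose proof (Rabs_pos (s - t)). nra.
Qed.

Definition expi (t : R) : C := (cos t, sin t).

Lemma Cmod_expi t : Cmod (expi t) = 1.
Proof.
  unfold Cmod, expi; simpl. pose proof (sin2_cos2 t) as H. unfold Rsqr in H.
  replace (cos t * (cos t * 1) + sin t * (sin t * 1)) with 1 by lra. apply sqrt_1.
Qed.

Lemma expi_plus s t : expi (s + t) = (expi s * expi t)%C.
Proof. unfold expi. rewrite cos_plus, sin_plus. apply injective_projections; simpl; ring. Qed.

Lemma expi_0 : expi 0 = 1%C.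
Proof. unfold expi. rewrite cos_0, sin_0. reflexivity. Qed.

Lemma expi_opp_mult t : (expi (- t) * expi t = 1)%C.
Proof. rewrite <- expi_plus, Rplus_opp_l. apply expi_0. Qed.

Lemma expi_2PI t : expi (t + 2 * PI) = expi t.
Proof. unfold expi. rewrite cos_plus, sin_plus, cos_2PI, sin_2PI. apply injective_projections; simpl; ring. Qed.

Lemma expi_lip s t : Cmod (expi s - expi t) <= 2 * Rabs (s - t).
Proof.
  eapply Rle_trans; [apply Cmod_le_sum|]. simpl.
  pose proof (Rabs_cos_diff s t). pose proof (Rabs_sin_diff s t).
  replace (cos s + - cos t) with (cos s - cos t) by ring.
  replace (sin s + - sin t) with (sin s - sin t) by ring. lra.
Qed.

(** Continuity by components, the form in which the real integration lemmas ask for it. *)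
Definition contC (f : R -> C) : Prop :=
  forall t, continuous (fun s => fst (f s)) t /\ continuous (fun s => snd (f s)) t.

Definition Cint (f : R -> C) (a b : R) : C :=
  (RInt (fun t => fst (f t)) a b, RInt (fun t => snd (f t)) a b).

Lemma continuous_eps (f : R -> R) (t : R) :
  (forall eps, 0 < eps -> exists d, 0 < d /\ forall s, Rabs (s - t) < d -> Rabs (f s - f t) < eps)
  -> continuous f t.
Proof.
  intros H. apply continuity_pt_filterlim.
  intros eps Heps. destruct (H eps Heps) as [d [Hd Hs]].
  exists d. split; [exact Hd|]. intros x [_ Hx]. apply Hs. exact Hx.
Qed.

Lemma continuous_eps_inv (f : R -> R) (t eps : R) :
  continuous f t -> 0 < eps ->
  exists d, 0 < d /\ forall s, Rabs (s - t) < d -> Rabs (f s - f t) < eps.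
Proof.
  intros H Heps. apply continuity_pt_filterlim in H. destruct (H eps Heps) as [d [Hd Hs]].
  exists d. split; [exact Hd|]. intros s Hx.
  destruct (Req_dec s t) as [->|Hne].
  - rewrite Rminus_eq_0, Rabs_R0. exact Heps.
  - apply Hs. split; [split; [exact I | auto] | exact Hx].
Qed.

Lemma contC_eps (f : R -> C) :
  (forall t eps, 0 < eps -> exists d, 0 < d /\ forall s, Rabs (s - t) < d -> Cmod (f s - f t) < eps)
  -> contC f.
Proof.
  intros H t. split; apply continuous_eps; intros eps He; destruct (H t eps He) as [d [Hd Hs]];
  exists d; (split; [exact Hd|]); intros s Hst; eapply Rle_lt_trans; try apply (Hs s Hst).
  - apply (fst_le_Cmod (f s - f t)%C).
  - apply (snd_le_Cmod (f s - f t)%C).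
Qed.

Lemma contC_eps_inv (f : R -> C) t eps : contC f -> 0 < eps ->
  exists d, 0 < d /\ forall s, Rabs (s - t) < d -> Cmod (f s - f t) < eps.
Proof.
  intros H He. destruct (H t) as [H1 H2].
  destruct (continuous_eps_inv _ _ (eps / 2) H1) as [d1 [Hd1 K1]]; [lra|].
  destruct (continuous_eps_inv _ _ (eps / 2) H2) as [d2 [Hd2 K2]]; [lra|].
  exists (Rmin d1 d2). split; [apply Rmin_glb_lt; assumption|].
  intros s Hs. eapply Rle_lt_trans; [apply Cmod_le_sum|].
  assert (Rabs (s - t) < d1) by (eapply Rlt_le_trans; [exact Hs | apply Rmin_l]).
  assert (Rabs (s - t) < d2) by (eapply Rlt_le_trans; [exact Hs | apply Rmin_r]).
  specialize (K1 s H0). specialize (K2 s H3). simpl.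
  unfold Rminus in K1, K2. lra.
Qed.

Definition LipRC (f : R -> C) : Prop :=
  exists K, 0 <= K /\ forall s t, Cmod (f s - f t) <= K * Rabs (s - t).

Lemma LipRC_contC f : LipRC f -> contC f.
Proof.
  intros [K [HK H]]. apply contC_eps. intros t eps He.
  exists (eps / (K + 1)). split; [apply Rdiv_lt_0_compat; lra|].
  intros s Hs. eapply Rle_lt_trans; [apply H|].
  apply Rmult_lt_compat_l with (r := K + 1) in Hs; [|lra].
  replace ((K + 1) * (eps / (K + 1))) with eps in Hs by (field; lra).
  pose proof (Rabs_pos (s - t)). nra.
Qed.

Lemma contC_const c : contC (fun _ => c).
Proof. intros t; split; apply continuous_const. Qed.

Lemma contC_plus f g : contC f -> contC g -> contC (fun t => f t + g t)%C.
Proof.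
  intros Hf Hg t. destruct (Hf t), (Hg t). simpl.
  split; apply (continuous_plus (V := R_NormedModule)); assumption.
Qed.

Lemma contC_mult f g : contC f -> contC g -> contC (fun t => f t * g t)%C.
Proof.
  intros Hf Hg t. destruct (Hf t), (Hg t). simpl.
  split; [apply (continuous_minus (V := R_NormedModule)) | apply (continuous_plus (V := R_NormedModule))];
  apply (continuous_mult (K := R_AbsRing)); assumption.
Qed.

Lemma contC_scal c f : contC f -> contC (fun t => c * f t)%C.
Proof. intros; apply contC_mult; [apply contC_const | assumption]. Qed.

Lemma contC_minus f g : contC f -> contC g -> contC (fun t => f t - g t)%C.
Proof.
  intros Hf Hg t. destruct (Hf t), (Hg t). simpl.
  split; apply (continuous_minus (V := R_NormedModule)); assumption.
Qed.

Lemma contC_RtoC (f : R -> R) : (forall t, continuous f t) -> contC (fun t => RtoC (f t)).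
Proof. intros H t. split; [apply H | apply continuous_const]. Qed.

Lemma expi_contC (s : R) : contC (fun t => expi (s * t)).
Proof.
  apply LipRC_contC. exists (2 * Rabs s). split; [pose proof (Rabs_pos s); lra|].
  intros u v. eapply Rle_trans; [apply expi_lip|].
  replace (s * u - s * v) with (s * (u - v)) by ring. rewrite Rabs_mult. lra.
Qed.

Lemma ex_RInt_cont (f : R -> R) a b : (forall t, continuous f t) -> ex_RInt f a b.
Proof. intros H. apply (ex_RInt_continuous (V := R_CompleteNormedModule)). intros; apply H. Qed.

Lemma contC_fst f : contC f -> forall t, continuous (fun s => fst (f s)) t.
Proof. exact (fun H t => proj1 (H t)). Qed.

Lemma contC_snd f : contC f -> forall t, continuous (fun s => snd (f s)) t.
Proof. exact (fun H t => proj2 (H t)). Qed.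

#[global] Hint Resolve contC_fst contC_snd ex_RInt_cont : cint.

Lemma Cint_ext f g a b : a <= b -> (forall t, a < t < b -> f t = g t) -> Cint f a b = Cint g a b.
Proof.
  intros Hab H. unfold Cint. f_equal; apply RInt_ext; intros t Ht;
  rewrite Rmin_left, Rmax_right in Ht by assumption; rewrite H; auto.
Qed.

Lemma Cint_plus f g a b : contC f -> contC g ->
  Cint (fun t => f t + g t)%C a b = (Cint f a b + Cint g a b)%C.
Proof.
  intros Hf Hg. unfold Cint. apply injective_projections; simpl;
  apply (RInt_plus (V := R_CompleteNormedModule)); auto with cint.
Qed.

Lemma Cint_scal c f a b : contC f -> Cint (fun t => c * f t)%C a b = (c * Cint f a b)%C.
Proof.
  intros Hf. unfold Cint. destruct c as [x y]. apply injective_projections; simpl.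
  - rewrite (RInt_minus (V := R_CompleteNormedModule) (fun t => x * fst (f t)) (fun t => y * snd (f t))).
    + rewrite !(RInt_scal (V := R_CompleteNormedModule)) by auto with cint. reflexivity.
    + apply (ex_RInt_scal (V := R_NormedModule)); auto with cint.
    + apply (ex_RInt_scal (V := R_NormedModule)); auto with cint.
  - rewrite (RInt_plus (V := R_CompleteNormedModule) (fun t => x * snd (f t)) (fun t => y * fst (f t))).
    + rewrite !(RInt_scal (V := R_CompleteNormedModule)) by auto with cint. reflexivity.
    + apply (ex_RInt_scal (V := R_NormedModule)); auto with cint.
    + apply (ex_RInt_scal (V := R_NormedModule)); auto with cint.
Qed.

Lemma Cint_minus f g a b : contC f -> contC g ->
  Cint (fun t => f t - g t)%C a b = (Cint f a b - Cint g a b)%C.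
Proof.
  intros Hf Hg. unfold Cint. apply injective_projections; simpl;
  apply (RInt_minus (V := R_CompleteNormedModule)); auto with cint.
Qed.

Lemma Cint_const c a b : Cint (fun _ => c) a b = (RtoC (b - a) * c)%C.
Proof.
  unfold Cint. rewrite !RInt_const. apply injective_projections; simpl;
  unfold scal; simpl; unfold mult; simpl; ring.
Qed.

Lemma Cint_Chasles f a b c : contC f -> (Cint f a b + Cint f b c)%C = Cint f a c.
Proof.
  intros Hf. unfold Cint. apply injective_projections; simpl;
  apply (RInt_Chasles (V := R_CompleteNormedModule)); auto with cint.
Qed.

Lemma Cint_RtoC (f : R -> R) a b : Cint (fun t => RtoC (f t)) a b = RtoC (RInt f a b).
Proof.
  unfold Cint, RtoC; simpl. f_equal. rewrite RInt_const. apply Rmult_0_r.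
Qed.

(** The factor 2 comes from bounding real and imaginary parts separately. It is harmless, as only
    rates in 1 - r matter later. *)
Lemma Cint_bound f (g : R -> R) a b : a <= b -> contC f -> (forall t, continuous g t) ->
  (forall t, a <= t <= b -> Cmod (f t) <= g t) -> Cmod (Cint f a b) <= 2 * RInt g a b.
Proof.
  intros Hab Hf Hg H. eapply Rle_trans; [apply Cmod_le_sum|]. unfold Cint; simpl.
  assert (forall h : R -> R, (forall t, continuous h t) -> (forall t, a <= t <= b -> Rabs (h t) <= g t) ->
     Rabs (RInt h a b) <= RInt g a b) as Hh.
  { intros h Hh Hb. eapply Rle_trans; [apply abs_RInt_le; auto with cint|].
    apply RInt_le; auto with cint.
    - apply ex_RInt_cont. intros t. apply (continuous_comp h Rabs); auto. apply continuous_Rabs.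
    - intros; apply Hb; lra. }
  assert (K1 := Hh (fun t => fst (f t)) (contC_fst f Hf)).
  assert (K2 := Hh (fun t => snd (f t)) (contC_snd f Hf)).
  enough (Rabs (RInt (fun t => fst (f t)) a b) <= RInt g a b /\
          Rabs (RInt (fun t => snd (f t)) a b) <= RInt g a b) by lra.
  split; [apply K1 | apply K2]; intros t Ht; eapply Rle_trans; try apply (H t Ht);
  [apply fst_le_Cmod | apply snd_le_Cmod].
Qed.

Lemma Cint_bound_const f m a b : a <= b -> contC f ->
  (forall t, a <= t <= b -> Cmod (f t) <= m) -> Cmod (Cint f a b) <= 2 * ((b - a) * m).
Proof.
  intros Hab Hf H. eapply Rle_trans; [apply (Cint_bound f (fun _ => m)); auto|].
  - intros; apply continuous_const.
  - rewrite RInt_const. apply Rle_refl.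
Qed.

Lemma RInt_abs_bound (h : R -> R) m a b : a <= b -> (forall t, continuous h t) ->
  (forall t, a <= t <= b -> Rabs (h t) <= m) -> Rabs (RInt h a b) <= (b - a) * m.
Proof. intros. apply abs_RInt_le_const; auto with cint. Qed.

(** * Uniform limits of polynomials on a circle *)

(** Horner form: structural induction splits off the constant term, which is all that the mean over
    a circle sees. *)
Inductive Pol (b : R -> C) : (R -> C) -> Prop :=
| Pol_const c : Pol b (fun _ => c)
| Pol_step c G : Pol b G -> Pol b (fun t => c + b t * G t)%C.

(** What is used of the circle of radius r: positive powers of [b] have mean zero. This holds for r
    e^{it} and also for the reversed circle, which occurs as [mu lam]. *)
Definition mean_base (b : R -> C) (r : R) : Prop :=
  contC b /\ (forall t, Cmod (b t) <= r) /\
  forall n, Cint (fun t => b t ^ S n)%C 0 (2 * PI) = 0%C.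

Lemma Pol_eq b G H : Pol b G -> (forall t, H t = G t) -> Pol b H.
Proof. intros HG E. replace H with G; [exact HG|]. apply functional_extensionality. intros; symmetry; apply E. Qed.

Lemma Pol_contC b G : contC b -> Pol b G -> contC G.
Proof.
  intros Hb. induction 1; [apply contC_const|].
  apply contC_plus; [apply contC_const|]. apply contC_mult; assumption.
Qed.

Lemma Pol_scal b k G : Pol b G -> Pol b (fun t => k * G t)%C.
Proof.
  induction 1 as [c|c G HG IH]; [apply Pol_const|].
  eapply Pol_eq; [apply (Pol_step b (k * c)%C _ IH)|]. intros; cbv beta; ring.
Qed.

Lemma Pol_plus b G H : Pol b G -> Pol b H -> Pol b (fun t => G t + H t)%C.
Proof.
  intros HG. revert H. induction HG as [c|c G HG IH]; intros H HH.
  - destruct HH as [d|d H HH]; [apply Pol_const|].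
    eapply Pol_eq; [apply (Pol_step b (c + d)%C _ HH)|]. intros; cbv beta; ring.
  - destruct HH as [d|d H HH].
    + eapply Pol_eq; [apply (Pol_step b (c + d)%C _ HG)|]. intros; cbv beta; ring.
    + eapply Pol_eq; [apply (Pol_step b (c + d)%C _ (IH _ HH))|]. intros; cbv beta; ring.
Qed.

Lemma Pol_mult b G H : Pol b G -> Pol b H -> Pol b (fun t => G t * H t)%C.
Proof.
  intros HG HH. induction HG as [c|c G HG IH]; [apply Pol_scal; assumption|].
  eapply Pol_eq; [apply Pol_plus; [apply (Pol_scal b c _ HH) | apply (Pol_step b 0%C _ IH)]|].
  intros; cbv beta; ring.
Qed.

Lemma Pol_bounded b r G : (forall t, Cmod (b t) <= r) -> Pol b G ->
  exists m, 0 <= m /\ forall t, Cmod (G t) <= m.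
Proof.
  intros Hb. assert (0 <= r) as Hr by (eapply Rle_trans; [apply Cmod_ge_0 | apply (Hb 0)]).
  induction 1 as [c|c G HG [m [Hm IH]]].
  - exists (Cmod c). split; [apply Cmod_ge_0 | intros; lra].
  - exists (Cmod c + r * m). split; [pose proof (Cmod_ge_0 c); nra|].
    intros t. eapply Rle_trans; [apply Cmod_triangle|]. rewrite Cmod_mult.
    apply Rplus_le_compat_l. apply Rmult_le_compat; auto using Cmod_ge_0.
Qed.

Lemma mean_base_Pol b r G n : mean_base b r -> Pol b G ->
  Cint (fun t => b t ^ S n * G t)%C 0 (2 * PI) = 0%C.
Proof.
  intros [Hc [_ Hm]] HG. revert n. pose proof PI_RGT_0.
  assert (forall n, contC (fun t => b t ^ n)%C) as Hp.
  { induction n; simpl; [apply contC_const | apply contC_mult; assumption]. }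
  induction HG as [c|c G HG IH]; intros n.
  - rewrite (Cint_ext _ (fun t => c * b t ^ S n)%C); [|lra|intros; ring].
    rewrite Cint_scal by apply Hp. rewrite Hm. ring.
  - rewrite (Cint_ext _ (fun t => c * b t ^ S n + b t ^ S (S n) * G t)%C); [|lra|intros; cbv beta; rewrite !Cpow_S; ring].
    rewrite Cint_plus, Cint_scal, Hm, IH; auto.
    + ring.
    + apply contC_scal, Hp.
    + apply contC_mult; [apply Hp | eapply Pol_contC; eauto].
Qed.

(** The mean picks the constant term, and taking constant terms is multiplicative. *)
Lemma Pol_mean_mult b r G H : mean_base b r -> Pol b G -> Pol b H ->
  (RtoC (2 * PI) * Cint (fun t => G t * H t) 0 (2 * PI) = Cint G 0 (2 * PI) * Cint H 0 (2 * PI))%C.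
Proof.
  intros Hb HG HH. pose proof PI_RGT_0. pose proof (proj1 Hb) as Hc.
  assert (forall G, Pol b G -> Cint (fun t => b t * G t)%C 0 (2 * PI) = 0%C) as Z0.
  { intros K HK. rewrite <- (mean_base_Pol b r K 0 Hb HK). apply Cint_ext; [lra|].
    intros; cbv beta; rewrite Cpow_1_r; ring. }
  destruct HG as [c|c G HG].
  - rewrite Cint_scal, Cint_const by (eapply Pol_contC; eauto). rewrite Rminus_0_r. ring.
  - rewrite (Cint_ext _ (fun t => c * H t + b t * (G t * H t))%C); [|lra|intros; ring].
    assert (Pol b (fun t => G t * H t)%C) as HGH by (apply Pol_mult; assumption).
    pose proof (Pol_contC b _ Hc HG) as CG. pose proof (Pol_contC b _ Hc HH) as CH.
    pose proof (Pol_contC b _ Hc HGH) as CGH.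
    rewrite (Cint_plus _ _ _ _ (contC_scal c _ CH) (contC_mult _ _ Hc CGH)), (Cint_scal c _ _ _ CH), (Z0 _ HGH).
    rewrite (Cint_plus _ _ _ _ (contC_const c) (contC_mult _ _ Hc CG)), Cint_const, (Z0 _ HG).
    rewrite Rminus_0_r. ring.
Qed.

(** For [b t] = r e^{it} this is the disc algebra restricted to the circle |lam| = r; uniform limits
    of polynomials stand in for holomorphic functions. *)
Definition An (b : R -> C) (G : R -> C) : Prop :=
  forall eps, 0 < eps -> exists P, Pol b P /\ forall t, Cmod (G t - P t) <= eps.

Lemma An_Pol b G : Pol b G -> An b G.
Proof.
  intros H eps He. exists G. split; [exact H|]. intros t.
  replace (G t - G t)%C with (RtoC 0) by ring. rewrite Cmod_0. lra.
Qed.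

Lemma An_const b c : An b (fun _ => c).
Proof. apply An_Pol, Pol_const. Qed.

Lemma An_base b : An b b.
Proof.
  apply An_Pol. eapply Pol_eq; [apply (Pol_step b 0%C _ (Pol_const b 1%C))|].
  intros; cbv beta; ring.
Qed.

Lemma An_lim b G : (forall eps, 0 < eps -> exists H, An b H /\ forall t, Cmod (G t - H t) <= eps) -> An b G.
Proof.
  intros HG eps He. destruct (HG (eps / 2)) as [H [HH H1]]; [lra|].
  destruct (HH (eps / 2)) as [P [HP H2]]; [lra|].
  exists P. split; [exact HP|]. intros t.
  eapply Rle_trans; [apply (Cmod_dist_triangle _ (H t))|].
  specialize (H1 t). specialize (H2 t). lra.
Qed.

Lemma An_eq b G H : An b G -> (forall t, H t = G t) -> An b H.
Proof.
  intros HG E eps He. destruct (HG eps He) as [P [HP K]]. exists P. split; [exact HP|].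
  intros t. rewrite E. apply K.
Qed.

Lemma An_plus b G H : An b G -> An b H -> An b (fun t => G t + H t)%C.
Proof.
  intros HG HH eps He. destruct (HG (eps / 2)) as [P [HP K]]; [lra|].
  destruct (HH (eps / 2)) as [Q [HQ L]]; [lra|].
  exists (fun t => P t + Q t)%C. split; [apply Pol_plus; assumption|]. intros t.
  replace (G t + H t - (P t + Q t))%C with ((G t - P t) + (H t - Q t))%C by ring.
  eapply Rle_trans; [apply Cmod_triangle|]. specialize (K t). specialize (L t). lra.
Qed.

Lemma An_bounded b r G : (forall t, Cmod (b t) <= r) -> An b G ->
  exists m, 0 <= m /\ forall t, Cmod (G t) <= m.
Proof.
  intros Hb HG. destruct (HG 1) as [P [HP K]]; [lra|].
  destruct (Pol_bounded b r P Hb HP) as [m [Hm L]].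
  exists (1 + m). split; [lra|]. intros t.
  replace (G t) with ((G t - P t) + P t)%C by ring.
  eapply Rle_trans; [apply Cmod_triangle|]. specialize (K t). specialize (L t). lra.
Qed.

Lemma An_contC b G : contC b -> An b G -> contC G.
Proof.
  intros Hb HG. apply contC_eps. intros t eps He.
  destruct (HG (eps / 4)) as [P [HP K]]; [lra|].
  destruct (contC_eps_inv P t (eps / 4)) as [d [Hd L]]; [eapply Pol_contC; eauto | lra |].
  exists d. split; [exact Hd|]. intros s Hs.
  eapply Rle_lt_trans; [apply (Cmod_dist_triangle _ (P s))|].
  pose proof (Cmod_dist_triangle (P s) (P t) (G t)) as T. rewrite (Cmod_minus_sym (P t)) in T.
  pose proof (K s). pose proof (K t). specialize (L s Hs). lra.
Qed.

Lemma An_mult b r G H : (forall t, Cmod (b t) <= r) -> An b G -> An b H ->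
  An b (fun t => G t * H t)%C.
Proof.
  intros Hb HG HH eps He.
  destruct (An_bounded b r H Hb HH) as [m [Hm BH]].
  destruct (HG (eps / (2 * (m + 1)))) as [P [HP K]]; [apply Rdiv_lt_0_compat; lra|].
  destruct (Pol_bounded b r P Hb HP) as [p [Hp BP]].
  destruct (HH (eps / (2 * (p + 1)))) as [Q [HQ L]]; [apply Rdiv_lt_0_compat; lra|].
  exists (fun t => P t * Q t)%C. split; [apply Pol_mult; assumption|]. intros t.
  eapply Rle_trans; [apply Cmod_mult_diff|].
  specialize (BH t). specialize (K t). specialize (BP t). specialize (L t).
  assert (Cmod (G t - P t) * Cmod (H t) <= eps / (2 * (m + 1)) * (m + 1)).
  { apply Rmult_le_compat; try apply Cmod_ge_0; lra. }
  assert (Cmod (P t) * Cmod (H t - Q t) <= (p + 1) * (eps / (2 * (p + 1)))).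
  { apply Rmult_le_compat; try apply Cmod_ge_0; lra. }
  replace (eps / (2 * (m + 1)) * (m + 1)) with (eps / 2) in * by (field; lra).
  replace ((p + 1) * (eps / (2 * (p + 1)))) with (eps / 2) in * by (field; lra). lra.
Qed.

Lemma An_scal b r k G : (forall t, Cmod (b t) <= r) -> An b G -> An b (fun t => k * G t)%C.
Proof. intros. eapply An_mult; eauto. apply An_const. Qed.

Lemma An_pow b r G n : (forall t, Cmod (b t) <= r) -> An b G -> An b (fun t => G t ^ n)%C.
Proof.
  intros Hb HG. induction n; simpl; [apply An_const|]. eapply An_mult; eauto.
Qed.

Lemma Czero_of_small (z : C) (K : R) : (forall eps, 0 < eps -> Cmod z <= K * eps) -> z = 0%C.
Proof.
  intros H. apply Cmod_eq_0. apply Rle_antisym; [|apply Cmod_ge_0].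
  apply Rnot_lt_le. intros Hz.
  assert (0 < Rabs K + 1) by (pose proof (Rabs_pos K); lra).
  specialize (H (Cmod z / (2 * (Rabs K + 1)))).
  assert (0 < Cmod z / (2 * (Rabs K + 1))) as Hp by (apply Rdiv_lt_0_compat; lra).
  specialize (H Hp).
  assert (K * (Cmod z / (2 * (Rabs K + 1))) <= (Rabs K + 1) * (Cmod z / (2 * (Rabs K + 1)))).
  { apply Rmult_le_compat_r; [lra|]. pose proof (Rle_abs K). lra. }
  replace ((Rabs K + 1) * (Cmod z / (2 * (Rabs K + 1)))) with (Cmod z / 2) in H1 by (field; lra).
  lra.
Qed.

Lemma Cint_close f g a b eps : a <= b -> contC f -> contC g ->
  (forall t, Cmod (f t - g t) <= eps) -> Cmod (Cint f a b - Cint g a b) <= 2 * ((b - a) * eps).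
Proof.
  intros Hab Hf Hg H. rewrite <- Cint_minus by assumption.
  apply Cint_bound_const; auto. apply contC_minus; assumption.
Qed.

Lemma An_mean_mult b r G H : mean_base b r -> An b G -> An b H ->
  (RtoC (2 * PI) * Cint (fun t => G t * H t) 0 (2 * PI) = Cint G 0 (2 * PI) * Cint H 0 (2 * PI))%C.
Proof.
  intros Hb HG HH. pose proof Hb as [Hc [Hr _]]. pose proof PI_RGT_0.
  destruct (An_bounded b r G Hr HG) as [mG [HmG BG]].
  destruct (An_bounded b r H Hr HH) as [mH [HmH BH]].
  assert (forall X, An b X -> contC X) as Hcont by (intros; eapply An_contC; eauto).
  pose (p := 2 * PI).
  (* [e <= 1] bounds the approximants by [mG + 1] and so makes the total error linear in [e]. *)
  assert (forall e, 0 < e -> e <= 1 ->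
    Cmod (RtoC p * Cint (fun t => G t * H t) 0 p - Cint G 0 p * Cint H 0 p)%C
    <= (p * (2 * (p * (mH + (mG + 1)))) + (2 * (p * 1)) * (2 * (p * mH)) + (2 * (p * (mG + 1))) * (2 * (p * 1))) * e) as Key.
  { intros e He He1. destruct (HG e He) as [P [HP KP]]. destruct (HH e He) as [Q [HQ KQ]].
    pose proof (Pol_mean_mult b r P Q Hb HP HQ) as E. fold p in E.
    pose proof (Hcont _ (An_Pol _ _ HP)) as cP. pose proof (Hcont _ (An_Pol _ _ HQ)) as cQ.
    pose proof (Hcont _ HG) as cG. pose proof (Hcont _ HH) as cH.
    assert (0 < p) by (unfold p; lra).
    assert (forall t, Cmod (P t) <= mG + 1) as BP.
    { intros t. replace (P t) with (G t - (G t - P t))%C by ring.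
      eapply Rle_trans; [apply Cmod_triangle_minus|]. specialize (BG t). specialize (KP t). lra. }
    assert (Cmod (Cint (fun t => G t * H t) 0 p - Cint (fun t => P t * Q t) 0 p)%C
             <= 2 * ((p - 0) * ((mH + (mG + 1)) * e))) as D1.
    { apply Cint_close; [lra | apply contC_mult; assumption | apply contC_mult; assumption |].
      intros t. eapply Rle_trans; [apply Cmod_mult_diff|].
      assert (Cmod (G t - P t) * Cmod (H t) <= e * mH)
        by (apply Rmult_le_compat; auto using Cmod_ge_0).
      assert (Cmod (P t) * Cmod (H t - Q t) <= (mG + 1) * e)
        by (apply Rmult_le_compat; auto using Cmod_ge_0). lra. }
    assert (Cmod (Cint G 0 p - Cint P 0 p)%C <= 2 * ((p - 0) * e)) as D2 by (apply Cint_close; auto; lra).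
    assert (Cmod (Cint H 0 p - Cint Q 0 p)%C <= 2 * ((p - 0) * e)) as D3 by (apply Cint_close; auto; lra).
    assert (Cmod (Cint H 0 p) <= 2 * ((p - 0) * mH)) as D4 by (apply Cint_bound_const; auto; lra).
    assert (Cmod (Cint P 0 p) <= 2 * ((p - 0) * (mG + 1))) as D5 by (apply Cint_bound_const; auto; lra).
    rewrite Rminus_0_r in *.
    replace (RtoC p * Cint (fun t => G t * H t) 0 p - Cint G 0 p * Cint H 0 p)%C
      with (RtoC p * (Cint (fun t => G t * H t) 0 p - Cint (fun t => P t * Q t) 0 p)
            - (Cint G 0 p * Cint H 0 p - Cint P 0 p * Cint Q 0 p))%C by (rewrite <- E; ring).
    eapply Rle_trans; [apply Cmod_triangle_minus|].
    pose proof (Cmod_mult_diff (Cint G 0 p) (Cint H 0 p) (Cint P 0 p) (Cint Q 0 p)) as D6.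
    rewrite Cmod_mult, Cmod_R, (Rabs_pos_eq p) by lra.
    assert (Cmod (Cint G 0 p - Cint P 0 p) * Cmod (Cint H 0 p) <= (2 * (p * e)) * (2 * (p * mH)))
      by (apply Rmult_le_compat; auto using Cmod_ge_0).
    assert (Cmod (Cint P 0 p) * Cmod (Cint H 0 p - Cint Q 0 p) <= (2 * (p * (mG + 1))) * (2 * (p * e)))
      by (apply Rmult_le_compat; auto using Cmod_ge_0).
    apply Rmult_le_compat_l with (r := p) in D1; [|lra]. nra. }
  match type of Key with forall e, _ -> _ -> _ <= ?k * e => set (K := k) in Key end.
  assert (0 <= K). { assert (0 < p) by (unfold p; lra). unfold K.
    repeat match goal with |- 0 <= _ + _ => apply Rplus_le_le_0_compat | |- 0 <= _ * _ => apply Rmult_le_pos end; lra. }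
  assert (RtoC p * Cint (fun t => G t * H t) 0 p - Cint G 0 p * Cint H 0 p = 0)%C as E.
  { apply (Czero_of_small _ K). intros eps He. destruct (Rle_lt_dec eps 1); [apply Key; lra|].
    eapply Rle_trans; [apply (Key 1); lra|]. nra. }
  fold p. rewrite <- (Cplus_0_r (Cint G 0 p * Cint H 0 p)%C), <- E. ring.
Qed.

Lemma Cmod_one_minus_ge x q : Cmod x <= q -> 1 - q <= Cmod (1 - x).
Proof.
  intros H. pose proof (Cmod_triangle (1 - x) x) as T.
  replace (1 - x + x)%C with (RtoC 1) in T by ring. rewrite Cmod_1 in T. lra.
Qed.

Lemma one_minus_neq_0 x q : Cmod x <= q -> q < 1 -> (1 - x <> 0)%C.
Proof. intros H Hq. apply Cmod_gt_0. pose proof (Cmod_one_minus_ge x q H). lra. Qed.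

(** Geometric series. The partial sums are built by S -> 1 + X S, and their remainder is exactly X^n
    / (1 - X), of size at most q^n / (1 - q). *)
Lemma An_inv b r X q : (forall t, Cmod (b t) <= r) -> An b X -> (forall t, Cmod (X t) <= q) -> q < 1 ->
  An b (fun t => / (1 - X t))%C.
Proof.
  intros Hb HX Hq q1. assert (0 <= q) by (eapply Rle_trans; [apply Cmod_ge_0 | apply (Hq 0)]).
  apply An_lim. intros eps He.
  destruct (pow_lt_1_zero q) with (y := eps * (1 - q)) as [N HN].
  { rewrite Rabs_pos_eq; lra. } { apply Rmult_lt_0_compat; lra. }
  assert (forall n, exists S, An b S /\ forall t, (/ (1 - X t) - S t = X t ^ n / (1 - X t))%C) as HS.
  { induction n as [|n [S [HS E]]].
    - exists (fun _ => 0%C). split; [apply An_const|]. intros t. simpl.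
      pose proof (one_minus_neq_0 _ _ (Hq t) q1). field. assumption.
    - exists (fun t => 1 + X t * S t)%C. split.
      + apply An_plus; [apply An_const|]. eapply An_mult; eauto.
      + intros t. simpl. pose proof (one_minus_neq_0 _ _ (Hq t) q1).
        specialize (E t).
        replace (X t * X t ^ n / (1 - X t))%C with (X t * (X t ^ n / (1 - X t)))%C by (field; assumption).
        rewrite <- E. field. assumption. }
  destruct (HS N) as [S [HSA E]]. exists S. split; [exact HSA|]. intros t. rewrite E.
  pose proof (one_minus_neq_0 _ _ (Hq t) q1). rewrite Cmod_div by assumption. rewrite Cmod_pow.
  specialize (HN N (Nat.le_refl _)).
  assert (0 <= q ^ N) by (apply pow_le; assumption). rewrite Rabs_pos_eq in HN by assumption.
  pose proof (Cmod_one_minus_ge _ _ (Hq t)).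
  assert (Cmod (X t) ^ N <= q ^ N) by (apply pow_incr; split; [apply Cmod_ge_0 | apply Hq]).
  apply Rmult_le_reg_r with (Cmod (1 - X t)); [lra|]. unfold Rdiv.
  rewrite Rmult_assoc, Rinv_l by lra. nra.
Qed.

(* Riemann sums by repeated bisection *)
Lemma An_int b r (G : R -> R -> C) L u v : (forall t, Cmod (b t) <= r) -> 0 <= L -> u <= v ->
  (forall y, An b (G y)) ->
  (forall y y' t, Cmod (G y t - G y' t) <= L * Rabs (y - y')) ->
  An b (fun t => Cint (fun y => G y t) u v).
Proof.
  intros Hb HL Huv HG HLip.
  assert (forall t, contC (fun y => G y t)) as Hc.
  { intros t. apply LipRC_contC. exists L. split; auto. }
  (* The one-point rule errs quadratically in the length of the interval, so every bisection halves
     the total error. *)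
  assert (forall n u v, u <= v -> exists H, An b H /\
     forall t, Cmod (Cint (fun y => G y t) u v - H t) <= 2 * L * (v - u) ^ 2 / 2 ^ n) as HS.
  { induction n as [|n IH]; intros a c Hac.
    - exists (fun t => RtoC (c - a) * G a t)%C. split; [eapply An_scal; eauto|].
      intros t. rewrite <- Cint_const. rewrite <- Cint_minus by (auto; apply contC_const).
      eapply Rle_trans; [apply Cint_bound_const with (m := L * (c - a)); auto|].
      + apply contC_minus; [auto | apply contC_const].
      + intros y Hy. eapply Rle_trans; [apply HLip|].
        apply Rmult_le_compat_l; [assumption|]. rewrite Rabs_pos_eq; lra.
      + simpl. lra.
    - destruct (IH a ((a + c) / 2)) as [H1 [HH1 E1]]; [lra|].
      destruct (IH ((a + c) / 2) c) as [H2 [HH2 E2]]; [lra|].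
      exists (fun t => H1 t + H2 t)%C. split; [apply An_plus; assumption|]. intros t.
      rewrite <- (Cint_Chasles _ a ((a + c) / 2) c) by auto.
      match goal with |- Cmod (?x + ?y - (?h + ?k)) <= _ =>
        replace (x + y - (h + k))%C with ((x - h) + (y - k))%C by ring end.
      eapply Rle_trans; [apply Cmod_triangle|].
      specialize (E1 t). specialize (E2 t).
      assert (2 * L * (c - a) ^ 2 / 2 ^ S n
        = 2 * L * ((a + c) / 2 - a) ^ 2 / 2 ^ n + 2 * L * (c - (a + c) / 2) ^ 2 / 2 ^ n) as ->.
      { simpl. field. apply pow_nonzero. lra. }
      lra. }
  apply An_lim. intros eps He.
  destruct (pow_lt_1_zero (/2)) with (y := eps / (2 * L * (v - u) ^ 2 + 1)) as [N HN].
  { rewrite Rabs_pos_eq; lra. }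
  { apply Rdiv_lt_0_compat; [lra|]. pose proof (pow2_ge_0 (v - u)). nra. }
  destruct (HS N u v Huv) as [H [HH E]]. exists H. split; [exact HH|]. intros t.
  eapply Rle_trans; [apply E|]. specialize (HN N (Nat.le_refl _)).
  rewrite pow_inv in HN. rewrite Rabs_pos_eq in HN by (left; apply Rinv_0_lt_compat, pow_lt; lra).
  pose proof (pow2_ge_0 (v - u)).
  assert (0 <= 2 * L * (v - u) ^ 2) by nra.
  unfold Rdiv at 1. eapply Rle_trans; [apply Rmult_le_compat_l; [assumption | left; apply HN]|].
  apply Rmult_le_reg_r with (2 * L * (v - u) ^ 2 + 1); [lra|].
  unfold Rdiv. rewrite !Rmult_assoc, Rinv_l by lra. nra.
Qed.

(** * The complex exponential *)

Lemma MVT_0 (f df : R -> R) (x : R) : (forall t, derivable_pt_lim f t (df t)) ->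
  exists c, Rabs c <= Rabs x /\ f x - f 0 = df c * x.
Proof.
  intros H. destruct (MVT_gen f 0 x df) as [c [Hc E]].
  - intros; apply is_derive_Reals, H.
  - intros t _. apply derivable_continuous_pt. exists (df t). apply H.
  - exists c. rewrite Rminus_0_r in E. split; [|exact E].
    destruct (Rle_dec 0 x).
    + rewrite Rmin_left, Rmax_right in Hc by lra. rewrite !Rabs_pos_eq; lra.
    + rewrite Rmin_right, Rmax_left in Hc by lra. rewrite !Rabs_left1; lra.
Qed.

Lemma exp_le x y : x <= y -> exp x <= exp y.
Proof. intros [H| ->]; [left; apply exp_increasing, H | lra]. Qed.

Lemma exp_le_Rabs x : exp x <= exp (Rabs x).
Proof. apply exp_le, Rle_abs. Qed.

Lemma exp_minus_1_bound x : Rabs (exp x - 1) <= Rabs x * exp (Rabs x).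
Proof.
  destruct (MVT_0 exp exp x derivable_pt_lim_exp) as [c [Hc E]].
  rewrite exp_0 in E. rewrite E, Rabs_mult, Rmult_comm, (Rabs_pos_eq (exp c)) by (left; apply exp_pos).
  apply Rmult_le_compat_l; [apply Rabs_pos|].
  apply exp_le. eapply Rle_trans; [apply Rle_abs | exact Hc].
Qed.

Lemma exp_taylor1_bound x : Rabs (exp x - 1 - x) <= x ^ 2 * exp (Rabs x).
Proof.
  destruct (MVT_0 (fun t => exp t - t) (fun t => exp t - 1) x) as [c [Hc E]].
  { intros t. apply derivable_pt_lim_minus; [apply derivable_pt_lim_exp | apply derivable_pt_lim_id]. }
  rewrite exp_0 in E. replace (exp x - 1 - x) with ((exp c - 1) * x) by lra.
  rewrite Rabs_mult, <- (pow2_abs x). pose proof (exp_minus_1_bound c) as B.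
  pose proof (Rabs_pos c). pose proof (exp_le _ _ Hc). pose proof (exp_pos (Rabs c)).
  assert (Rabs c * exp (Rabs c) <= Rabs x * exp (Rabs x)) by (apply Rmult_le_compat; lra).
  replace (Rabs x ^ 2 * exp (Rabs x)) with ((Rabs x * exp (Rabs x)) * Rabs x) by ring.
  apply Rmult_le_compat_r; [apply Rabs_pos | lra].
Qed.

Lemma cos_minus_1_bound y : Rabs (cos y - 1) <= y ^ 2.
Proof.
  destruct (MVT_0 cos (fun t => - sin t) y derivable_pt_lim_cos) as [c [Hc E]].
  rewrite cos_0 in E. rewrite E, Rabs_mult, Rabs_Ropp, <- (pow2_abs y).
  pose proof (Rabs_sin_diff c 0) as S. rewrite sin_0, !Rminus_0_r in S.
  simpl. rewrite Rmult_1_r. apply Rmult_le_compat_r; [apply Rabs_pos | lra].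
Qed.

Lemma sin_minus_id_bound y : Rabs (sin y - y) <= y ^ 2.
Proof.
  destruct (MVT_0 (fun t => sin t - t) (fun t => cos t - 1) y) as [c [Hc E]].
  { intros t. apply derivable_pt_lim_minus; [apply derivable_pt_lim_sin | apply derivable_pt_lim_id]. }
  rewrite sin_0 in E. replace (sin y - y) with ((cos c - 1) * y) by lra.
  rewrite Rabs_mult, <- (pow2_abs y).
  pose proof (Rabs_cos_diff c 0) as S. rewrite cos_0, !Rminus_0_r in S.
  simpl. rewrite Rmult_1_r. apply Rmult_le_compat_r; [apply Rabs_pos | lra].
Qed.

Definition cexp (z : C) : C := (RtoC (exp (fst z)) * expi (snd z))%C.

Lemma cexp_plus z w : cexp (z + w) = (cexp z * cexp w)%C.
Proof.
  unfold cexp. simpl. rewrite exp_plus, expi_plus, RtoC_mult. ring.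
Qed.

Lemma cexp_0 : cexp 0 = 1%C.
Proof. unfold cexp. simpl. rewrite exp_0, expi_0. ring. Qed.

Lemma cexp_opp_mult z : (cexp (- z) * cexp z = 1)%C.
Proof. rewrite <- cexp_plus. replace (- z + z)%C with (RtoC 0) by ring. apply cexp_0. Qed.

Lemma Cmod_cexp z : Cmod (cexp z) = exp (fst z).
Proof.
  unfold cexp. rewrite Cmod_mult, Cmod_expi, Cmod_R, Rabs_pos_eq; [ring | left; apply exp_pos].
Qed.

Lemma Cmod_cexp_le z : Cmod (cexp z) <= exp (Cmod z).
Proof.
  rewrite Cmod_cexp. apply exp_le. eapply Rle_trans; [apply Rle_abs | apply fst_le_Cmod].
Qed.

(** Four real remainders, each at most [m ^ 2 * exp m], make up the two components; 5 leaves
    room. *)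
Lemma cexp_taylor1 (w : C) : Cmod (cexp w - 1 - w) <= 5 * Cmod w ^ 2 * exp (Cmod w).
Proof.
  destruct w as [x y]. set (m := Cmod (x, y)).
  assert (Rabs x <= m) as Hx by apply (fst_le_Cmod (x, y)).
  assert (Rabs y <= m) as Hy by apply (snd_le_Cmod (x, y)).
  assert (x ^ 2 <= m ^ 2) as Hx2 by (rewrite <- pow2_abs; apply pow_incr; split; [apply Rabs_pos | exact Hx]).
  assert (y ^ 2 <= m ^ 2) as Hy2 by (rewrite <- pow2_abs; apply pow_incr; split; [apply Rabs_pos | exact Hy]).
  assert (0 <= m) by apply Cmod_ge_0.
  assert (exp (Rabs x) <= exp m) as Ex by (apply exp_le; exact Hx).
  assert (1 <= exp m) as E1 by (rewrite <- exp_0; apply exp_le; assumption).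
  eapply Rle_trans; [apply Cmod_le_sum|]. unfold cexp; simpl fst; simpl snd.
  assert (Rabs (exp x - 1 - x) <= m ^ 2 * exp m) as T1.
  { eapply Rle_trans; [apply exp_taylor1_bound|].
    apply Rmult_le_compat; auto using pow2_ge_0. left; apply exp_pos. }
  assert (Rabs (exp x * (cos y - 1)) <= exp m * m ^ 2) as T2.
  { rewrite Rabs_mult. apply Rmult_le_compat; try apply Rabs_pos.
    - rewrite Rabs_pos_eq by (left; apply exp_pos). eapply Rle_trans; [apply exp_le_Rabs | exact Ex].
    - eapply Rle_trans; [apply cos_minus_1_bound | exact Hy2]. }
  assert (Rabs (exp x * (sin y - y)) <= exp m * m ^ 2) as T3.
  { rewrite Rabs_mult. apply Rmult_le_compat; try apply Rabs_pos.
    - rewrite Rabs_pos_eq by (left; apply exp_pos). eapply Rle_trans; [apply exp_le_Rabs | exact Ex].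
    - eapply Rle_trans; [apply sin_minus_id_bound | exact Hy2]. }
  assert (Rabs ((exp x - 1) * y) <= (m * exp m) * m) as T4.
  { rewrite Rabs_mult. apply Rmult_le_compat; try apply Rabs_pos; [|exact Hy].
    eapply Rle_trans; [apply exp_minus_1_bound|].
    apply Rmult_le_compat; auto using Rabs_pos. left; apply exp_pos. }
  match goal with |- Rabs ?u + Rabs ?v <= _ =>
    replace u with ((exp x - 1 - x) + exp x * (cos y - 1)) by ring;
    replace v with (exp x * (sin y - y) + (exp x - 1) * y) by ring end.
  pose proof (Rabs_triang (exp x - 1 - x) (exp x * (cos y - 1))).
  pose proof (Rabs_triang (exp x * (sin y - y)) ((exp x - 1) * y)).
  pose proof (pow2_ge_0 m).
  replace ((m * exp m) * m) with (exp m * m ^ 2) in T4 by ring.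
  assert (0 <= exp m * m ^ 2) by nra. lra.
Qed.

(** Telescoping sum; [1 <= M] lets the single power [M ^ n] dominate every term. *)
Lemma Cmod_pow_diff (A B : C) (M : R) n : Cmod A <= M -> Cmod B <= M -> 1 <= M ->
  Cmod (A ^ n - B ^ n) <= INR n * M ^ n * Cmod (A - B).
Proof.
  intros HA HB HM. induction n as [|n IH].
  - simpl. replace (1 - 1)%C with (RtoC 0) by ring. rewrite Cmod_0. lra.
  - rewrite !Cpow_S. eapply Rle_trans; [apply Cmod_mult_diff|]. rewrite S_INR, Cmod_pow.
    assert (Cmod A ^ n <= M ^ n) by (apply pow_incr; split; [apply Cmod_ge_0 | exact HA]).
    pose proof (Cmod_ge_0 (A - B)). pose proof (Cmod_ge_0 (A ^ n - B ^ n)). pose proof (Cmod_ge_0 A).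
    assert (M ^ n <= M ^ S n) by (simpl; assert (0 <= M ^ n) by (apply pow_le; lra); nra).
    assert (Cmod (A - B) * Cmod A ^ n <= Cmod (A - B) * M ^ S n) by (apply Rmult_le_compat_l; lra).
    assert (Cmod B * Cmod (A ^ n - B ^ n) <= M * (INR n * M ^ n * Cmod (A - B)))
      by (apply Rmult_le_compat; auto using Cmod_ge_0).
    simpl (M ^ S n) in *. lra.
Qed.

Lemma cexp_pow z n : (cexp z ^ n)%C = cexp (RtoC (INR n) * z).
Proof.
  induction n as [|n IH].
  - simpl. rewrite <- cexp_0. f_equal. ring.
  - rewrite Cpow_S, IH, <- cexp_plus, S_INR, RtoC_plus. f_equal. ring.
Qed.

(* exp G is the uniform limit of (1 + G / n) ^ n *)
Lemma An_exp b r G : (forall t, Cmod (b t) <= r) -> An b G -> An b (fun t => cexp (G t)).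
Proof.
  intros Hb HG. destruct (An_bounded b r G Hb HG) as [m [Hm BG]].
  apply An_lim. intros eps He.
  (* N factors, each with Taylor error at most 5 (m / N)^2 e^m and amplified by at most e^m in
     total, err by K / N. *)
  pose (K := exp m * (5 * m ^ 2 * exp m)).
  assert (0 <= K). { unfold K. pose proof (exp_pos m). pose proof (pow2_ge_0 m). nra. }
  destruct (archimed_cor1 (eps / (K + 1))) as [N [HN N0]]; [apply Rdiv_lt_0_compat; lra|].
  assert (0 < INR N) as Np by (apply lt_0_INR; exact N0).
  exists (fun t => (1 + RtoC (/ INR N) * G t) ^ N)%C. split.
  { apply An_pow with r; [assumption|]. apply An_plus; [apply An_const|]. eapply An_scal; eauto. }
  intros t. set (w := (RtoC (/ INR N) * G t)%C).
  assert (1 <= INR N) as N1 by (replace 1 with (INR 1) by reflexivity; apply le_INR; lia).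
  assert (Cmod w <= m / INR N) as Hw.
  { unfold w. rewrite Cmod_mult, Cmod_R, Rabs_pos_eq by (left; apply Rinv_0_lt_compat; lra).
    unfold Rdiv. rewrite Rmult_comm. apply Rmult_le_compat_r; [left; apply Rinv_0_lt_compat; lra | apply BG]. }
  assert (m / INR N <= m).
  { unfold Rdiv. rewrite <- (Rmult_1_r m) at 2. apply Rmult_le_compat_l; [assumption|].
    rewrite <- Rinv_1. apply Rinv_le_contravar; lra. }
  replace (cexp (G t)) with (cexp w ^ N)%C.
  2: { rewrite cexp_pow. f_equal. unfold w. rewrite RtoC_inv by lra. field.
       intros E. apply RtoC_inj in E. lra. }
  assert (0 <= m / INR N) as Hmn by (eapply Rle_trans; [apply Cmod_ge_0 | exact Hw]).
  eapply Rle_trans; [apply (Cmod_pow_diff _ _ (exp (m / INR N)))|].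
  - eapply Rle_trans; [apply Cmod_cexp_le|]. apply exp_le; exact Hw.
  - eapply Rle_trans; [apply Cmod_triangle|]. rewrite Cmod_1.
    eapply Rle_trans; [|apply exp_ineq1_le]. lra.
  - rewrite <- exp_0. apply exp_le. assumption.
  - assert (exp (m / INR N) ^ N = exp m) as ->.
    { assert (forall n x, exp x ^ n = exp (INR n * x)) as Hp.
      { induction n; intros x; [simpl; rewrite Rmult_0_l, exp_0; reflexivity|].
        rewrite S_INR, Rmult_plus_distr_r, Rmult_1_l, exp_plus, <- IHn. simpl. ring. }
      rewrite Hp. f_equal. field. lra. }
    replace (cexp w - (1 + w))%C with (cexp w - 1 - w)%C by ring.
    assert (Cmod (cexp w - 1 - w) <= 5 * (m / INR N) ^ 2 * exp m) as T.
    { eapply Rle_trans; [apply cexp_taylor1|].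
      assert (Cmod w ^ 2 <= (m / INR N) ^ 2) by (apply pow_incr; split; [apply Cmod_ge_0 | exact Hw]).
      apply Rmult_le_compat; [pose proof (pow2_ge_0 (Cmod w)); lra | left; apply exp_pos | lra |].
      apply exp_le; lra. }
    eapply Rle_trans; [apply Rmult_le_compat_l; [|exact T]|].
    { pose proof (exp_pos m). nra. }
    replace (INR N * exp m * (5 * (m / INR N) ^ 2 * exp m)) with (K * / INR N) by (unfold K; field; lra).
    replace eps with ((K + 1) * (eps / (K + 1))) by (field; lra).
    apply Rmult_le_compat; try lra. left; apply Rinv_0_lt_compat; lra.
Qed.

(** * The Cauchy kernel of the complexified transport operator *)

Lemma expi_INR_2PI n : expi (INR n * (2 * PI)) = 1%C.
Proof.
  induction n as [|n IH].
  - rewrite Rmult_0_l. apply expi_0.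
  - rewrite S_INR, Rmult_plus_distr_r, Rmult_1_l, expi_2PI. exact IH.
Qed.

Lemma Cint_expi k n : (k = INR (S n) \/ k = - INR (S n)) ->
  Cint (fun t => expi (k * t)) 0 (2 * PI) = 0%C.
Proof.
  intros Hk.
  assert (INR (S n) <> 0) as Hn by (apply not_0_INR; lia).
  assert (k <> 0) as K0 by (destruct Hk; subst; lra).
  assert (cos (k * (2 * PI)) = 1 /\ sin (k * (2 * PI)) = 0) as [Ec Es].
  { pose proof (expi_INR_2PI (S n)) as E.
    assert (cos (INR (S n) * (2 * PI)) = 1) as E1 by exact (f_equal fst E).
    assert (sin (INR (S n) * (2 * PI)) = 0) as E2 by exact (f_equal snd E).
    destruct Hk; subst k.
    - split; assumption.
    - replace (- INR (S n) * (2 * PI)) with (- (INR (S n) * (2 * PI))) by ring.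
      rewrite cos_neg, sin_neg, E1, E2. split; ring. }
  unfold Cint, expi; simpl fst; simpl snd. unfold RtoC. f_equal.
  - apply is_RInt_unique.
    replace 0 with (minus (sin (k * (2 * PI)) / k) (sin (k * 0) / k)) at 2.
    2: { rewrite Es, Rmult_0_r, sin_0. unfold minus, plus, opp; simpl. field. assumption. }
    apply (is_RInt_derive (V := R_CompleteNormedModule) (fun t => sin (k * t) / k)).
    + intros x _. auto_derive; [trivial | field; assumption].
    + intros x _. apply (contC_fst _ (expi_contC k)).
  - apply is_RInt_unique.
    replace 0 with (minus (- cos (k * (2 * PI)) / k) (- cos (k * 0) / k)) at 2.
    2: { rewrite Ec, Rmult_0_r, cos_0. unfold minus, plus, opp; simpl. field. assumption. }
    apply (is_RInt_derive (V := R_CompleteNormedModule) (fun t => - cos (k * t) / k)).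
    + intros x _. auto_derive; [trivial | field; assumption].
    + intros x _. apply (contC_snd _ (expi_contC k)).
Qed.

(** [s = 1] serves lam moving on its circle, [s = -1] serves [mu lam] as a function of the polar
    angle. *)
Lemma mean_base_circle c s : s = 1 \/ s = -1 ->
  mean_base (fun t => c * expi (s * t))%C (Cmod c).
Proof.
  intros Hs. split; [|split].
  - apply contC_scal, expi_contC.
  - intros t. rewrite Cmod_mult, Cmod_expi. lra.
  - intros n. pose proof PI_RGT_0.
    assert (forall m x, (expi x ^ m)%C = expi (INR m * x)) as Hp.
    { induction m; intros x; [simpl; rewrite Rmult_0_l, expi_0; reflexivity|].
      rewrite Cpow_S, IHm, <- expi_plus, S_INR. f_equal. ring. }
    rewrite (Cint_ext _ (fun t => c ^ S n * expi (INR (S n) * s * t))%C); [|lra|].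
    + rewrite Cint_scal by apply expi_contC. rewrite (Cint_expi _ n); [ring|].
      destruct Hs; subst s; [left | right]; ring.
    + intros t _. rewrite Cpow_mult_l, Hp. f_equal. f_equal. ring.
Qed.

Definition mu (lam : C) (w : R) : C := (lam * expi (- w))%C.
(** This is rho lam / (z - lam^2 zbar) at z = rho e^{iw}: the factor rho from polar coordinates
    removes the singularity and leaves a function of the angle. *)
Definition ker (lam : C) (w : R) : C := (mu lam w / (1 - mu lam w * mu lam w))%C.
(** The function (1 + zeta) / (1 - zeta) at zeta = mu^2; its real part is the Poisson kernel of the
    unit disc. *)
Definition poisson (lam : C) (w : R) : C := ((1 + mu lam w * mu lam w) / (1 - mu lam w * mu lam w))%C.

Lemma Cmod_mu lam w : Cmod (mu lam w) = Cmod lam.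
Proof. unfold mu. rewrite Cmod_mult, Cmod_expi. ring. Qed.

Lemma mean_base_mu lam : mean_base (mu lam) (Cmod lam).
Proof.
  replace (mu lam) with (fun t => lam * expi (-1 * t))%C; [apply mean_base_circle; auto|].
  apply functional_extensionality. intros t. unfold mu. f_equal. f_equal. ring.
Qed.

Lemma Cmod_mu2_lt lam w : Cmod lam < 1 -> Cmod (mu lam w * mu lam w) <= Cmod lam * Cmod lam.
Proof. intros. rewrite Cmod_mult, Cmod_mu. lra. Qed.

Lemma Cmod_sq_lt_1 lam : Cmod lam < 1 -> Cmod lam * Cmod lam < 1.
Proof. intros. pose proof (Cmod_ge_0 lam). nra. Qed.

Lemma mu_denom_neq_0 lam w : Cmod lam < 1 -> (1 - mu lam w * mu lam w <> 0)%C.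
Proof.
  intros H. apply one_minus_neq_0 with (Cmod lam * Cmod lam);
  [apply Cmod_mu2_lt | apply Cmod_sq_lt_1]; assumption.
Qed.

Lemma mu_denom_ge lam w : Cmod lam < 1 -> 1 - Cmod lam <= Cmod (1 - mu lam w * mu lam w).
Proof.
  intros H. eapply Rle_trans; [|apply Cmod_one_minus_ge, Cmod_mu2_lt; assumption].
  pose proof (Cmod_ge_0 lam). nra.
Qed.

Lemma An_mu_inv lam : Cmod lam < 1 -> An (mu lam) (fun w => / (1 - mu lam w * mu lam w))%C.
Proof.
  intros H. destruct (mean_base_mu lam) as [_ [Hb _]].
  apply An_inv with (Cmod lam) (Cmod lam * Cmod lam); auto using Cmod_sq_lt_1, Cmod_mu2_lt.
  apply An_mult with (Cmod lam); auto using An_base.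
Qed.

Lemma ker_contC lam : Cmod lam < 1 -> contC (ker lam).
Proof.
  intros H. destruct (mean_base_mu lam) as [Hc _].
  apply contC_mult; [assumption|]. eapply An_contC; eauto using An_mu_inv.
Qed.

Lemma poisson_contC lam : Cmod lam < 1 -> contC (poisson lam).
Proof.
  intros H. destruct (mean_base_mu lam) as [Hc _].
  apply contC_mult.
  - apply contC_plus; [apply contC_const|]. apply contC_mult; assumption.
  - eapply An_contC; eauto using An_mu_inv.
Qed.

(** [poisson] is 1 plus the product of [mu lam], whose mean vanishes, and a limit of polynomials in
    it. Means are multiplicative, so only the 1 contributes. *)
Lemma poisson_mean lam : Cmod lam < 1 -> Cint (poisson lam) 0 (2 * PI) = RtoC (2 * PI).
Proof.
  intros H. pose proof (mean_base_mu lam) as Hb. pose proof Hb as [Hc [Hr Hm]]. pose proof PI_RGT_0.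
  pose (G := fun w => (2 * (mu lam w * / (1 - mu lam w * mu lam w)))%C).
  assert (An (mu lam) G) as HG.
  { eapply An_scal; eauto. eapply An_mult; eauto using An_base, An_mu_inv. }
  assert (contC G) as H1 by (eapply An_contC; eauto).
  rewrite (Cint_ext _ (fun w => 1 + mu lam w * G w)%C); [|lra|].
  - rewrite Cint_plus, Cint_const by (try apply contC_const; apply contC_mult; assumption).
    pose proof (An_mean_mult _ _ _ _ Hb (An_base _) HG) as E.
    assert (Cint (mu lam) 0 (2 * PI) = 0)%C as E0.
    { rewrite <- (Hm O). apply Cint_ext; [lra|]. intros; rewrite Cpow_1_r; reflexivity. }
    rewrite E0, Cmult_0_l in E.
    assert (Cint (fun t => mu lam t * G t) 0 (2 * PI) = 0)%C as ->.
    { assert (RtoC (2 * PI) <> 0)%C by (intros e; apply RtoC_inj in e; lra).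
      replace (Cint (fun t => mu lam t * G t) 0 (2 * PI))%C
        with (/ RtoC (2 * PI) * (RtoC (2 * PI) * Cint (fun t => mu lam t * G t) 0 (2 * PI)))%C
        by (field; assumption).
      rewrite E. ring. }
    rewrite Rminus_0_r. ring.
  - intros w _. unfold poisson, G. pose proof (mu_denom_neq_0 lam w H). field. assumption.
Qed.

Lemma Cmod2_coord (z : C) : Cmod z ^ 2 = fst z ^ 2 + snd z ^ 2.
Proof. apply Cmod2_alt. Qed.

Lemma fst_poisson lam w : Cmod lam < 1 ->
  fst (poisson lam w) = (1 - Cmod lam ^ 4) / Cmod (1 - mu lam w * mu lam w) ^ 2.
Proof.
  intros H. pose proof (mu_denom_ge lam w H) as D.
  rewrite <- (Cmod_mu lam w).
  assert (0 < Cmod (1 - mu lam w * mu lam w) ^ 2) as P by (apply pow_lt; lra).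
  replace (Cmod (mu lam w) ^ 4) with ((Cmod (mu lam w) ^ 2) ^ 2) by ring.
  revert P. rewrite !Cmod2_coord. unfold poisson. destruct (mu lam w) as [x y]. simpl. intros P.
  field. simpl. lra.
Qed.

(** Multiplying mu by the conjugate of the denominator gives mu - |mu|^2 conj(mu), whose real part
    carries the factor 1 - |mu|^2. This gain is absent from the modulus of [ker]. *)
Lemma fst_ker lam w : Cmod lam < 1 ->
  fst (ker lam w) = fst (mu lam w) * (1 - Cmod lam ^ 2) / Cmod (1 - mu lam w * mu lam w) ^ 2.
Proof.
  intros H. pose proof (mu_denom_ge lam w H) as D.
  rewrite <- (Cmod_mu lam w).
  assert (0 < Cmod (1 - mu lam w * mu lam w) ^ 2) as P by (apply pow_lt; lra).
  revert P. rewrite !Cmod2_coord. unfold ker. destruct (mu lam w) as [x y]. simpl. intros P.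
  field. simpl. lra.
Qed.

(** Compare numerators: 1 - r^4 = (1 + r^2)(1 - r^2), and |Re mu| <= r <= 1 + r^2. *)
Lemma fst_poisson_ge_ker lam w : Cmod lam < 1 -> Rabs (fst (ker lam w)) <= fst (poisson lam w).
Proof.
  intros H. rewrite fst_ker, fst_poisson by assumption.
  pose proof (mu_denom_ge lam w H) as D.
  assert (0 < / Cmod (1 - mu lam w * mu lam w) ^ 2) as P by (apply Rinv_0_lt_compat, pow_lt; lra).
  pose proof (fst_le_Cmod (mu lam w)) as F. rewrite Cmod_mu in F.
  pose proof (Cmod_ge_0 lam) as L0. unfold Rdiv. rewrite !Rabs_mult.
  rewrite (Rabs_pos_eq (1 - Cmod lam ^ 2)) by nra.
  rewrite (Rabs_pos_eq (/ _)) by lra.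
  apply Rmult_le_compat_r; [lra|].
  replace (1 - Cmod lam ^ 4) with ((1 + Cmod lam ^ 2) * (1 - Cmod lam ^ 2)) by ring.
  apply Rmult_le_compat_r; nra.
Qed.

Lemma RInt_fst_poisson lam : Cmod lam < 1 -> RInt (fun w => fst (poisson lam w)) 0 (2 * PI) = 2 * PI.
Proof.
  intros H. pose proof (poisson_mean lam H) as E. unfold Cint in E.
  apply (f_equal fst) in E. exact E.
Qed.

(* AM-GM: 2 s d <= s^2 + d^2 for d = |1 - mu^2| and s = sqrt (1 - |lam|); moreover s^2 <= 1 - |lam|^4. *)
Lemma Cmod_ker_le lam w : Cmod lam < 1 ->
  Cmod (ker lam w) <= / 2 * / sqrt (1 - Cmod lam) * (fst (poisson lam w) + 1).
Proof.
  intros H. pose proof (mu_denom_ge lam w H) as D. pose proof (Cmod_ge_0 lam) as L0.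
  rewrite fst_poisson by assumption. unfold ker. rewrite Cmod_div by (apply mu_denom_neq_0; assumption).
  rewrite Cmod_mu. set (d := Cmod (1 - mu lam w * mu lam w)) in *. set (r := Cmod lam) in *.
  assert (0 < sqrt (1 - r)) as S0 by (apply sqrt_lt_R0; lra).
  assert (sqrt (1 - r) * sqrt (1 - r) = 1 - r) as S2 by (apply sqrt_sqrt; lra).
  set (s := sqrt (1 - r)) in *. assert (0 < d) by lra.
  apply Rmult_le_reg_r with (2 * s * d ^ 2); [assert (0 < d ^ 2) by (apply pow_lt; lra); nra|].
  replace (r / d * (2 * s * d ^ 2)) with (2 * s * r * d) by (field; lra).
  replace (/ 2 * / s * ((1 - r ^ 4) / d ^ 2 + 1) * (2 * s * d ^ 2)) with (1 - r ^ 4 + d ^ 2) by (field; lra).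
  assert (s * s <= 1 - r ^ 4). { rewrite S2. assert (r ^ 4 <= r). { simpl. assert (r * r <= r) by nra. nra. } lra. }
  pose proof (pow2_ge_0 (d - s)).
  assert (s * r * d <= s * d) by (assert (0 <= s * d) by nra; nra). nra.
Qed.

(** * Ray integrals and the solution operator [Top] *)

Definition LipC (B : C -> C) : Prop :=
  exists K, 0 <= K /\ forall z w, Cmod (B z - B w) <= K * Cmod (z - w).

Lemma LipC_const c : LipC (fun _ => c).
Proof.
  exists 0. split; [lra|]. intros z w. replace (c - c)%C with (RtoC 0) by ring. rewrite Cmod_0. lra.
Qed.

Lemma LipC_plus F G : LipC F -> LipC G -> LipC (fun z => F z + G z)%C.
Proof.
  intros [K [HK H]] [L [HL I]]. exists (K + L). split; [lra|]. intros z w.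
  replace (F z + G z - (F w + G w))%C with ((F z - F w) + (G z - G w))%C by ring.
  eapply Rle_trans; [apply Cmod_triangle|]. specialize (H z w). specialize (I z w). lra.
Qed.

Lemma LipC_mult F G m n : LipC F -> LipC G -> (forall z, Cmod (F z) <= m) -> (forall z, Cmod (G z) <= n) ->
  LipC (fun z => F z * G z)%C.
Proof.
  intros [K [HK H]] [L [HL I]] Bm Bn.
  assert (0 <= m) by (eapply Rle_trans; [apply Cmod_ge_0 | apply (Bm 0%C)]).
  assert (0 <= n) by (eapply Rle_trans; [apply Cmod_ge_0 | apply (Bn 0%C)]).
  exists (K * n + m * L). split; [nra|]. intros z w.
  eapply Rle_trans; [apply Cmod_mult_diff|].
  assert (Cmod (F z - F w) * Cmod (G z) <= K * Cmod (z - w) * n)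
    by (apply Rmult_le_compat; auto using Cmod_ge_0).
  assert (Cmod (F w) * Cmod (G z - G w) <= m * (L * Cmod (z - w)))
    by (apply Rmult_le_compat; auto using Cmod_ge_0). lra.
Qed.

Lemma LipC_scal c F : LipC F -> LipC (fun z => c * F z)%C.
Proof.
  intros [K [HK H]]. exists (Cmod c * K). pose proof (Cmod_ge_0 c). split; [nra|]. intros z w.
  replace (c * F z - c * F w)%C with (c * (F z - F w))%C by ring. rewrite Cmod_mult, Rmult_assoc.
  apply Rmult_le_compat_l; auto.
Qed.

Lemma LipC_minus F G : LipC F -> LipC G -> LipC (fun z => F z - G z)%C.
Proof.
  intros HF HG. apply (LipC_scal (-1)%C) in HG. pose proof (LipC_plus _ _ HF HG) as [K [HK H]].
  exists K. split; [exact HK|]. intros z w. specialize (H z w).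
  replace (F z - G z - (F w - G w))%C with (F z + -1 * G z - (F w + -1 * G w))%C by ring. exact H.
Qed.

Lemma LipC_shift h F : LipC F -> LipC (fun z => F (z + h)%C).
Proof.
  intros [K [HK H]]. exists K. split; [exact HK|]. intros z w.
  replace (z - w)%C with (z + h - (w + h))%C by ring. apply H.
Qed.

(** Truncated at length [L]; when [B] vanishes on the rest of the ray, this is the integral over the
    half-line. *)
Definition ray (L : R) (B : C -> C) (z : C) (w : R) : C :=
  Cint (fun rho => B (z - RtoC rho * expi w)%C) 0 L.

Lemma ray_integrand_contC B z w : LipC B -> contC (fun rho => B (z - RtoC rho * expi w)%C).
Proof.
  intros [K [HK H]]. apply LipRC_contC. exists K. split; [exact HK|]. intros s t.
  eapply Rle_trans; [apply H|]. apply Rmult_le_compat_l; [exact HK|].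
  replace (z - s * expi w - (z - t * expi w))%C with (RtoC (t - s) * expi w)%C by (rewrite RtoC_minus; ring).
  rewrite Cmod_mult, Cmod_expi, Cmod_R, Rabs_minus_sym. lra.
Qed.

Lemma ray_lip L B z K s t : 0 <= L -> 0 <= K -> (forall z w, Cmod (B z - B w) <= K * Cmod (z - w)) ->
  Cmod (ray L B z s - ray L B z t) <= 4 * K * L ^ 2 * Rabs (s - t).
Proof.
  intros HL HK H. assert (LipC B) as HB by (exists K; auto). unfold ray.
  rewrite <- Cint_minus by (apply ray_integrand_contC; assumption).
  eapply Rle_trans; [apply Cint_bound_const with (m := K * (L * 2) * Rabs (s - t)); [assumption| |]|].
  - apply contC_minus; apply ray_integrand_contC; assumption.
  - intros rho Hr. eapply Rle_trans; [apply H|]. rewrite Rmult_assoc. apply Rmult_le_compat_l; [exact HK|].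
    replace (z - rho * expi s - (z - rho * expi t))%C with (- (RtoC rho * (expi s - expi t)))%C by ring.
    rewrite Cmod_opp, Cmod_mult, Cmod_R, Rabs_pos_eq, Rmult_assoc by lra.
    apply Rmult_le_compat; auto using Cmod_ge_0; try lra. apply expi_lip.
  - rewrite Rminus_0_r. apply Req_le. ring.
Qed.

Lemma ray_contC L B z : 0 <= L -> LipC B -> contC (ray L B z).
Proof.
  intros HL [K [HK H]]. apply LipRC_contC. exists (4 * K * L ^ 2). split.
  - pose proof (pow2_ge_0 L). nra.
  - intros s t. apply ray_lip; assumption.
Qed.

Lemma ray_bound L B z w m : 0 <= L -> LipC B -> (forall z, Cmod (B z) <= m) ->
  Cmod (ray L B z w) <= 2 * (L * m).
Proof.
  intros HR HB Hm. unfold ray. rewrite <- (Rminus_0_r L) at 2. apply Cint_bound_const; auto.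
  apply ray_integrand_contC; assumption.
Qed.

(* Convolution with the fundamental solution 1 / (pi (z - lam^2 zbar)) of d_zbar + lam^2 d_z, times lam:
   the Jacobian of the polar coordinates cancels its singularity. *)
Definition Top (L : R) (lam : C) (B : C -> C) (z : C) : C :=
  (RtoC (/ PI) * Cint (fun w => ker lam w * ray L B z w) 0 (2 * PI))%C.

Lemma ker_ray_contC L lam B z : 0 <= L -> Cmod lam < 1 -> LipC B ->
  contC (fun w => ker lam w * ray L B z w)%C.
Proof. intros. apply contC_mult; [apply ker_contC; assumption | apply ray_contC; assumption]. Qed.

Lemma Top_plus L lam F G z : 0 <= L -> Cmod lam < 1 -> LipC F -> LipC G ->
  Top L lam (fun z => F z + G z)%C z = (Top L lam F z + Top L lam G z)%C.
Proof.
  intros HR Hl HF HG. unfold Top. pose proof PI_RGT_0.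
  rewrite (Cint_ext _ (fun w => ker lam w * ray L F z w + ker lam w * ray L G z w)%C); [|lra|].
  - rewrite Cint_plus by (apply ker_ray_contC; assumption). ring.
  - intros w _. unfold ray. rewrite Cint_plus by (apply ray_integrand_contC; assumption). ring.
Qed.

Lemma Top_scal L lam c F z : 0 <= L -> Cmod lam < 1 -> LipC F ->
  Top L lam (fun z => c * F z)%C z = (c * Top L lam F z)%C.
Proof.
  intros HR Hl HF. unfold Top. pose proof PI_RGT_0.
  rewrite (Cint_ext _ (fun w => c * (ker lam w * ray L F z w))%C); [|lra|].
  - rewrite Cint_scal by (apply ker_ray_contC; assumption). ring.
  - intros w _. unfold ray. rewrite Cint_scal by (apply ray_integrand_contC; assumption). ring.
Qed.

Lemma Top_minus L lam F G z : 0 <= L -> Cmod lam < 1 -> LipC F -> LipC G ->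
  Top L lam (fun z => F z - G z)%C z = (Top L lam F z - Top L lam G z)%C.
Proof.
  intros HR Hl HF HG.
  replace (fun z => F z - G z)%C with (fun z => F z + (-1) * G z)%C
    by (apply functional_extensionality; intros; ring).
  rewrite (Top_plus L lam F (fun z => (-1) * G z)%C), Top_scal by (try apply LipC_scal; assumption). ring.
Qed.

(** The square root comes from the AM-GM estimate of [ker] against the Poisson kernel. The true loss
    is logarithmic in 1 - |lam|, but any power below 1 is beaten by the error O(1 - r) to which this
    is applied. *)
Lemma Top_bound L lam B z m : 0 <= L -> Cmod lam < 1 -> LipC B -> (forall z, Cmod (B z) <= m) ->
  Cmod (Top L lam B z) <= 8 * L * m / sqrt (1 - Cmod lam).
Proof.
  intros HR Hl HB Hm. pose proof PI_RGT_0 as HP. unfold Top.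
  assert (0 <= m) by (eapply Rle_trans; [apply Cmod_ge_0 | apply (Hm 0%C)]).
  assert (0 < / sqrt (1 - Cmod lam)) as S0 by (apply Rinv_0_lt_compat, sqrt_lt_R0; lra).
  set (k := / 2 * / sqrt (1 - Cmod lam) * (2 * (L * m))).
  assert (forall t, continuous (fun w => fst (poisson lam w)) t) as HPc
    by (apply contC_fst, poisson_contC; assumption).
  (* 4 PI: both the Poisson kernel and the added constant 1 integrate to 2 PI. *)
  assert (Cmod (Cint (fun w => ker lam w * ray L B z w)%C 0 (2 * PI)) <= 2 * (k * (4 * PI))) as Hb.
  { eapply Rle_trans; [apply Cint_bound with (g := fun w => k * (fst (poisson lam w) + 1))|].
    - lra.
    - apply ker_ray_contC; assumption.
    - intros t. apply (continuous_mult (K := R_AbsRing)); [apply continuous_const|].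
      apply (continuous_plus (V := R_NormedModule)); [apply HPc | apply continuous_const].
    - intros w _. rewrite Cmod_mult.
      replace (k * (fst (poisson lam w) + 1))
        with ((/ 2 * / sqrt (1 - Cmod lam) * (fst (poisson lam w) + 1)) * (2 * (L * m))) by (unfold k; ring).
      apply Rmult_le_compat; auto using Cmod_ge_0, Cmod_ker_le. apply ray_bound; assumption.
    - apply Req_le. f_equal.
      rewrite (RInt_scal (V := R_CompleteNormedModule) (fun w => fst (poisson lam w) + 1)).
      + rewrite (RInt_plus (V := R_CompleteNormedModule)); [|apply ex_RInt_cont; exact HPc | apply ex_RInt_const].
        rewrite RInt_fst_poisson, RInt_const by assumption.
        unfold scal, plus; simpl; unfold mult; simpl. ring.
      + apply (ex_RInt_plus (V := R_NormedModule)); [apply ex_RInt_cont; exact HPc | apply ex_RInt_const]. }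
  rewrite Cmod_mult, Cmod_R, Rabs_pos_eq by (left; apply Rinv_0_lt_compat; lra).
  eapply Rle_trans; [apply Rmult_le_compat_l; [left; apply Rinv_0_lt_compat; lra | exact Hb]|].
  unfold k. apply Req_le. field. split; [|lra].
  pose proof (sqrt_lt_R0 (1 - Cmod lam)). lra.
Qed.

(* The real part of the kernel is dominated by a Poisson kernel, so there is no loss as |lam| -> 1. *)
Lemma Top_re_bound L lam (a : C -> R) z m : 0 <= L -> Cmod lam < 1 -> LipC (fun z => RtoC (a z)) ->
  (forall z, Rabs (a z) <= m) ->
  Rabs (fst (Top L lam (fun z => RtoC (a z)) z)) <= 2 * (L * m).
Proof.
  intros HR Hl Ha Hm. pose proof PI_RGT_0 as HP.
  (* [a] is real, hence so are its ray integrals [D], and the real part of the product sees the real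
     part of the kernel alone. *)
  set (D := fun w => RInt (fun rho => a (z - RtoC rho * expi w)%C) 0 L).
  assert (forall w, ray L (fun z => RtoC (a z)) z w = RtoC (D w)) as HD.
  { intros w. unfold ray, D. rewrite <- Cint_RtoC. reflexivity. }
  pose proof (ker_ray_contC L lam _ z HR Hl Ha) as Hc.
  pose proof (contC_fst _ (ray_contC L _ z HR Ha)) as HDc.
  assert (0 <= m) by (eapply Rle_trans; [apply Rabs_pos | apply (Hm 0%C)]).
  assert (forall w, Rabs (D w) <= L * m) as BD.
  { intros w. unfold D. rewrite <- (Rminus_0_r L) at 2. apply RInt_abs_bound; auto.
    apply (contC_fst _ (ray_integrand_contC _ z w Ha)). }
  unfold Top. unfold Cmult at 1. simpl fst. rewrite Rmult_0_l, Rminus_0_r.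
  rewrite (RInt_ext (V := R_CompleteNormedModule) _ (fun w => fst (ker lam w) * D w)).
  2: { intros w _. change (fst (ker lam w * ray L (fun z => RtoC (a z)) z w)%C = fst (ker lam w) * D w).
       rewrite HD. simpl. ring. }
  assert (forall t, continuous (fun w => fst (ker lam w) * D w) t) as Hc2.
  { intros t. apply (continuous_mult (K := R_AbsRing)); [apply contC_fst, ker_contC; assumption|].
    apply (continuous_ext (fun w => fst (ray L (fun z => RtoC (a z)) z w))); [|apply HDc].
    intros w. rewrite HD. reflexivity. }
  rewrite Rabs_mult, (Rabs_pos_eq (/ PI)) by (left; apply Rinv_0_lt_compat; lra).
  assert (Rabs (RInt (fun w => fst (ker lam w) * D w) 0 (2 * PI)) <= (L * m) * (2 * PI)) as Hb.
  { replace ((L * m) * (2 * PI)) with ((L * m) * RInt (fun w => fst (poisson lam w)) 0 (2 * PI))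
      by (rewrite RInt_fst_poisson; auto).
    change ((L * m) * RInt (fun w => fst (poisson lam w)) 0 (2 * PI))
      with (scal (L * m) (RInt (fun w => fst (poisson lam w)) 0 (2 * PI))).
    rewrite <- (RInt_scal (V := R_CompleteNormedModule) (fun w => fst (poisson lam w)))
      by (apply ex_RInt_cont, contC_fst, poisson_contC; assumption).
    eapply Rle_trans; [apply abs_RInt_le; [lra | apply ex_RInt_cont; exact Hc2]|].
    apply RInt_le; [lra | | |].
    - apply ex_RInt_cont. intros t. apply (continuous_comp _ Rabs); [apply Hc2 | apply continuous_Rabs].
    - apply ex_RInt_cont. intros t. apply (continuous_mult (K := R_AbsRing)); [apply continuous_const|].
      apply contC_fst, poisson_contC; assumption.
    - intros w _. change (Rabs (fst (ker lam w) * D w) <= (L * m) * fst (poisson lam w)).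
      rewrite Rabs_mult, Rmult_comm.
      apply Rmult_le_compat; auto using Rabs_pos, fst_poisson_ge_ker. }
  eapply Rle_trans; [apply Rmult_le_compat_l; [left; apply Rinv_0_lt_compat; lra | exact Hb]|].
  apply Req_le. field. lra.
Qed.

(** Translation invariance turns sup-norm bounds for [Top] into Lipschitz bounds and first-order
    expansions, without differentiating under the integral. *)
Lemma Top_shift L lam B z h : Top L lam (fun z => B (z + h)%C) z = Top L lam B (z + h)%C.
Proof.
  unfold Top, ray. f_equal. f_equal. apply functional_extensionality. intros w. f_equal.
  f_equal. apply functional_extensionality. intros rho. f_equal. ring.
Qed.

Lemma Top_LipC L lam B K z w : 0 <= L -> Cmod lam < 1 -> 0 <= K ->
  (forall z w, Cmod (B z - B w) <= K * Cmod (z - w)) ->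
  Cmod (Top L lam B z - Top L lam B w) <= 8 * L * K / sqrt (1 - Cmod lam) * Cmod (z - w).
Proof.
  intros HR Hl HK H. assert (LipC B) as HB by (exists K; auto).
  replace z with (w + (z - w))%C at 1 by ring. rewrite <- Top_shift.
  rewrite <- Top_minus by (try apply LipC_shift; assumption).
  eapply Rle_trans; [apply Top_bound with (m := K * Cmod (z - w)); auto|].
  - apply LipC_minus; [apply LipC_shift|]; assumption.
  - intros u. replace (z - w)%C with (u + (z - w) - u)%C at 2 by ring. apply H.
  - unfold Rdiv. lra.
Qed.

(** * Functions with Lipschitz gradient *)

(** Each bisection halves the admissible increment, so the increment is zero. This plays the part of
    the theorem on functions with zero derivative. *)
Lemma quadratic_increments_const (h : R -> C) K a b : a <= b ->
  (forall s t, a <= s <= t -> t <= b -> Cmod (h t - h s) <= K * (t - s) ^ 2) -> h b = h a.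
Proof.
  intros Hab H.
  assert (forall n s t, a <= s <= t -> t <= b -> Cmod (h t - h s) <= K * (t - s) ^ 2 / 2 ^ n) as HS.
  { induction n as [|n IH]; intros s t Hs Ht.
    - simpl. specialize (H s t Hs Ht). lra.
    - eapply Rle_trans; [apply (Cmod_dist_triangle _ (h ((s + t) / 2)))|].
      pose proof (IH s ((s + t) / 2) ltac:(lra) ltac:(lra)).
      pose proof (IH ((s + t) / 2) t ltac:(lra) ltac:(lra)).
      replace (K * (t - s) ^ 2 / 2 ^ S n) with
        (K * (t - (s + t) / 2) ^ 2 / 2 ^ n + K * ((s + t) / 2 - s) ^ 2 / 2 ^ n); [lra|].
      simpl. field. apply pow_nonzero. lra. }
  assert (h b - h a = 0)%C as E.
  { apply (Czero_of_small _ (K * (b - a) ^ 2)). intros eps He.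
    destruct (pow_lt_1_zero (/2)) with (y := eps) as [N HN]; [rewrite Rabs_pos_eq; lra | lra|].
    specialize (HN N (Nat.le_refl _)). rewrite pow_inv in HN.
    rewrite Rabs_pos_eq in HN by (left; apply Rinv_0_lt_compat, pow_lt; lra).
    pose proof (HS N a b ltac:(lra) ltac:(lra)) as E.
    pose proof (HS O a b ltac:(lra) ltac:(lra)) as E0. simpl in E0.
    pose proof (Cmod_ge_0 (h b - h a)).
    eapply Rle_trans; [exact E|]. unfold Rdiv.
    apply Rmult_le_compat_l; [simpl; lra | lra]. }
  replace (h b) with (h a + (h b - h a))%C by ring. rewrite E. ring.
Qed.

Lemma Cint_LipRC_param (f : R -> R -> C) K a b : a <= b -> 0 <= K ->
  (forall x, contC (f x)) ->
  (forall x x' y, Cmod (f x y - f x' y) <= K * Rabs (x - x')) ->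
  LipRC (fun x => Cint (f x) a b).
Proof.
  intros Hab HK Hc H. exists (2 * ((b - a) * K)).
  split; [nra|]. intros s t. eapply Rle_trans.
  - apply (Cint_close _ _ _ _ (K * Rabs (s - t))); auto.
  - lra.
Qed.

(** Both iterated integrals are regarded as functions of the upper limit [t] of the x-integral. From
    s to t each grows by (t - s) times the same integral over y at x = s, up to O((t - s)^2), so
    their difference is constant. *)
Lemma Cint_fubini (f : R -> R -> C) K a b c d : a <= b -> c <= d -> 0 <= K ->
  (forall x x' y, Cmod (f x y - f x' y) <= K * Rabs (x - x')) ->
  (forall x y y', Cmod (f x y - f x y') <= K * Rabs (y - y')) ->
  Cint (fun y => Cint (fun x => f x y) a b) c d = Cint (fun x => Cint (fun y => f x y) c d) a b.
Proof.
  intros Hab Hcd HK H1 H2.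
  assert (forall y, contC (fun x => f x y)) as C1.
  { intros y. apply LipRC_contC. exists K. split; auto. }
  assert (forall x, contC (fun y => f x y)) as C2.
  { intros x. apply LipRC_contC. exists K. split; auto. }
  assert (forall u v, u <= v -> contC (fun y => Cint (fun x => f x y) u v)) as C3.
  { intros u v Huv. apply LipRC_contC.
    apply (Cint_LipRC_param (fun y x => f x y) K); auto. }
  assert (contC (fun x => Cint (fun y => f x y) c d)) as C4.
  { apply LipRC_contC. apply (Cint_LipRC_param (fun x y => f x y) K); auto. }
  pose (h := fun t => (Cint (fun y => Cint (fun x => f x y) a t) c d - Cint (fun x => Cint (fun y => f x y) c d) a t)%C).
  assert (h b = h a) as E.
  { apply (quadratic_increments_const h (2 * ((d - c) * (2 * K)) + 2 * (2 * ((d - c) * K)))); [exact Hab|].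
    intros s t Hs Ht. unfold h.
    rewrite <- (Cint_Chasles (fun x => Cint (fun y => f x y) c d) a s t) by assumption.
    rewrite (Cint_ext (fun y => Cint (fun x => f x y) a t)
       (fun y => Cint (fun x => f x y) a s + Cint (fun x => f x y) s t)%C) by
       (try assumption; intros; rewrite Cint_Chasles; auto).
    rewrite Cint_plus by (apply C3; lra).
    set (g := Cint (fun y => f s y) c d).
    match goal with |- Cmod (?P + ?Q - (?S + ?U) - (?P - ?S)) <= _ =>
      replace (P + Q - (S + U) - (P - S))%C with ((Q - RtoC (t - s) * g) - (U - RtoC (t - s) * g))%C by ring end.
    eapply Rle_trans; [apply Cmod_triangle_minus|].
    rewrite Rmult_plus_distr_r. apply Rplus_le_compat.
    - unfold g. rewrite <- Cint_scal by auto.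
      eapply Rle_trans; [apply (Cint_close _ _ _ _ ((2 * K) * (t - s) ^ 2)); auto|].
      + apply C3; lra.
      + apply contC_scal; auto.
      + intros y. rewrite <- Cint_const.
        rewrite <- Cint_minus by (auto; apply contC_const).
        eapply Rle_trans; [apply Cint_bound_const with (m := K * (t - s)); [lra| |]|].
        * apply contC_minus; [auto | apply contC_const].
        * intros x Hx. eapply Rle_trans; [apply H1|]. apply Rmult_le_compat_l; [lra|].
          rewrite Rabs_pos_eq; lra.
        * lra.
      + lra.
    - rewrite <- Cint_const. rewrite <- Cint_minus by (auto; apply contC_const).
      eapply Rle_trans; [apply Cint_bound_const with (m := 2 * ((d - c) * (K * (t - s)))); [lra| |]|].
      + apply contC_minus; [auto | apply contC_const].
      + intros x Hx. unfold g. eapply Rle_trans; [apply (Cint_close _ _ _ _ (K * Rabs (x - s))); auto|].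
        rewrite Rabs_pos_eq by lra. assert (K * (x - s) <= K * (t - s)) by (apply Rmult_le_compat_l; lra). nra.
      + lra. }
  unfold h in E.
  assert (forall g, Cint g a a = 0%C) as Z.
  { intros g. unfold Cint. rewrite !RInt_point. reflexivity. }
  rewrite Z in E. rewrite (Cint_ext (fun y => Cint (fun x => f x y) a a) (fun _ => 0%C)) in E by auto.
  rewrite Cint_const in E.
  replace (Cint (fun y => Cint (fun x => f x y) a b) c d)
    with ((Cint (fun y => Cint (fun x => f x y) a b) c d - Cint (fun x => Cint (fun y => f x y) c d) a b)
      + Cint (fun x => Cint (fun y => f x y) c d) a b)%C by ring.
  rewrite E. ring.
Qed.

(** * Bounded Lipschitz functions and C^{1,1} calculus *)

Definition BL (F : C -> C) : Prop := (exists m, forall z, Cmod (F z) <= m) /\ LipC F.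

Lemma BL_const c : BL (fun _ => c).
Proof. split; [exists (Cmod c); intros; lra | apply LipC_const]. Qed.

Lemma BL_plus F G : BL F -> BL G -> BL (fun z => F z + G z)%C.
Proof.
  intros [[m Hm] HF] [[n Hn] HG]. split; [|apply LipC_plus; assumption].
  exists (m + n). intros z. eapply Rle_trans; [apply Cmod_triangle|]. specialize (Hm z). specialize (Hn z). lra.
Qed.

Lemma BL_mult F G : BL F -> BL G -> BL (fun z => F z * G z)%C.
Proof.
  intros [[m Hm] HF] [[n Hn] HG]. split; [|eapply LipC_mult; eauto].
  exists (m * n). intros z. rewrite Cmod_mult. apply Rmult_le_compat; auto using Cmod_ge_0.
Qed.

Lemma BL_scal c F : BL F -> BL (fun z => c * F z)%C.
Proof. intros. apply BL_mult; [apply BL_const | assumption]. Qed.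

Lemma BL_minus F G : BL F -> BL G -> BL (fun z => F z - G z)%C.
Proof.
  intros [[m Hm] HF] [[n Hn] HG]. split; [|apply LipC_minus; assumption].
  exists (m + n). intros z. eapply Rle_trans; [apply Cmod_triangle_minus|]. specialize (Hm z). specialize (Hn z). lra.
Qed.

Lemma BL_Top L lam F : 0 <= L -> Cmod lam < 1 -> BL F -> BL (Top L lam F).
Proof.
  intros HL Hl [[m Hm] HF]. split.
  - eexists. intros z. apply (Top_bound L lam F z m); assumption.
  - destruct HF as [K [HK H]]. exists (8 * L * K / sqrt (1 - Cmod lam)). split.
    + apply Rmult_le_pos; [nra|]. left. apply Rinv_0_lt_compat, sqrt_lt_R0. lra.
    + intros z w. apply Top_LipC; assumption.
Qed.

(* C^{1,1} with gradient (p1, p2) *)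
Definition C11 (V p1 p2 : C -> C) : Prop :=
  BL V /\ BL p1 /\ BL p2 /\
  exists K, 0 <= K /\ forall z e,
    Cmod (V (z + e)%C - V z - (RtoC (fst e) * p1 z + RtoC (snd e) * p2 z)) <= K * Cmod e ^ 2.

Lemma C11_mult V p1 p2 W q1 q2 : C11 V p1 p2 -> C11 W q1 q2 ->
  C11 (fun z => V z * W z)%C (fun z => p1 z * W z + V z * q1 z)%C (fun z => p2 z * W z + V z * q2 z)%C.
Proof.
  intros [BV [B1 [B2 [K [HK H]]]]] [BW [D1 [D2 [L [HL I]]]]].
  split; [exact (BL_mult V W BV BW)|].
  split; [exact (BL_plus _ _ (BL_mult p1 W B1 BW) (BL_mult V q1 BV D1))|].
  split; [exact (BL_plus _ _ (BL_mult p2 W B2 BW) (BL_mult V q2 BV D2))|].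
  destruct BV as [[m Hm] [KV [HKV LV]]]. destruct BW as [[n Hn] [KW [HKW LW]]].
  assert (0 <= m) by (eapply Rle_trans; [apply Cmod_ge_0 | apply (Hm 0%C)]).
  assert (0 <= n) by (eapply Rle_trans; [apply Cmod_ge_0 | apply (Hn 0%C)]).
  exists (K * n + m * L + KV * KW). split; [nra|]. intros z e.
  specialize (H z e). specialize (I z e).
  assert (Cmod (V (z + e)%C - V z) <= KV * Cmod e) as HV.
  { eapply Rle_trans; [apply LV|]. replace (z + e - z)%C with e by ring. lra. }
  assert (Cmod (W (z + e)%C - W z) <= KW * Cmod e) as HW.
  { eapply Rle_trans; [apply LW|]. replace (z + e - z)%C with e by ring. lra. }
  set (a := RtoC (fst e)) in *. set (b := RtoC (snd e)) in *.
  replace (V (z + e) * W (z + e) - V z * W z -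
   (a * (p1 z * W z + V z * q1 z) + b * (p2 z * W z + V z * q2 z)))%C
  with ((V (z + e) - V z - (a * p1 z + b * p2 z)) * W z
       + V z * (W (z + e) - W z - (a * q1 z + b * q2 z))
       + (V (z + e) - V z) * (W (z + e) - W z))%C by ring.
  eapply Rle_trans; [apply Cmod_triangle|]. eapply Rle_trans; [apply Rplus_le_compat_r, Cmod_triangle|].
  rewrite !Cmod_mult. specialize (Hm z). specialize (Hn z).
  replace ((K * n + m * L + KV * KW) * Cmod e ^ 2)
    with (K * Cmod e ^ 2 * n + m * (L * Cmod e ^ 2) + (KV * Cmod e) * (KW * Cmod e)) by ring.
  repeat apply Rplus_le_compat; apply Rmult_le_compat; auto using Cmod_ge_0.
Qed.

(** Factor out [cexp v] and expand at the difference, whose modulus is at most 2 m; one power of it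
    is absorbed into [10 * m * exp (2 * m)]. *)
Lemma cexp_diff_bound u v m : Cmod u <= m -> Cmod v <= m ->
  Cmod (cexp u - cexp v) <= exp m * ((1 + 10 * m * exp (2 * m)) * Cmod (u - v)).
Proof.
  intros Hu Hv.
  replace (cexp u - cexp v)%C with (cexp v * ((cexp (u - v) - 1 - (u - v)) + (u - v)))%C.
  2: { replace (cexp u) with (cexp v * cexp (u - v))%C by (rewrite <- cexp_plus; f_equal; ring). ring. }
  assert (Cmod (u - v) <= 2 * m) as D by (eapply Rle_trans; [apply Cmod_triangle_minus|]; lra).
  rewrite Cmod_mult. apply Rmult_le_compat; auto using Cmod_ge_0.
  - eapply Rle_trans; [apply Cmod_cexp_le | apply exp_le; exact Hv].
  - eapply Rle_trans; [apply Cmod_triangle|]. pose proof (cexp_taylor1 (u - v)) as T.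
    pose proof (Cmod_ge_0 (u - v)). pose proof (exp_le _ _ D). pose proof (exp_pos (Cmod (u - v))).
    assert (Cmod (u - v) * exp (Cmod (u - v)) <= 2 * m * exp (2 * m)) by (apply Rmult_le_compat; lra).
    assert (Cmod (u - v) * (Cmod (u - v) * exp (Cmod (u - v))) <= Cmod (u - v) * (2 * m * exp (2 * m)))
      by (apply Rmult_le_compat_l; lra).
    nra.
Qed.

Lemma BL_cexp h : BL h -> BL (fun z => cexp (h z)).
Proof.
  intros [[m Hm] [K [HK H]]]. split.
  - exists (exp m). intros z. eapply Rle_trans; [apply Cmod_cexp_le | apply exp_le, Hm].
  - assert (0 <= m) by (eapply Rle_trans; [apply Cmod_ge_0 | apply (Hm 0%C)]).
    pose proof (exp_pos m). pose proof (exp_pos (2 * m)).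
    assert (0 <= 1 + 10 * m * exp (2 * m)) by nra.
    exists (exp m * ((1 + 10 * m * exp (2 * m)) * K)).
    split; [apply Rmult_le_pos; [lra | apply Rmult_le_pos; lra]|]. intros z w.
    eapply Rle_trans; [apply cexp_diff_bound with (m := m); apply Hm|].
    set (X := 1 + 10 * m * exp (2 * m)) in *.
    replace (exp m * (X * K) * Cmod (z - w)) with (exp m * (X * (K * Cmod (z - w)))) by ring.
    apply Rmult_le_compat_l; [lra|]. apply Rmult_le_compat_l; [lra | apply H].
Qed.

Lemma C11_cexp h p1 p2 : C11 h p1 p2 ->
  C11 (fun z => cexp (h z)) (fun z => cexp (h z) * p1 z)%C (fun z => cexp (h z) * p2 z)%C.
Proof.
  intros [Bh [B1 [B2 [K [HK H]]]]]. pose proof (BL_cexp h Bh) as Be.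
  split; [exact Be|]. split; [apply BL_mult; assumption|]. split; [apply BL_mult; assumption|].
  destruct Bh as [[m Hm] [L [HL I]]].
  assert (0 <= m) by (eapply Rle_trans; [apply Cmod_ge_0 | apply (Hm 0%C)]).
  exists (exp m * (5 * L ^ 2 * exp (2 * m) + K)).
  pose proof (exp_pos m). pose proof (exp_pos (2 * m)). pose proof (pow2_ge_0 L).
  split; [apply Rmult_le_pos; [lra|]; nra|]. intros z e.
  set (d := (h (z + e) - h z)%C).
  assert (Cmod d <= L * Cmod e) as D1.
  { unfold d. eapply Rle_trans; [apply I|]. replace (z + e - z)%C with e by ring. lra. }
  assert (Cmod d <= 2 * m) as D2.
  { unfold d. eapply Rle_trans; [apply Cmod_triangle_minus|].
    pose proof (Hm (z + e)%C). pose proof (Hm z). lra. }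
  assert (cexp (h (z + e)) = cexp (h z) * cexp d)%C as E by (rewrite <- cexp_plus; f_equal; unfold d; ring).
  rewrite E. specialize (H z e). fold d in H.
  set (a := RtoC (fst e)) in *. set (b := RtoC (snd e)) in *.
  replace (cexp (h z) * cexp d - cexp (h z) - (a * (cexp (h z) * p1 z) + b * (cexp (h z) * p2 z)))%C
   with (cexp (h z) * ((cexp d - 1 - d) + (d - (a * p1 z + b * p2 z))))%C by ring.
  rewrite Cmod_mult, Rmult_assoc. apply Rmult_le_compat; auto using Cmod_ge_0.
  - eapply Rle_trans; [apply Cmod_cexp_le | apply exp_le, Hm].
  - eapply Rle_trans; [apply Cmod_triangle|]. rewrite Rmult_plus_distr_r. apply Rplus_le_compat; [|exact H].
    eapply Rle_trans; [apply cexp_taylor1|].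
    assert (Cmod d ^ 2 <= (L * Cmod e) ^ 2) by (apply pow_incr; split; [apply Cmod_ge_0 | exact D1]).
    pose proof (exp_le _ _ D2). pose proof (exp_pos (Cmod d)).
    replace (5 * L ^ 2 * exp (2 * m) * Cmod e ^ 2) with (5 * (L * Cmod e) ^ 2 * exp (2 * m)) by ring.
    pose proof (pow2_ge_0 (Cmod d)).
    apply Rmult_le_compat; lra.
Qed.

(** [Top] is linear, commutes with translations and is bounded in the sup norm, so applying it to
    the first-order expansion of V yields that of [Top L lam V]. *)
Lemma C11_Top L lam V p1 p2 : 0 <= L -> Cmod lam < 1 -> C11 V p1 p2 ->
  C11 (Top L lam V) (Top L lam p1) (Top L lam p2).
Proof.
  intros HL Hl [BV [B1 [B2 [K [HK H]]]]].
  repeat (split; [apply BL_Top; assumption|]).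
  exists (8 * L * K / sqrt (1 - Cmod lam)). split.
  { apply Rmult_le_pos; [nra|]. left. apply Rinv_0_lt_compat, sqrt_lt_R0. lra. }
  intros z e. destruct BV as [_ LV], B1 as [_ L1], B2 as [_ L2].
  assert (LipC (fun z => V (z + e)%C - V z)%C) by (apply LipC_minus; [apply LipC_shift|]; assumption).
  assert (LipC (fun z => RtoC (fst e) * p1 z + RtoC (snd e) * p2 z)%C)
    by (apply LipC_plus; apply LipC_scal; assumption).
  rewrite <- (Top_scal L lam (RtoC (fst e)) p1) by assumption.
  rewrite <- (Top_scal L lam (RtoC (snd e)) p2) by assumption.
  rewrite <- Top_plus by (try apply LipC_scal; assumption).
  rewrite <- Top_shift.
  rewrite <- (Top_minus L lam (fun z => V (z + e)%C) V) by (try apply LipC_shift; assumption).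
  rewrite <- (Top_minus L lam (fun z => V (z + e)%C - V z)%C)
    by assumption.
  eapply Rle_trans; [apply Top_bound with (m := K * Cmod e ^ 2); auto|].
  - apply LipC_minus; assumption.
  - unfold Rdiv. lra.
Qed.

Lemma quadratic_curve_derive (X P1 P2 : C -> R) K (x y : R -> R) t x' y' : 0 <= K ->
  (forall z e : C, Rabs (X (z + e)%C - X z - (fst e * P1 z + snd e * P2 z)) <= K * Cmod e ^ 2) ->
  derivable_pt_lim x t x' -> derivable_pt_lim y t y' ->
  derivable_pt_lim (fun s => X (x s, y s)) t (P1 (x t, y t) * x' + P2 (x t, y t) * y').
Proof.
  intros HK H Hx Hy. apply (derivable_pt_lim_comp_2d (fun u v => X (u, v))); try assumption.
  (* The increment has modulus at most 2 m, so the remainder is at most 4 K m times m; this radius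
     makes 4 K m <= eps. *)
  intros eps. assert (0 < eps / (4 * K + 1)) as Hd by (apply Rdiv_lt_0_compat; [apply cond_pos | lra]).
  exists (mkposreal _ Hd). simpl. intros u v Hu Hv.
  specialize (H (x t, y t) (u - x t, v - y t)). simpl in H.
  unfold Cplus in H; simpl in H.
  replace (x t + (u - x t)) with u in H by ring. replace (y t + (v - y t)) with v in H by ring.
  replace (P1 (x t, y t) * (u - x t) + P2 (x t, y t) * (v - y t))
    with ((u - x t) * P1 (x t, y t) + (v - y t) * P2 (x t, y t)) by ring.
  eapply Rle_trans; [exact H|].
  set (m := Rmax (Rabs (u - x t)) (Rabs (v - y t))).
  assert (Rabs (u - x t) <= m) by apply Rmax_l. assert (Rabs (v - y t) <= m) by apply Rmax_r.
  assert (0 <= m) by (eapply Rle_trans; [apply Rabs_pos | eassumption]).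
  assert (m < eps / (4 * K + 1)) by (apply Rmax_lub_lt; assumption).
  assert (Cmod (u - x t, v - y t) <= 2 * m) as D.
  { eapply Rle_trans; [apply Cmod_le_sum|]. simpl. lra. }
  assert (Cmod (u - x t, v - y t) ^ 2 <= (2 * m) ^ 2) by (apply pow_incr; split; [apply Cmod_ge_0 | exact D]).
  assert (m * (4 * K + 1) <= eps).
  { apply Rmult_lt_compat_r with (r := 4 * K + 1) in H3; [|lra].
    unfold Rdiv in H3. rewrite Rmult_assoc, Rinv_l in H3 by lra. lra. }
  simpl in *. nra.
Qed.

Lemma Cint_derive (f df : R -> C) a b : contC df ->
  (forall t, derivable_pt_lim (fun s => fst (f s)) t (fst (df t))) ->
  (forall t, derivable_pt_lim (fun s => snd (f s)) t (snd (df t))) ->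
  Cint df a b = (f b - f a)%C.
Proof.
  intros Hc H1 H2. unfold Cint. apply injective_projections; simpl.
  - apply is_RInt_unique.
    apply (is_RInt_derive (V := R_CompleteNormedModule) (fun s => fst (f s))).
    + intros; apply is_derive_Reals, H1.
    + intros; apply contC_fst, Hc.
  - apply is_RInt_unique.
    apply (is_RInt_derive (V := R_CompleteNormedModule) (fun s => snd (f s))).
    + intros; apply is_derive_Reals, H2.
    + intros; apply contC_snd, Hc.
Qed.

Lemma C11_curve_derive V p1 p2 (g : R -> C) t (g' : C) : C11 V p1 p2 ->
  derivable_pt_lim (fun s => fst (g s)) t (fst g') ->
  derivable_pt_lim (fun s => snd (g s)) t (snd g') ->
  derivable_pt_lim (fun s => fst (V (g s))) t (fst (RtoC (fst g') * p1 (g t) + RtoC (snd g') * p2 (g t))%C) /\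
  derivable_pt_lim (fun s => snd (V (g s))) t (snd (RtoC (fst g') * p1 (g t) + RtoC (snd g') * p2 (g t))%C).
Proof.
  intros [_ [_ [_ [K [HK H]]]]] H1 H2.
  assert (forall s, g s = (fst (g s), snd (g s))) as Eg by (intros; apply surjective_pairing).
  split.
  - pose proof (quadratic_curve_derive (fun z => fst (V z)) (fun z => fst (p1 z)) (fun z => fst (p2 z))
      K (fun s => fst (g s)) (fun s => snd (g s)) t (fst g') (snd g') HK) as D.
    assert (forall z e : C, Rabs (fst (V (z + e)%C) - fst (V z) - (fst e * fst (p1 z) + snd e * fst (p2 z)))
       <= K * Cmod e ^ 2) as HX.
    { intros z e. eapply Rle_trans; [|apply (H z e)]. eapply Rle_trans; [|apply fst_le_Cmod].
      apply Req_le. f_equal.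
      generalize (V (z + e)%C), (V z), (p1 z), (p2 z). intros. simpl. ring. }
    specialize (D HX H1 H2). simpl in D.
    eapply derivable_pt_lim_ext in D; [|intros s; rewrite <- Eg; reflexivity].
    rewrite <- Eg in D. simpl.
    match goal with |- derivable_pt_lim _ _ ?l => match type of D with derivable_pt_lim _ _ ?l' =>
      replace l with l' by ring end end. exact D.
  - pose proof (quadratic_curve_derive (fun z => snd (V z)) (fun z => snd (p1 z)) (fun z => snd (p2 z))
      K (fun s => fst (g s)) (fun s => snd (g s)) t (fst g') (snd g') HK) as D.
    assert (forall z e : C, Rabs (snd (V (z + e)%C) - snd (V z) - (fst e * snd (p1 z) + snd e * snd (p2 z)))
       <= K * Cmod e ^ 2) as HX.
    { intros z e. eapply Rle_trans; [|apply (H z e)]. eapply Rle_trans; [|apply snd_le_Cmod].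
      apply Req_le. f_equal.
      generalize (V (z + e)%C), (V z), (p1 z), (p2 z). intros. simpl. ring. }
    specialize (D HX H1 H2). simpl in D.
    eapply derivable_pt_lim_ext in D; [|intros s; rewrite <- Eg; reflexivity].
    rewrite <- Eg in D. simpl.
    match goal with |- derivable_pt_lim _ _ ?l => match type of D with derivable_pt_lim _ _ ?l' =>
      replace l with l' by ring end end. exact D.
Qed.

(** * Polar coordinates and the inversion formula *)

Definition d_rad (p1 p2 : C -> C) (w : R) (z : C) : C := (RtoC (cos w) * p1 z + RtoC (sin w) * p2 z)%C.
Definition d_ang (p1 p2 : C -> C) (w : R) (z : C) : C := (RtoC (- sin w) * p1 z + RtoC (cos w) * p2 z)%C.

Lemma LipC_d_rad p1 p2 w : LipC p1 -> LipC p2 -> LipC (d_rad p1 p2 w).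
Proof. intros; apply LipC_plus; apply LipC_scal; assumption. Qed.
Lemma LipC_d_ang p1 p2 w : LipC p1 -> LipC p2 -> LipC (d_ang p1 p2 w).
Proof. intros; apply LipC_plus; apply LipC_scal; assumption. Qed.

(** Along z - rho e^{iw} the derivative of V in rho is minus [d_rad], so the fundamental theorem of
    calculus leaves the two end points. *)
Lemma ray_d_rad V p1 p2 L z w : C11 V p1 p2 ->
  ray L (d_rad p1 p2 w) z w = (V z - V (z - RtoC L * expi w))%C.
Proof.
  intros HV. unfold ray.
  assert (contC (fun rho => d_rad p1 p2 w (z - RtoC rho * expi w)%C)) as Hc.
  { destruct HV as [_ [[_ B1] [[_ B2] _]]]. apply ray_integrand_contC, LipC_d_rad; assumption. }
  pose proof (Cint_derive (fun rho => V (z - RtoC rho * expi w)%C)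
    (fun rho => (-1) * d_rad p1 p2 w (z - RtoC rho * expi w)%C)%C 0 L) as E.
  rewrite Cint_scal in E by exact Hc.
  assert (forall t, derivable_pt_lim (fun s => fst (z - RtoC s * expi w)%C) t (fst (- expi w)%C) /\
                    derivable_pt_lim (fun s => snd (z - RtoC s * expi w)%C) t (snd (- expi w)%C)) as D.
  { intros t. split; apply is_derive_Reals; simpl; auto_derive; trivial; ring. }
  assert (forall t, (RtoC (fst (- expi w)%C) * p1 (z - RtoC t * expi w) + RtoC (snd (- expi w)%C) * p2 (z - RtoC t * expi w)
      = (-1) * d_rad p1 p2 w (z - RtoC t * expi w))%C) as F.
  { intros t. unfold d_rad. simpl. rewrite !RtoC_opp. ring. }
  match type of E with ?A -> _ => assert A as HA by (apply contC_scal; exact Hc) end.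
  specialize (E HA).
  assert (forall A B : C, ((-1) * A = B)%C -> A = (- B)%C) as N.
  { intros A0 B0 e. rewrite <- e. ring. }
  match type of E with _ -> _ -> ?x = ?y => assert (x = y) as E2; [apply E|] end.
  - intros t. rewrite <- F.
    apply (C11_curve_derive V p1 p2 (fun s => z - RtoC s * expi w)%C); [exact HV | apply D | apply D].
  - intros t. rewrite <- F.
    apply (C11_curve_derive V p1 p2 (fun s => z - RtoC s * expi w)%C); [exact HV | apply D | apply D].
  - rewrite (N _ _ E2). replace (z - RtoC 0 * expi w)%C with z by ring. ring.
Qed.

(** One constant serves all radii up to [rho], as the exchange of the radial and the angular
    integral requires. *)
Lemma LipRC_d_ang_circle p1 p2 z rho : BL p1 -> BL p2 -> 0 <= rho ->
  exists K, 0 <= K /\ forall r s t, Rabs r <= rho ->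
    Cmod (d_ang p1 p2 s (z - RtoC r * expi s) - d_ang p1 p2 t (z - RtoC r * expi t)) <= K * Rabs (s - t).
Proof.
  intros [[m Hm] [K [HK H]]] [[n Hn] [K2 [HK2 H2]]] Hr.
  assert (0 <= m) by (eapply Rle_trans; [apply Cmod_ge_0 | apply (Hm 0%C)]).
  assert (0 <= n) by (eapply Rle_trans; [apply Cmod_ge_0 | apply (Hn 0%C)]).
  exists ((m + K * (rho * 2)) + (n + K2 * (rho * 2))). split; [nra|]. intros r s t Hrr.
  assert (forall r, Rabs r <= rho -> Cmod ((z - RtoC r * expi s) - (z - RtoC r * expi t)) <= (rho * 2) * Rabs (s - t)) as D.
  { intros q Hq. replace (z - q * expi s - (z - q * expi t))%C with (- (RtoC q * (expi s - expi t)))%C by ring.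
    rewrite Cmod_opp, Cmod_mult, Cmod_R, Rmult_assoc. apply Rmult_le_compat; auto using Rabs_pos, Cmod_ge_0, expi_lip. }
  specialize (D r Hrr). unfold d_ang.
  set (u := (z - RtoC r * expi s)%C) in *. set (v := (z - RtoC r * expi t)%C) in *.
  replace (RtoC (- sin s) * p1 u + RtoC (cos s) * p2 u - (RtoC (- sin t) * p1 v + RtoC (cos t) * p2 v))%C
    with ((RtoC (- sin s) * p1 u - RtoC (- sin t) * p1 v) + (RtoC (cos s) * p2 u - RtoC (cos t) * p2 v))%C by ring.
  eapply Rle_trans; [apply Cmod_triangle|]. rewrite Rmult_plus_distr_r.
  pose proof (Rabs_pos (s - t)).
  apply Rplus_le_compat; (eapply Rle_trans; [apply Cmod_mult_diff|]); rewrite Rmult_plus_distr_r;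
    apply Rplus_le_compat.
  - rewrite <- RtoC_minus, Cmod_R, Rmult_comm. apply Rmult_le_compat; auto using Cmod_ge_0, Rabs_pos.
    replace (- sin s - - sin t) with (- (sin s - sin t)) by ring. rewrite Rabs_Ropp. apply Rabs_sin_diff.
  - rewrite Cmod_R, Rabs_Ropp. rewrite <- (Rmult_1_l (K * _ * _)).
    apply Rmult_le_compat; auto using Cmod_ge_0, Rabs_pos.
    + apply Rabs_le, SIN_bound.
    + eapply Rle_trans; [apply H|]. rewrite Rmult_assoc. apply Rmult_le_compat_l; assumption.
  - rewrite <- RtoC_minus, Cmod_R, Rmult_comm. apply Rmult_le_compat; auto using Cmod_ge_0, Rabs_pos, Rabs_cos_diff.
  - rewrite Cmod_R. rewrite <- (Rmult_1_l (K2 * _ * _)).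
    apply Rmult_le_compat; auto using Cmod_ge_0, Rabs_pos.
    + apply Rabs_le, COS_bound.
    + eapply Rle_trans; [apply H2|]. rewrite Rmult_assoc. apply Rmult_le_compat_l; assumption.
Qed.

(** -rho times [d_ang] is the derivative of V in the angle along a circle, and V returns to its
    initial value after a full turn. The proof divides by rho, hence [0 < rho]. *)
Lemma circle_d_ang V p1 p2 z rho : C11 V p1 p2 -> 0 < rho ->
  Cint (fun w => d_ang p1 p2 w (z - RtoC rho * expi w)%C) 0 (2 * PI) = 0%C.
Proof.
  intros HV Hr.
  assert (contC (fun w => d_ang p1 p2 w (z - RtoC rho * expi w)%C)) as Hc.
  { destruct HV as [_ [B1 [B2 _]]]. destruct (LipRC_d_ang_circle p1 p2 z rho B1 B2 (Rlt_le _ _ Hr)) as [K [HK H]].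
    apply LipRC_contC. exists K. split; [exact HK|]. intros s t. apply H. rewrite Rabs_pos_eq; lra. }
  pose proof (Cint_derive (fun w => V (z - RtoC rho * expi w)%C)
    (fun w => RtoC (- rho) * d_ang p1 p2 w (z - RtoC rho * expi w)%C)%C 0 (2 * PI)) as E.
  rewrite Cint_scal in E by exact Hc.
  assert (forall t, derivable_pt_lim (fun s => fst (z - RtoC rho * expi s)%C) t (fst (RtoC (- rho) * (Ci * expi t))%C) /\
                    derivable_pt_lim (fun s => snd (z - RtoC rho * expi s)%C) t (snd (RtoC (- rho) * (Ci * expi t))%C)) as D.
  { intros t. split; apply is_derive_Reals; simpl; auto_derive; trivial; ring. }
  assert (forall t, (RtoC (fst (RtoC (- rho) * (Ci * expi t))%C) * p1 (z - RtoC rho * expi t)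
      + RtoC (snd (RtoC (- rho) * (Ci * expi t))%C) * p2 (z - RtoC rho * expi t)
      = RtoC (- rho) * d_ang p1 p2 t (z - RtoC rho * expi t))%C) as F.
  { intros t. unfold d_ang.
    replace (fst (RtoC (- rho) * (Ci * expi t))%C) with (- rho * - sin t) by (simpl; ring).
    replace (snd (RtoC (- rho) * (Ci * expi t))%C) with (- rho * cos t) by (simpl; ring).
    rewrite !RtoC_mult. ring. }
  match type of E with ?A -> _ => assert A as HA by (apply contC_scal; exact Hc) end.
  specialize (E HA).
  assert (RtoC (- rho) <> 0%C) as N by (intros e; apply RtoC_inj in e; lra).
  match type of E with _ -> _ -> ?x = ?y => assert (x = y) as E2; [apply E|] end.
  - intros t. rewrite <- F.
    apply (C11_curve_derive V p1 p2 (fun s => z - RtoC rho * expi s)%C); [exact HV | apply D | apply D].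
  - intros t. rewrite <- F.
    apply (C11_curve_derive V p1 p2 (fun s => z - RtoC rho * expi s)%C); [exact HV | apply D | apply D].
  - replace (expi (2 * PI)) with (expi 0) in E2
      by (rewrite <- (expi_2PI 0); f_equal; ring).
    match goal with |- ?x = _ => replace x with (/ RtoC (- rho) * (RtoC (- rho) * x))%C by (field; exact N) end.
    rewrite E2. ring.
Qed.

(** [Cint_fubini] asks for Lipschitz bounds on the whole plane; freezing the radius outside [0, L]
    provides them without changing the integrals. *)
Definition clamp (L x : R) : R := Rmax 0 (Rmin L x).
Lemma clamp_id L x : 0 <= x <= L -> clamp L x = x.
Proof. intros. unfold clamp. rewrite Rmin_right, Rmax_right; lra. Qed.
Lemma clamp_range L x : 0 <= L -> 0 <= clamp L x <= L.
Proof. intros. unfold clamp. split; [apply Rmax_l|]. apply Rmax_lub; [assumption | apply Rmin_l]. Qed.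
Lemma clamp_lip L x y : 0 <= L -> Rabs (clamp L x - clamp L y) <= Rabs (x - y).
Proof.
  intros _. unfold clamp.
  assert (forall u v, Rabs (Rmax 0 u - Rmax 0 v) <= Rabs (u - v)) as H1.
  { intros u v. unfold Rmax. destruct (Rle_dec 0 u), (Rle_dec 0 v);
    unfold Rabs; repeat destruct Rcase_abs; lra. }
  assert (forall u v, Rabs (Rmin L u - Rmin L v) <= Rabs (u - v)) as H2.
  { intros u v. unfold Rmin. destruct (Rle_dec L u), (Rle_dec L v);
    unfold Rabs; repeat destruct Rcase_abs; lra. }
  eapply Rle_trans; [apply H1 | apply H2].
Qed.

(** After the exchange of integrals each circle contributes zero; the radius 0 is only an end point
    of the interval of integration. *)
Lemma ang_average_0 V p1 p2 L z : C11 V p1 p2 -> 0 <= L ->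
  Cint (fun w => ray L (d_ang p1 p2 w) z w) 0 (2 * PI) = 0%C.
Proof.
  intros HV HL. pose proof PI_RGT_0. pose proof HV as [_ [B1 [B2 _]]].
  pose (f := fun rho w => d_ang p1 p2 w (z - RtoC (clamp L rho) * expi w)%C).
  destruct (LipRC_d_ang_circle p1 p2 z L B1 B2 HL) as [K1 [HK1 H1]].
  destruct B1 as [_ [K2 [HK2 H2]]], B2 as [_ [K3 [HK3 H3]]].
  rewrite (Cint_ext _ (fun w => Cint (fun rho => f rho w) 0 L)); [|lra|].
  2: { intros w _. unfold ray. apply Cint_ext; [exact HL|]. intros rho Hr. unfold f.
       rewrite clamp_id by lra. reflexivity. }
  rewrite (Cint_fubini f (K1 + K2 + K3)); try lra.
  - rewrite (Cint_ext _ (fun _ => 0%C)); [rewrite Cint_const; ring | exact HL |].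
    intros rho Hr. unfold f. rewrite clamp_id by lra. apply (circle_d_ang V); [exact HV | lra].
  - intros x x' y. unfold f, d_ang.
    set (u := (z - RtoC (clamp L x) * expi y)%C). set (v := (z - RtoC (clamp L x') * expi y)%C).
    assert (Cmod (u - v) <= Rabs (x - x')) as D.
    { unfold u, v. replace (z - clamp L x * expi y - (z - clamp L x' * expi y))%C
        with (- (RtoC (clamp L x - clamp L x') * expi y))%C by (rewrite RtoC_minus; ring).
      rewrite Cmod_opp, Cmod_mult, Cmod_expi, Cmod_R, Rmult_1_r. apply clamp_lip; exact HL. }
    replace (RtoC (- sin y) * p1 u + RtoC (cos y) * p2 u - (RtoC (- sin y) * p1 v + RtoC (cos y) * p2 v))%C
      with (RtoC (- sin y) * (p1 u - p1 v) + RtoC (cos y) * (p2 u - p2 v))%C by ring.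
    eapply Rle_trans; [apply Cmod_triangle|]. rewrite !Cmod_mult, !Cmod_R, Rabs_Ropp.
    assert (Rabs (sin y) <= 1) by apply Rabs_le, SIN_bound.
    assert (Rabs (cos y) <= 1) by apply Rabs_le, COS_bound.
    assert (Rabs (sin y) * Cmod (p1 u - p1 v) <= 1 * (K2 * Cmod (u - v))) by
      (apply Rmult_le_compat; auto using Rabs_pos, Cmod_ge_0).
    assert (Rabs (cos y) * Cmod (p2 u - p2 v) <= 1 * (K3 * Cmod (u - v))) by
      (apply Rmult_le_compat; auto using Rabs_pos, Cmod_ge_0).
    pose proof (Rabs_pos (x - x')). pose proof (Cmod_ge_0 (u - v)). nra.
  - intros x y y'. unfold f. eapply Rle_trans; [apply H1|].
    + pose proof (clamp_range L x HL). rewrite Rabs_pos_eq; lra.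
    + pose proof (Rabs_pos (y - y')). nra.
Qed.

(* X_lam = lam d/dz + lam^-1 d/dzbar; for lam = e^{i phi} this is the derivative along (cos phi, sin phi) *)
Definition Xop (lam : C) (p1 p2 : C -> C) (z : C) : C :=
  (/ 2 * (lam * (p1 z - Ci * p2 z)) + / 2 * (/ lam * (p1 z + Ci * p2 z)))%C.

Lemma C2_neq_0 : RtoC 2 <> 0%C.
Proof. intros e; apply RtoC_inj in e; lra. Qed.

Lemma Ci_sqr : (Ci * Ci = -1)%C.
Proof. unfold Ci, Cmult; simpl. unfold RtoC. f_equal; ring. Qed.

(** In the frame rotated by w, X_lam = (mu + 1/mu)/2 [d_rad] + i (1/mu - mu)/2 [d_ang]. The kernel
    makes the angular coefficient the constant i/2, and angular derivatives with constant weight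
    average to zero. *)
Lemma ker_Xop (lam : C) p1 p2 w z : lam <> 0%C -> Cmod lam < 1 ->
  (ker lam w * Xop lam p1 p2 z = / 2 * poisson lam w * d_rad p1 p2 w z + Ci / 2 * d_ang p1 p2 w z)%C.
Proof.
  intros Hl H1. pose proof (mu_denom_neq_0 lam w H1) as Hd.
  pose proof C2_neq_0 as N2.
  assert (expi w <> 0)%C as He by (apply Cmod_gt_0; rewrite Cmod_expi; lra).
  assert (lam = mu lam w * expi w)%C as El.
  { unfold mu. rewrite <- Cmult_assoc, expi_opp_mult. ring. }
  assert (mu lam w <> 0)%C as Hm.
  { intros e. apply Hl. rewrite El, e. ring. }
  assert (RtoC (cos w) = / 2 * (expi w + / expi w) /\ RtoC (sin w) = - Ci / 2 * (expi w - / expi w))%C as [Ec Es].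
  { assert (/ expi w = expi (- w))%C as ->.
    { replace (expi (-w)) with (expi (- w) * expi w * / expi w)%C by (field; assumption).
      rewrite expi_opp_mult. ring. }
    unfold expi. rewrite cos_neg, sin_neg. split; apply injective_projections; simpl; field. }
  unfold ker, Xop, poisson, d_rad, d_ang. rewrite RtoC_opp, Ec, Es.
  revert Hd Hm El. generalize (mu lam w). intros m Hd Hm El.
  rewrite El. set (e := expi w) in *.
  set (P := p1 z). set (S := p2 z).
  assert (forall a b c d : C, a = b -> c = d -> (a + Ci * c = b + Ci * d)%C) as G by (intros; subst; ring).
  transitivity ((/ 2 * (m / (1 - m * m)) * (m * e + / (m * e)) * P)
     + Ci * (/ 2 * (m / (1 - m * m)) * (/ (m * e) - m * e) * S))%C.
  { field. repeat split; assumption. }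
  (* [field] treats [Ci] as an indeterminate, so the place where its square occurs is isolated and
     rewritten to -1. *)
  transitivity ((/ 2 * ((1 + m * m) / (1 - m * m)) * (/ 2 * (e + / e)) * P - Ci * Ci / 2 * (/2 * (/ e - e)) * P) +
    Ci * (- / 2 * ((1 + m * m) / (1 - m * m)) * (/ 2 * (e - / e)) * S + / 2 * (/ 2 * (e + / e)) * S))%C.
  { rewrite Ci_sqr. apply G; field; repeat split; assumption. }
  field. repeat split; assumption.
Qed.

(** The radial part telescopes along each ray to V z, because V vanishes at the far end, and
    [poisson] has mean 1. The angular part averages to zero. *)
Lemma Top_Xop L (lam : C) V p1 p2 z : 0 <= L -> lam <> 0%C -> Cmod lam < 1 -> C11 V p1 p2 ->
  (forall w, V (z - RtoC L * expi w)%C = 0%C) ->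
  Top L lam (Xop lam p1 p2) z = V z.
Proof.
  intros HL Hl H1 HV H0. pose proof PI_RGT_0. pose proof HV as [_ [B1 [B2 _]]].
  unfold Top.
  rewrite (Cint_ext _ (fun w => (/ 2 * V z) * poisson lam w + Ci / 2 * ray L (d_ang p1 p2 w) z w)%C); [|lra|].
  - assert (contC (fun w => ray L (d_ang p1 p2 w) z w)) as Hc.
    { destruct (LipRC_d_ang_circle p1 p2 z L B1 B2 HL) as [K [HK H2]].
      apply LipRC_contC. exists (2 * (L * K)). split; [nra|]. intros s t. unfold ray.
      rewrite <- Cint_minus by (apply ray_integrand_contC, LipC_d_ang; [apply B1 | apply B2]).
      eapply Rle_trans; [apply Cint_bound_const with (m := K * Rabs (s - t)); [exact HL| |]|].
      - apply contC_minus; apply ray_integrand_contC, LipC_d_ang; solve [apply B1 | apply B2].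
      - intros r Hr. apply H2. rewrite Rabs_pos_eq; lra.
      - lra. }
    pose proof (poisson_contC lam H1) as Hp.
    rewrite (Cint_plus _ _ _ _ (contC_scal (/ 2 * V z) _ Hp) (contC_scal (Ci / 2) _ Hc)).
    rewrite (Cint_scal (/ 2 * V z) _ _ _ Hp), (Cint_scal (Ci / 2) _ _ _ Hc).
    rewrite (ang_average_0 V), poisson_mean by assumption.
    rewrite RtoC_inv, RtoC_mult by lra. field.
    repeat split; try exact C2_neq_0; intros e; apply RtoC_inj in e; lra.
  - intros w _.
    transitivity (Cint (fun rho => ker lam w * Xop lam p1 p2 (z - RtoC rho * expi w))%C 0 L).
    { unfold ray. rewrite Cint_scal; [reflexivity|]. apply ray_integrand_contC.
      apply LipC_plus; apply LipC_scal, LipC_scal; [apply LipC_minus | apply LipC_plus];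
      try apply LipC_scal; solve [apply B1 | apply B2]. }
    rewrite (Cint_ext _ (fun rho => / 2 * poisson lam w * d_rad p1 p2 w (z - RtoC rho * expi w)
       + Ci / 2 * d_ang p1 p2 w (z - RtoC rho * expi w))%C); [|exact HL|].
    + assert (contC (fun rho => d_rad p1 p2 w (z - RtoC rho * expi w)%C)) as Cr
        by (apply ray_integrand_contC, LipC_d_rad; [apply B1 | apply B2]).
      assert (contC (fun rho => d_ang p1 p2 w (z - RtoC rho * expi w)%C)) as Ca
        by (apply ray_integrand_contC, LipC_d_ang; [apply B1 | apply B2]).
      rewrite (Cint_plus _ _ _ _ (contC_scal (/ 2 * poisson lam w) _ Cr) (contC_scal (Ci / 2) _ Ca)).
      rewrite (Cint_scal (/ 2 * poisson lam w) _ _ _ Cr), (Cint_scal (Ci / 2) _ _ _ Ca).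
      pose proof (ray_d_rad V p1 p2 L z w HV) as E. unfold ray in E. rewrite E, H0. unfold ray. ring.
    + intros rho _. apply ker_Xop; assumption.
Qed.

(** * Mollification *)

(** A box kernel is convenient: the derivative of a moving average is a difference quotient, so a
    single average makes a Lipschitz function C^{1,1} in that variable. *)
Definition avg (eps : R) (h : R -> R) : R := RInt h (- eps) eps / (2 * eps).

Lemma continuous_lip (h : R -> R) K : 0 <= K -> (forall s t, Rabs (h s - h t) <= K * Rabs (s - t)) ->
  forall t, continuous h t.
Proof.
  intros HK H t. apply continuous_eps. intros eps He. exists (eps / (K + 1)).
  split; [apply Rdiv_lt_0_compat; lra|]. intros s Hs. eapply Rle_lt_trans; [apply H|].
  apply Rmult_lt_compat_l with (r := K + 1) in Hs; [|lra].
  replace ((K + 1) * (eps / (K + 1))) with eps in Hs by (field; lra).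
  pose proof (Rabs_pos (s - t)). nra.
Qed.

Lemma avg_const eps c : 0 < eps -> avg eps (fun _ => c) = c.
Proof.
  intros. unfold avg. rewrite RInt_const. unfold scal; simpl; unfold mult; simpl. field. lra.
Qed.

Lemma avg_close eps g h d : 0 < eps -> (forall t, continuous g t) -> (forall t, continuous h t) ->
  (forall t, - eps <= t <= eps -> Rabs (g t - h t) <= d) -> Rabs (avg eps g - avg eps h) <= d.
Proof.
  intros He Hg Hh H. unfold avg.
  replace (RInt g (- eps) eps / (2 * eps) - RInt h (- eps) eps / (2 * eps))
    with ((RInt g (- eps) eps - RInt h (- eps) eps) / (2 * eps)) by (field; lra).
  assert (RInt (fun x => g x - h x) (- eps) eps = RInt g (- eps) eps - RInt h (- eps) eps) as E
    by (apply (RInt_minus (V := R_CompleteNormedModule)); auto with cint).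
  rewrite <- E.
  assert (Rabs (RInt (fun t => g t - h t) (- eps) eps) <= (eps - - eps) * d).
  { apply RInt_abs_bound; [lra | | exact H]. intros t. apply (continuous_minus (V := R_NormedModule)); auto. }
  unfold Rdiv. rewrite Rabs_mult, (Rabs_pos_eq (/ _)) by (left; apply Rinv_0_lt_compat; lra).
  apply Rmult_le_reg_r with (2 * eps); [lra|]. rewrite Rmult_assoc, Rinv_l by lra. lra.
Qed.

Lemma avg_lin eps g h y d : (forall t, continuous g t) -> (forall t, continuous h t) -> (forall t, continuous d t) ->
  avg eps (fun t => g t - h t - y * d t) = avg eps g - avg eps h - y * avg eps d.
Proof.
  intros Hg Hh Hd. unfold avg.
  assert (forall t, continuous (fun t => g t - h t) t) as C1
    by (intros; apply (continuous_minus (V := R_NormedModule)); auto).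
  assert (forall t, continuous (fun t => y * d t) t) as C2
    by (intros; apply (continuous_mult (K := R_AbsRing)); [apply continuous_const | auto]).
  assert (RInt (fun t => g t - h t - y * d t) (- eps) eps
    = RInt (fun t => g t - h t) (- eps) eps - RInt (fun t => y * d t) (- eps) eps) as ->
    by (apply (RInt_minus (V := R_CompleteNormedModule)); auto with cint).
  assert (RInt (fun t => g t - h t) (- eps) eps = RInt g (- eps) eps - RInt h (- eps) eps) as ->
    by (apply (RInt_minus (V := R_CompleteNormedModule)); auto with cint).
  assert (RInt (fun t => y * d t) (- eps) eps = y * RInt d (- eps) eps) as ->
    by (apply (RInt_scal (V := R_CompleteNormedModule)); auto with cint).
  unfold Rdiv. ring.
Qed.

Lemma RInt_upper_derive (h : R -> R) c x : (forall t, continuous h t) ->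
  derivable_pt_lim (fun y => RInt h c y) x (h x).
Proof.
  intros H. apply is_derive_Reals. apply (is_derive_RInt (V := R_NormedModule)) with c; [|apply H].
  exists (mkposreal 1 Rlt_0_1). intros y _.
  apply (RInt_correct (V := R_CompleteNormedModule)). auto with cint.
Qed.

(** The moving average is a difference of a primitive at x + eps and x - eps, so its derivative is
    the symmetric difference quotient of h, which has Lipschitz constant K / eps. *)
Lemma avg_taylor eps (h : R -> R) K x : 0 < eps -> 0 <= K ->
  (forall s t, Rabs (h s - h t) <= K * Rabs (s - t)) ->
  Rabs (avg eps (fun s => h (x + s)) - avg eps h - x * ((h eps - h (- eps)) / (2 * eps))) <= K / eps * x ^ 2.
Proof.
  intros He HK H. pose proof (continuous_lip h K HK H) as Hc.
  pose (F := fun y => (RInt h 0 (y + eps) - RInt h 0 (y + - eps)) / (2 * eps)).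
  assert (forall y, avg eps (fun s => h (y + s)) = F y) as EF.
  { intros y. unfold avg, F. f_equal.
    assert (RInt (fun s => h (y + s)) (- eps) eps = RInt h (y + - eps) (y + eps)) as ->.
    { pose proof (RInt_comp_lin (V := R_CompleteNormedModule) h 1 y (- eps) eps) as E.
      rewrite !Rmult_1_l in E. rewrite (Rplus_comm (- eps)), (Rplus_comm eps) in E.
      rewrite <- E by auto with cint. apply RInt_ext. intros s _.
      unfold scal; simpl; unfold mult; simpl. rewrite !Rmult_1_l, Rplus_comm. reflexivity. }
    assert (RInt h 0 (y + - eps) + RInt h (y + - eps) (y + eps) = RInt h 0 (y + eps)) as E
      by (apply (RInt_Chasles (V := R_CompleteNormedModule)); auto with cint).
    lra. }
  destruct (MVT_0 F (fun y => (h (y + eps) - h (y + - eps)) / (2 * eps)) x) as [c [Hxc E]].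
  { intros y. unfold F. unfold Rdiv.
    assert (forall d, derivable_pt_lim (fun y => RInt h 0 (y + d)) y (h (y + d))) as D.
    { intros d. pose proof (derivable_pt_lim_comp (fun y => y + d) (RInt h 0) y 1 (h (y + d))) as D.
      rewrite Rmult_1_r in D. apply D; [|apply RInt_upper_derive; exact Hc].
      rewrite <- (Rplus_0_r 1). apply derivable_pt_lim_plus; [apply derivable_pt_lim_id | apply derivable_pt_lim_const]. }
    apply (derivable_pt_lim_ext (mult_real_fct (/ (2 * eps)) (fun y => RInt h 0 (y + eps) - RInt h 0 (y + - eps)))).
    { intros z. unfold mult_real_fct. ring. }
    rewrite (Rmult_comm (_ - _)). apply derivable_pt_lim_scal. apply derivable_pt_lim_minus; apply D. }
  rewrite EF. rewrite <- (EF 0) in E.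
  replace (avg eps (fun s => h (0 + s))) with (avg eps h) in E
    by (f_equal; apply functional_extensionality; intros; rewrite Rplus_0_l; reflexivity).
  rewrite E.
  replace ((h (c + eps) - h (c + - eps)) / (2 * eps) * x - x * ((h eps - h (- eps)) / (2 * eps)))
    with (x * (((h (c + eps) - h eps) - (h (c + - eps) - h (- eps))) * / (2 * eps))) by (field; lra).
  rewrite !Rabs_mult, (Rabs_pos_eq (/ (2 * eps))) by (left; apply Rinv_0_lt_compat; lra).
  assert (Rabs ((h (c + eps) - h eps) - (h (c + - eps) - h (- eps))) <= 2 * (K * Rabs x)) as B.
  { assert (forall d, Rabs (h (c + d) - h d) <= K * Rabs x) as B0.
    { intros d. eapply Rle_trans; [apply H|]. replace (c + d - d) with c by ring. apply Rmult_le_compat_l; assumption. }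
    pose proof (B0 eps) as B1. pose proof (B0 (- eps)) as B2.
    pose proof (Rabs_triang (h (c + eps) - h eps) (- (h (c + - eps) - h (- eps)))) as T.
    rewrite Rabs_Ropp in T. unfold Rminus at 1. lra. }
  rewrite <- (pow2_abs x).
  replace (K / eps * Rabs x ^ 2) with (Rabs x * (2 * (K * Rabs x) * / (2 * eps))) by (field; lra).
  apply Rmult_le_compat_l; [apply Rabs_pos|].
  apply Rmult_le_compat_r; [left; apply Rinv_0_lt_compat; lra | exact B].
Qed.

Definition LipCR (K : R) (g : C -> R) : Prop := forall z w, Rabs (g z - g w) <= K * Cmod (z - w).

Lemma LipCR_bounded_LipC K g m : 0 <= K -> LipCR K g -> (forall z, Rabs (g z) <= m) -> BL (fun z => RtoC (g z)).
Proof.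
  intros HK H Hm. split.
  - exists m. intros z. rewrite Cmod_R. apply Hm.
  - exists K. split; [exact HK|]. intros z w. rewrite <- RtoC_minus, Cmod_R. apply H.
Qed.

Definition av1 eps (g : C -> R) (z : C) : R := avg eps (fun s => g (fst z + s, snd z)).
Definition av2 eps (g : C -> R) (z : C) : R := avg eps (fun s => g (fst z, snd z + s)).
Definition dq1 eps (g : C -> R) (z : C) : R := (g (fst z + eps, snd z) - g (fst z + - eps, snd z)) / (2 * eps).
Definition dq2 eps (g : C -> R) (z : C) : R := (g (fst z, snd z + eps) - g (fst z, snd z + - eps)) / (2 * eps).
Definition moll eps (g : C -> R) : C -> R := av1 eps (av2 eps g).

Lemma Cmod_real x : Cmod (x, 0) = Rabs x.
Proof. apply (Cmod_R x). Qed.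
Lemma Cmod_imag x : Cmod (0, x) = Rabs x.
Proof.
  replace (0, x) with (Ci * RtoC x)%C by (apply injective_projections; simpl; ring).
  rewrite Cmod_mult, Cmod_Ci, Cmod_R. ring.
Qed.

Lemma LipCR_row K g z s t : LipCR K g ->
  Rabs (g (fst z + s, snd z) - g (fst z + t, snd z)) <= K * Rabs (s - t).
Proof.
  intros H. eapply Rle_trans; [apply H|]. apply Req_le. f_equal.
  rewrite <- Cmod_real. f_equal. apply injective_projections; simpl; ring.
Qed.
Lemma LipCR_col K g z s t : LipCR K g ->
  Rabs (g (fst z, snd z + s) - g (fst z, snd z + t)) <= K * Rabs (s - t).
Proof.
  intros H. eapply Rle_trans; [apply H|]. apply Req_le. f_equal.
  rewrite <- Cmod_imag. f_equal. apply injective_projections; simpl; ring.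
Qed.
Lemma LipCR_row_cont K g z : 0 <= K -> LipCR K g -> forall t, continuous (fun s => g (fst z + s, snd z)) t.
Proof. intros HK H. apply (continuous_lip _ K HK). intros; apply LipCR_row; exact H. Qed.
Lemma LipCR_col_cont K g z : 0 <= K -> LipCR K g -> forall t, continuous (fun s => g (fst z, snd z + s)) t.
Proof. intros HK H. apply (continuous_lip _ K HK). intros; apply LipCR_col; exact H. Qed.

Lemma av1_LipCR eps K g : 0 < eps -> 0 <= K -> LipCR K g -> LipCR K (av1 eps g).
Proof.
  intros He HK H z w. apply avg_close; auto; try (eapply LipCR_row_cont; eassumption).
  intros t _. eapply Rle_trans; [apply H|]. apply Req_le. f_equal. f_equal.
  apply injective_projections; simpl; ring.
Qed.
Lemma av2_LipCR eps K g : 0 < eps -> 0 <= K -> LipCR K g -> LipCR K (av2 eps g).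
Proof.
  intros He HK H z w. apply avg_close; auto; try (eapply LipCR_col_cont; eassumption).
  intros t _. eapply Rle_trans; [apply H|]. apply Req_le. f_equal. f_equal.
  apply injective_projections; simpl; ring.
Qed.

Lemma diff_quot_bound eps a b c : 0 < eps -> Rabs (a - b) <= c * (2 * eps) -> Rabs ((a - b) / (2 * eps)) <= c.
Proof.
  intros He H. unfold Rdiv. rewrite Rabs_mult, (Rabs_pos_eq (/ _)) by (left; apply Rinv_0_lt_compat; lra).
  apply Rmult_le_reg_r with (2 * eps); [lra|]. rewrite Rmult_assoc, Rinv_l by lra. lra.
Qed.

Lemma dq_LipCR eps K g h1 h2 : 0 < eps -> 0 <= K -> LipCR K g ->
  LipCR (K / eps) (fun z => (g (fst z + fst h1, snd z + snd h1) - g (fst z + fst h2, snd z + snd h2)) / (2 * eps)).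
Proof.
  intros He HK H z w.
  replace ((g (fst z + fst h1, snd z + snd h1) - g (fst z + fst h2, snd z + snd h2)) / (2 * eps) -
    (g (fst w + fst h1, snd w + snd h1) - g (fst w + fst h2, snd w + snd h2)) / (2 * eps)) with
   (((g (fst z + fst h1, snd z + snd h1) - g (fst w + fst h1, snd w + snd h1)) -
     (g (fst z + fst h2, snd z + snd h2) - g (fst w + fst h2, snd w + snd h2))) / (2 * eps)) by (field; lra).
  apply diff_quot_bound; [exact He|].
  assert (forall h : C, Rabs (g (fst z + fst h, snd z + snd h) - g (fst w + fst h, snd w + snd h)) <= K * Cmod (z - w)) as B.
  { intros h. eapply Rle_trans; [apply H|]. apply Req_le. f_equal. f_equal.
    apply injective_projections; simpl; ring. }
  replace (K / eps * Cmod (z - w) * (2 * eps)) with (K * Cmod (z - w) + K * Cmod (z - w)) by (field; lra).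
  eapply Rle_trans; [apply Rabs_triang|]. rewrite Rabs_Ropp. apply Rplus_le_compat; apply B.
Qed.

Lemma dq1_LipCR eps K g : 0 < eps -> 0 <= K -> LipCR K g -> LipCR (K / eps) (dq1 eps g).
Proof.
  intros He HK H z w. pose proof (dq_LipCR eps K g (eps, 0) (- eps, 0) He HK H z w) as D.
  simpl in D. rewrite !Rplus_0_r in D. exact D.
Qed.
Lemma dq2_LipCR eps K g : 0 < eps -> 0 <= K -> LipCR K g -> LipCR (K / eps) (dq2 eps g).
Proof.
  intros He HK H z w. pose proof (dq_LipCR eps K g (0, eps) (0, - eps) He HK H z w) as D.
  simpl in D. rewrite !Rplus_0_r in D. exact D.
Qed.
Lemma dq1_bound eps K g z : 0 < eps -> LipCR K g -> Rabs (dq1 eps g z) <= K.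
Proof.
  intros He H. apply diff_quot_bound; [exact He|]. eapply Rle_trans; [apply LipCR_row; exact H|].
  rewrite Rabs_pos_eq by lra. apply Req_le. ring.
Qed.
Lemma dq2_bound eps K g z : 0 < eps -> LipCR K g -> Rabs (dq2 eps g z) <= K.
Proof.
  intros He H. apply diff_quot_bound; [exact He|]. eapply Rle_trans; [apply LipCR_col; exact H|].
  rewrite Rabs_pos_eq by lra. apply Req_le. ring.
Qed.

Lemma av1_bound eps g z c d K : 0 < eps -> 0 <= K -> LipCR K g ->
  (forall s, - eps <= s <= eps -> Rabs (g (fst z + s, snd z) - c) <= d) -> Rabs (av1 eps g z - c) <= d.
Proof.
  intros He HK Hg H. rewrite <- (avg_const eps c He). apply avg_close; auto.
  - eapply LipCR_row_cont; eassumption.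
  - intros; apply continuous_const.
Qed.
Lemma av2_bound eps g z c d K : 0 < eps -> 0 <= K -> LipCR K g ->
  (forall s, - eps <= s <= eps -> Rabs (g (fst z, snd z + s) - c) <= d) -> Rabs (av2 eps g z - c) <= d.
Proof.
  intros He HK Hg H. rewrite <- (avg_const eps c He). apply avg_close; auto.
  - eapply LipCR_col_cont; eassumption.
  - intros; apply continuous_const.
Qed.

Lemma moll_bound eps g z c d K : 0 < eps -> 0 <= K -> LipCR K g ->
  (forall e : C, Cmod e <= 2 * eps -> Rabs (g (z + e)%C - c) <= d) -> Rabs (moll eps g z - c) <= d.
Proof.
  intros He HK Hg H. eapply av1_bound; eauto using av2_LipCR. intros s Hs.
  eapply av2_bound; eauto. intros t Ht. simpl.
  apply (H (s, t)). eapply Rle_trans; [apply Cmod_le_sum|]. simpl.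
  assert (Rabs s <= eps) by (apply Rabs_le; lra). assert (Rabs t <= eps) by (apply Rabs_le; lra). lra.
Qed.

Lemma moll_C11 eps g m K : 0 < eps -> 0 <= K -> LipCR K g -> (forall z, Rabs (g z) <= m) ->
  C11 (fun z => RtoC (moll eps g z)) (fun z => RtoC (dq1 eps (av2 eps g) z))
      (fun z => RtoC (av1 eps (dq2 eps g) z)).
Proof.
  intros He HK H Hm.
  assert (0 <= K / eps) as HKe by (apply Rmult_le_pos; [exact HK | left; apply Rinv_0_lt_compat; lra]).
  pose proof (av2_LipCR eps K g He HK H) as L2. pose proof (dq2_LipCR eps K g He HK H) as D2.
  pose proof (dq1_LipCR eps K _ He HK L2) as D1.
  split; [|split; [|split]].
  - apply (LipCR_bounded_LipC K _ m); auto; [apply av1_LipCR; assumption|]. intros z.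
    rewrite <- (Rminus_0_r (moll eps g z)). apply (moll_bound _ _ _ _ _ K); auto.
    intros. rewrite Rminus_0_r. apply Hm.
  - apply (LipCR_bounded_LipC (K / eps) _ K); auto. intros z. apply dq1_bound; assumption.
  - apply (LipCR_bounded_LipC (K / eps) _ K); auto; [apply av1_LipCR; assumption|]. intros z.
    rewrite <- (Rminus_0_r (av1 _ _ z)). apply (av1_bound _ _ _ _ _ (K / eps)); auto.
    intros. rewrite Rminus_0_r. apply dq2_bound; assumption.
  - exists (3 * (K / eps)). split; [lra|]. intros z [x y]. simpl fst; simpl snd.
    rewrite <- !RtoC_mult, <- RtoC_plus, <- !RtoC_minus, Cmod_R.
    (* The increment is split at z', so that each piece moves in one variable; the cross term is the
       change of [dq1] between z and z'. Each of the three pieces costs K / eps. *)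
    set (G := moll eps g). set (z' := (z + (0, y))%C).
    assert (Rabs (G (z + (x, y))%C - G z' - x * dq1 eps (av2 eps g) z') <= K / eps * x ^ 2) as T1.
    { pose proof (avg_taylor eps (fun s => av2 eps g (fst z' + s, snd z')) K x He HK) as T.
      assert (forall s t, Rabs (av2 eps g (fst z' + s, snd z') - av2 eps g (fst z' + t, snd z')) <= K * Rabs (s - t)) as TL
        by (intros; apply LipCR_row; assumption).
      specialize (T TL). unfold G, moll.
      replace (av1 eps (av2 eps g) (z + (x, y))%C) with (avg eps (fun s => av2 eps g (fst z' + (x + s), snd z'))); [exact T|].
      unfold av1. f_equal. apply functional_extensionality. intros s. f_equal. unfold z'.
      apply injective_projections; simpl; ring. }
    assert (Rabs (dq1 eps (av2 eps g) z' - dq1 eps (av2 eps g) z) <= K / eps * Rabs y) as T2.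
    { eapply Rle_trans; [apply D1|]. unfold z'. replace (z + (0, y) - z)%C with ((0, y) : C) by (apply injective_projections; simpl; ring).
      rewrite Cmod_imag. lra. }
    assert (Rabs (G z' - G z - y * av1 eps (dq2 eps g) z) <= K / eps * y ^ 2) as T3.
    { unfold G, moll, av1.
      rewrite <- avg_lin; [| apply (LipCR_row_cont K (av2 eps g) _ HK L2) | apply (LipCR_row_cont K (av2 eps g) _ HK L2)
          | apply (LipCR_row_cont (K / eps) (dq2 eps g) _ HKe D2)].
      match goal with |- Rabs (avg eps ?h) <= ?d =>
        rewrite <- (Rminus_0_r (avg eps h)), <- (avg_const eps 0 He); apply avg_close; auto end.
      - intros t. apply (continuous_minus (V := R_NormedModule));
          [apply (continuous_minus (V := R_NormedModule)); apply (LipCR_row_cont K (av2 eps g) _ HK L2) |].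
        apply (continuous_mult (K := R_AbsRing)); [apply continuous_const|].
        apply (LipCR_row_cont (K / eps) (dq2 eps g) _ HKe D2).
      - intros; apply continuous_const.
      - intros t _. rewrite Rminus_0_r.
        pose proof (avg_taylor eps (fun s => g (fst z + t, snd z + s)) K y He HK) as T.
        assert (forall s s', Rabs (g (fst z + t, snd z + s) - g (fst z + t, snd z + s')) <= K * Rabs (s - s')) as TL.
        { intros s s'. apply (LipCR_col K g (fst z + t, snd z) s s' H). }
        specialize (T TL). unfold av2, dq2. simpl.
        replace (avg eps (fun s => g (fst z + 0 + t, snd z + y + s)))
          with (avg eps (fun s => g (fst z + t, snd z + (y + s)))); [exact T|].
        f_equal. apply functional_extensionality. intros s. f_equal. f_equal; ring. }
    replace (G (z + (x, y))%C - G z - (x * dq1 eps (av2 eps g) z + y * av1 eps (dq2 eps g) z))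
     with ((G (z + (x, y))%C - G z' - x * dq1 eps (av2 eps g) z')
        + x * (dq1 eps (av2 eps g) z' - dq1 eps (av2 eps g) z)
        + (G z' - G z - y * av1 eps (dq2 eps g) z)) by ring.
    eapply Rle_trans; [apply Rabs_triang|]. eapply Rle_trans; [apply Rplus_le_compat_r, Rabs_triang|].
    rewrite Rabs_mult.
    pose proof (fst_le_Cmod (x, y)) as Hx. pose proof (snd_le_Cmod (x, y)) as Hy. simpl in Hx, Hy.
    pose proof (Rabs_pos x). pose proof (Rabs_pos y).
    assert (Rabs x * Rabs (dq1 eps (av2 eps g) z' - dq1 eps (av2 eps g) z) <= Rabs x * (K / eps * Rabs y))
      by (apply Rmult_le_compat_l; assumption).
    rewrite <- (pow2_abs x) in T1. rewrite <- (pow2_abs y) in T3.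
    set (c := Cmod (x, y)) in *. set (k := K / eps) in *.
    assert (Rabs x ^ 2 <= c ^ 2) by (apply pow_incr; lra). assert (Rabs y ^ 2 <= c ^ 2) by (apply pow_incr; lra).
    assert (Rabs x * Rabs y <= c * c) by (apply Rmult_le_compat; lra).
    assert (k * Rabs x ^ 2 <= k * c ^ 2) by (apply Rmult_le_compat_l; lra).
    assert (k * Rabs y ^ 2 <= k * c ^ 2) by (apply Rmult_le_compat_l; lra).
    assert (k * (Rabs x * Rabs y) <= k * (c * c)) by (apply Rmult_le_compat_l; lra).
    simpl in *. lra.
Qed.

Lemma avg_diff_bound eps g h c d : 0 < eps -> (forall t, continuous g t) -> (forall t, continuous h t) ->
  (forall t, - eps <= t <= eps -> Rabs (g t - h t - c) <= d) -> Rabs (avg eps g - avg eps h - c) <= d.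
Proof.
  intros He Hg Hh H.
  assert (forall t, continuous (fun _ : R => c) t) as Hc by (intros; apply continuous_const).
  replace (avg eps g - avg eps h - c) with (avg eps g - avg eps h - 1 * avg eps (fun _ => c))
    by (rewrite avg_const by assumption; ring).
  rewrite <- avg_lin by assumption.
  match goal with |- Rabs (avg eps ?h) <= ?d =>
    rewrite <- (Rminus_0_r (avg eps h)), <- (avg_const eps 0 He); apply avg_close; auto end.
  - intros t. apply (continuous_minus (V := R_NormedModule)); [apply (continuous_minus (V := R_NormedModule)); auto|].
    apply (continuous_mult (K := R_AbsRing)); [apply continuous_const | apply continuous_const].
  - intros; apply continuous_const.
  - intros t Ht. rewrite Rminus_0_r, Rmult_1_l. apply H, Ht.
Qed.

(** The two functions are compared before averaging, so only their difference near z enters. The box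
    of half-side eps lies within 2 eps of its centre. *)
Lemma moll_diff_bound eps g h z c d K : 0 < eps -> 0 <= K -> LipCR K g -> LipCR K h ->
  (forall e : C, Cmod e <= 2 * eps -> Rabs (g (z + e)%C - h (z + e)%C - c) <= d) ->
  Rabs (moll eps g z - moll eps h z - c) <= d.
Proof.
  intros He HK Hg Hh H. pose proof (av2_LipCR eps K g He HK Hg) as L1. pose proof (av2_LipCR eps K h He HK Hh) as L2.
  apply avg_diff_bound; auto.
  - apply (LipCR_row_cont K (av2 eps g) _ HK L1).
  - apply (LipCR_row_cont K (av2 eps h) _ HK L2).
  - intros s Hs. apply avg_diff_bound; auto.
    + apply (LipCR_col_cont K g (fst z + s, snd z) HK Hg).
    + apply (LipCR_col_cont K h (fst z + s, snd z) HK Hh).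
    + intros t Ht. simpl.
      apply (H (s, t)). eapply Rle_trans; [apply Cmod_le_sum|]. simpl.
      assert (Rabs s <= eps) by (apply Rabs_le; lra). assert (Rabs t <= eps) by (apply Rabs_le; lra). lra.
Qed.

Lemma LipCR_shift K g h : LipCR K g -> LipCR K (fun z => g (z + h)%C).
Proof.
  intros H z w. eapply Rle_trans; [apply H|]. apply Req_le. f_equal. f_equal. ring.
Qed.

Lemma moll_shift eps g h z : moll eps (fun z => g (z + h)%C) z = moll eps g (z + h)%C.
Proof.
  unfold moll, av1, av2. f_equal. apply functional_extensionality. intros s.
  f_equal. apply functional_extensionality. intros t. f_equal.
  apply injective_projections; simpl; ring.
Qed.

(** Mollification nearly preserves the derivative along theta although [g] need not have a gradient:
    the expansion of [g] along theta is averaged over the box, compared with the expansion of the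
    mollified function and divided by t, and then t tends to 0. The error is the oscillation of [D]
    over the box. *)
Lemma moll_directional eps g D m K K' phi z : 0 < eps -> 0 <= K -> 0 <= K' ->
  LipCR K g -> (forall z, Rabs (g z) <= m) -> LipCR K' D ->
  (forall x, derivable_pt_lim (fun t => g (x + RtoC t * expi phi)%C) 0 (D x)) ->
  Rabs (cos phi * dq1 eps (av2 eps g) z + sin phi * av1 eps (dq2 eps g) z - D z) <= 2 * K' * eps.
Proof.
  intros He HK HK' Hg Hm HD Hd.
  assert (forall x s, derivable_pt_lim (fun t => g (x + RtoC t * expi phi)%C) s (D (x + RtoC s * expi phi)%C)) as Hd'.
  { intros x s. specialize (Hd (x + RtoC s * expi phi)%C).
    assert (derivable_pt_lim (fun t => t - s) s 1) as Ds.
    { rewrite <- (Rminus_0_r 1). apply derivable_pt_lim_minus; [apply derivable_pt_lim_id | apply derivable_pt_lim_const]. }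
    rewrite <- (Rminus_diag s) in Hd.
    pose proof (derivable_pt_lim_comp (fun t => t - s) (fun t => g (x + RtoC s * expi phi + RtoC t * expi phi)%C)
      s 1 (D (x + RtoC s * expi phi)%C) Ds Hd) as Dc. rewrite Rmult_1_r in Dc.
    eapply derivable_pt_lim_ext; [|exact Dc]. intros t. unfold comp. f_equal. rewrite RtoC_minus. ring. }
  assert (forall x t, Cmod (x - z) <= 2 * eps ->
     Rabs (g (x + RtoC t * expi phi)%C - g x - t * D z) <= Rabs t * (K' * (2 * eps + Rabs t))) as S1.
  { intros x t Hx. destruct (MVT_0 _ _ t (Hd' x)) as [c [Hct E]].
    replace (x + RtoC 0 * expi phi)%C with x in E by ring. rewrite E.
    replace (D (x + RtoC c * expi phi)%C * t - t * D z) with (t * (D (x + RtoC c * expi phi)%C - D z)) by ring.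
    rewrite Rabs_mult. apply Rmult_le_compat_l; [apply Rabs_pos|].
    eapply Rle_trans; [apply HD|]. apply Rmult_le_compat_l; [exact HK'|].
    replace (x + RtoC c * expi phi - z)%C with ((x - z) + RtoC c * expi phi)%C by ring.
    eapply Rle_trans; [apply Cmod_triangle|]. rewrite Cmod_mult, Cmod_expi, Cmod_R. lra. }
  destruct (moll_C11 eps g m K He HK Hg Hm) as [_ [_ [_ [Kq [HKq Q]]]]].
  set (p1 := dq1 eps (av2 eps g) z) in *. set (p2 := av1 eps (dq2 eps g) z) in *.
  apply le_epsilon. intros d Hdp.
  (* [Kq] may be large when eps is small, but eps stays fixed while t is chosen. *)
  set (t := d / (K' + Kq + 1)).
  assert (0 < t) as Ht by (apply Rdiv_lt_0_compat; lra).
  assert (t * (K' + Kq) <= d) as Htd.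
  { unfold t. apply Rle_trans with (d / (K' + Kq + 1) * (K' + Kq + 1)).
    - apply Rmult_le_compat_l; [left; exact Ht | lra].
    - apply Req_le. field. lra. }
  specialize (Q z (RtoC t * expi phi)%C).
  assert (Cmod (RtoC t * expi phi) = t) as Em by (rewrite Cmod_mult, Cmod_expi, Cmod_R, Rabs_pos_eq; lra).
  rewrite Em in Q. fold p1 p2 in Q.
  replace (fst (RtoC t * expi phi)%C) with (t * cos phi) in Q by (simpl; ring).
  replace (snd (RtoC t * expi phi)%C) with (t * sin phi) in Q by (simpl; ring).
  rewrite <- !RtoC_mult, <- RtoC_plus, <- !RtoC_minus, Cmod_R in Q.
  assert (Rabs (moll eps g (z + RtoC t * expi phi)%C - moll eps g z - t * D z) <= t * (K' * (2 * eps + t))) as S2.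
  { rewrite <- moll_shift. apply (moll_diff_bound eps _ g z (t * D z) _ K); auto using LipCR_shift.
    intros e Hee. replace t with (Rabs t) at 3 4 by (apply Rabs_pos_eq; lra).
    replace (g (z + e + RtoC t * expi phi)%C) with (g ((z + e) + RtoC t * expi phi)%C) by reflexivity.
    apply S1. replace (z + e - z)%C with e by ring. exact Hee. }
  set (X := moll eps g (z + RtoC t * expi phi)%C - moll eps g z) in *.
  set (A0 := cos phi * p1 + sin phi * p2 - D z) in *.
  assert (Rabs (t * A0) <= t * (K' * (2 * eps + t)) + Kq * t ^ 2) as F.
  { replace (t * A0) with ((X - t * D z) - (X - (t * cos phi * p1 + t * sin phi * p2))) by (unfold A0; ring).
    eapply Rle_trans; [apply Rabs_triang|]. rewrite Rabs_Ropp. apply Rplus_le_compat; assumption. }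
  rewrite Rabs_mult, (Rabs_pos_eq t) in F by lra.
  apply Rmult_le_reg_l with t; [exact Ht|]. simpl in F. nra.
Qed.

(** * Approximate holomorphy of the transport solution *)

(** The constants are explicit because the final error must be uniform in phi and controlled as r
    tends to 1. *)
Definition lip_supported (M m K : R) (g : C -> R) : Prop :=
  LipCR K g /\ (forall z, Rabs (g z) <= m) /\ (forall z, M < Cmod z -> g z = 0).

Lemma moll_close eps M m K g z : 0 < eps -> 0 <= K -> lip_supported M m K g ->
  Rabs (moll eps g z - g z) <= 2 * K * eps.
Proof.
  intros He HK [HL _]. apply (moll_bound _ _ _ _ _ K); auto. intros e Hee.
  eapply Rle_trans; [apply HL|]. replace (z + e - z)%C with e by ring.
  apply Rmult_le_compat_l with (r := K) in Hee; lra.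
Qed.

Lemma moll_abs_bound eps M m K g z : 0 < eps -> 0 <= K -> lip_supported M m K g -> Rabs (moll eps g z) <= m.
Proof.
  intros He HK [HL [Hm _]]. rewrite <- (Rminus_0_r (moll eps g z)). apply (moll_bound _ _ _ _ _ K); auto.
  intros. rewrite Rminus_0_r. apply Hm.
Qed.

Lemma Cmod_sub_ge (z w : C) : Cmod z - Cmod w <= Cmod (z - w).
Proof.
  pose proof (Cmod_triangle (z - w) w) as T. replace (z - w + w)%C with z in T by ring. lra.
Qed.

Lemma moll_support eps M m K g z : 0 < eps <= 1 -> 0 <= K -> lip_supported M m K g -> M + 2 < Cmod z -> moll eps g z = 0.
Proof.
  intros He HK [HL [Hm H0]] Hz.
  assert (Rabs (moll eps g z - 0) <= 0) as B.
  { apply (moll_bound _ _ _ _ _ K); auto; try lra. intros e Hee. rewrite H0; [rewrite Rminus_0_r, Rabs_R0; lra|].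
    pose proof (Cmod_sub_ge z (- e)) as T. rewrite Cmod_opp in T.
    replace (z - - e)%C with (z + e)%C in T by ring. lra. }
  rewrite Rminus_0_r in B. pose proof (Rabs_pos (moll eps g z)).
  destruct (Req_dec (moll eps g z) 0) as [E|E]; [exact E|]. apply Rabs_pos_lt in E. lra.
Qed.

Lemma Xop_expi phi p1 p2 z : Xop (expi phi) p1 p2 z = d_rad p1 p2 phi z.
Proof.
  unfold Xop, d_rad.
  assert (expi phi <> 0)%C as He by (apply Cmod_gt_0; rewrite Cmod_expi; lra).
  assert (/ expi phi = expi (- phi))%C as ->.
  { replace (expi (- phi)) with (expi (- phi) * expi phi * / expi phi)%C by (field; assumption).
    rewrite expi_opp_mult. ring. }
  unfold expi. rewrite cos_neg, sin_neg.
  replace (RtoC (cos phi)) with (/ 2 * ((cos phi, sin phi) + (cos phi, (- sin phi)%R)))%C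
    by (apply injective_projections; simpl; field).
  replace (RtoC (sin phi)) with (- Ci * (/ 2 * ((cos phi, sin phi) - (cos phi, (- sin phi)%R))))%C
    by (apply injective_projections; simpl; field).
  ring.
Qed.

(** The coefficients lam and 1/lam differ from their values on the unit circle by O(1 - r);
    [1 / 2 <= r] keeps 1/lam under control. *)
Lemma Xop_near_circle r phi p1 p2 z m1 m2 : 1 / 2 <= r < 1 -> Cmod (p1 z) <= m1 -> Cmod (p2 z) <= m2 ->
  Cmod (Xop (RtoC r * expi phi) p1 p2 z - d_rad p1 p2 phi z) <= 2 * (1 - r) * (m1 + m2).
Proof.
  intros Hr H1 H2. rewrite <- Xop_expi. unfold Xop.
  assert (expi phi <> 0)%C as He by (apply Cmod_gt_0; rewrite Cmod_expi; lra).
  assert (RtoC r <> 0)%C as Hr0 by (intros e; apply RtoC_inj in e; lra).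
  set (a := (p1 z - Ci * p2 z)%C). set (b := (p1 z + Ci * p2 z)%C).
  assert (Cmod a <= m1 + m2) as Ha.
  { unfold a. eapply Rle_trans; [apply Cmod_triangle_minus|]. rewrite Cmod_mult, Cmod_Ci. lra. }
  assert (Cmod b <= m1 + m2) as Hb.
  { unfold b. eapply Rle_trans; [apply Cmod_triangle|]. rewrite Cmod_mult, Cmod_Ci. lra. }
  replace (/ 2 * (RtoC r * expi phi * a) + / 2 * (/ (RtoC r * expi phi) * b) -
     (/ 2 * (expi phi * a) + / 2 * (/ expi phi * b)))%C
   with (RtoC ((r - 1) / 2) * (expi phi * a) + RtoC ((1 - r) / (2 * r)) * (/ expi phi * b))%C.
  2: { rewrite !RtoC_div, !RtoC_minus, RtoC_mult by lra. field. repeat split; auto using C2_neq_0. }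
  eapply Rle_trans; [apply Cmod_triangle|]. rewrite !Cmod_mult, Cmod_inv, Cmod_expi, !Cmod_R by assumption.
  rewrite Rinv_1, !Rmult_1_l.
  assert (Rabs ((r - 1) / 2) <= 1 - r) as B1 by (apply Rabs_le; lra).
  assert (Rabs ((1 - r) / (2 * r)) <= 1 - r) as B2.
  { rewrite Rabs_pos_eq.
    - apply Rmult_le_reg_r with (2 * r); [lra|]. unfold Rdiv. rewrite Rmult_assoc, Rinv_l by lra. nra.
    - apply Rmult_le_pos; [lra|]. left; apply Rinv_0_lt_compat; lra. }
  assert (Rabs ((r - 1) / 2) * Cmod a <= (1 - r) * (m1 + m2))
    by (apply Rmult_le_compat; auto using Rabs_pos, Cmod_ge_0).
  assert (Rabs ((1 - r) / (2 * r)) * Cmod b <= (1 - r) * (m1 + m2))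
    by (apply Rmult_le_compat; auto using Rabs_pos, Cmod_ge_0).
  lra.
Qed.

Lemma lip_supported_BL M m K g : 0 <= K -> lip_supported M m K g -> BL (fun z => RtoC (g z)).
Proof. intros HK [HL [Hm _]]. apply (LipCR_bounded_LipC K _ m); assumption. Qed.

Lemma BL_Xop lam p1 p2 : BL p1 -> BL p2 -> BL (Xop lam p1 p2).
Proof.
  intros B1 B2. apply BL_plus; apply BL_scal, BL_scal; [apply BL_minus | apply BL_plus];
  try apply BL_scal; assumption.
Qed.

(** The coefficients of X do not depend on z, so linearity of [Top] suffices. *)
Lemma Top_Xop_comm L lam lam' p1 p2 z : 0 <= L -> Cmod lam < 1 -> LipC p1 -> LipC p2 ->
  Top L lam (Xop lam' p1 p2) z = Xop lam' (Top L lam p1) (Top L lam p2) z.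
Proof.
  intros HL Hl L1 L2. pose proof (LipC_scal Ci _ L2) as L3.
  pose proof (LipC_minus _ _ L1 L3) as La. pose proof (LipC_plus _ _ L1 L3) as Lb.
  pose proof (LipC_scal lam' _ La) as La'. pose proof (LipC_scal (/ lam') _ Lb) as Lb'.
  unfold Xop.
  rewrite (Top_plus L lam _ _ z HL Hl (LipC_scal (/ 2) _ La') (LipC_scal (/ 2) _ Lb')).
  rewrite (Top_scal L lam (/ 2) _ z HL Hl La'), (Top_scal L lam (/ 2) _ z HL Hl Lb').
  rewrite (Top_scal L lam lam' _ z HL Hl La), (Top_scal L lam (/ lam') _ z HL Hl Lb).
  rewrite (Top_minus L lam _ _ z HL Hl L1 L3), (Top_plus L lam _ _ z HL Hl L1 L3).
  rewrite (Top_scal L lam Ci _ z HL Hl L2). reflexivity.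
Qed.

(** The exponent h of the integrating factor: X_lam h is the mollified attenuation on a
    neighbourhood of the supports. *)
Definition int_factor (L eps : R) (a : C -> R) (lam : C) : C -> C := Top L lam (fun z => RtoC (moll eps a z)).
(** [Xop] is applied to (F1, F2) in place of a gradient: this continues theta.F from |lam| = 1 into
    the disc. *)
Definition source (f F1 F2 : C -> R) (lam : C) (w : C) : C :=
  (RtoC (f w) - Xop lam (fun z => RtoC (F1 z)) (fun z => RtoC (F2 z)) w)%C.
Definition psi (L eps : R) (a f F1 F2 : C -> R) (lam : C) (z : C) : C :=
  (cexp (- int_factor L eps a lam z) * Top L lam (fun w => cexp (int_factor L eps a lam w) * source f F1 F2 lam w) z)%C.

Lemma Cmod_cexp_bounds h H : Rabs (fst h) <= H -> Cmod (cexp h) <= exp H /\ Cmod (cexp (- h)) <= exp H.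
Proof.
  intros HH. rewrite !Cmod_cexp. simpl. split; apply exp_le.
  - eapply Rle_trans; [apply Rle_abs | exact HH].
  - eapply Rle_trans; [apply Rle_abs | rewrite Rabs_Ropp; exact HH].
Qed.

(* [cexp h * u_eps] is recovered from its image under X_lam; the image differs from
   [cexp h * source] by O(1 - r) only. *)
Lemma psi_close M m K a f F1 F2 (u : C -> R) r phi z :
  0 < M -> 0 <= K -> lip_supported M m K a -> lip_supported M m K f -> lip_supported M m K F1 -> lip_supported M m K F2 -> lip_supported M m K u ->
  (forall x, derivable_pt_lim (fun t => u (x + RtoC t * expi phi)%C) 0
      (f x - (cos phi * F1 x + sin phi * F2 x) - a x * u x)) ->
  1 / 2 <= r < 1 -> Cmod z <= M ->
  Cmod (psi (2 * M + 5) (1 - r) a f F1 F2 (RtoC r * expi phi) z - RtoC (u z)) <=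
    (exp (2 * ((2 * M + 5) * m)) * (8 * (2 * M + 5) * (exp (2 * ((2 * M + 5) * m)) *
      (4 * K * m + 4 * K + 2 * (3 * K + 2 * m * K) + 4 * m))) + 2 * K) * sqrt (1 - r).
Proof.
  intros HM HK Ha Hf H1 H2 Hu Htr Hr Hz.
  (* From any point of the disc of radius M + 2 a step of length 2 M + 5 leaves that disc, and the
     mollified functions vanish outside it. *)
  set (L := 2 * M + 5). set (eps := 1 - r). set (lam := (RtoC r * expi phi)%C).
  assert (0 < eps <= 1) as He by (unfold eps; lra). assert (0 <= L) as HL by (unfold L; lra).
  assert (Cmod lam = r) as Hlam.
  { unfold lam. rewrite Cmod_mult, Cmod_expi, Cmod_R, Rabs_pos_eq; lra. }
  assert (Cmod lam < 1) as Hl1 by lra.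
  assert (lam <> 0)%C as Hl0 by (apply Cmod_gt_0; lra).
  assert (0 <= m) as Hm0 by (eapply Rle_trans; [apply Rabs_pos | apply (proj1 (proj2 Ha) 0%C)]).
  set (aE := moll eps a). set (uE := moll eps u).
  pose proof (moll_C11 eps a m K (proj1 He) HK (proj1 Ha) (proj1 (proj2 Ha))) as Ca. fold aE in Ca.
  pose proof (moll_C11 eps u m K (proj1 He) HK (proj1 Hu) (proj1 (proj2 Hu))) as Cu. fold uE in Cu.
  set (a1 := fun z => RtoC (dq1 eps (av2 eps a) z)) in *. set (a2 := fun z => RtoC (av1 eps (dq2 eps a) z)) in *.
  set (q1 := fun z => RtoC (dq1 eps (av2 eps u) z)) in *. set (q2 := fun z => RtoC (av1 eps (dq2 eps u) z)) in *.
  set (h := int_factor L eps a lam).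
  assert (C11 h (Top L lam a1) (Top L lam a2)) as Ch by (apply C11_Top; assumption).
  pose proof (C11_mult _ _ _ _ _ _ (C11_cexp _ _ _ Ch) Cu) as CV.
  set (H := 2 * (L * m)).
  assert (forall z, Rabs (fst (h z)) <= H) as Bh.
  { intros w. apply Top_re_bound; auto.
    - exact (proj2 (proj1 Ca)).
    - intros x. apply (moll_abs_bound eps M m K); auto; lra. }
  assert (forall w, Xop lam (Top L lam a1) (Top L lam a2) w = Top L lam (Xop lam a1 a2) w) as XT.
  { intros w. symmetry. exact (Top_Xop_comm L lam lam a1 a2 w HL Hl1 (proj2 (proj1 (proj2 Ca))) (proj2 (proj1 (proj2 (proj2 Ca))))). }
  assert (forall w, Cmod w <= M + 2 -> forall t, M + 2 < Cmod (w - RtoC L * expi t)) as Far.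
  { intros w Hw t. pose proof (Cmod_sub_ge (RtoC L * expi t) w) as T.
    rewrite Cmod_minus_sym, Cmod_mult, Cmod_expi, Cmod_R, Rabs_pos_eq in T by assumption. unfold L in *. lra. }
  set (V := fun z => (cexp (h z) * RtoC (uE z))%C) in *.
  set (Err := fun w => (RtoC (aE w * uE w) + Xop lam q1 q2 w - source f F1 F2 lam w)%C).
  assert (forall w, Xop lam (fun z => cexp (h z) * Top L lam a1 z * RtoC (uE z) + cexp (h z) * q1 z)%C
      (fun z => cexp (h z) * Top L lam a2 z * RtoC (uE z) + cexp (h z) * q2 z)%C w
    = (cexp (h w) * source f F1 F2 lam w + cexp (h w) * Err w)%C) as XV.
  { intros w.
    assert (Xop lam (Top L lam a1) (Top L lam a2) w * RtoC (uE w) = RtoC (aE w) * RtoC (uE w))%C as E.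
    (* Inside the enlarged support X_lam h = a_eps by the inversion formula; outside it the factor
       u_eps vanishes. *)
    { destruct (Rle_lt_dec (Cmod w) (M + 2)) as [Hw|Hw].
      - rewrite XT. rewrite (Top_Xop L lam (fun z => RtoC (aE z))); try assumption; [reflexivity|].
        intros t. unfold aE. rewrite (moll_support eps M m K); auto.
      - unfold uE. rewrite (moll_support eps M m K u w); auto. ring. }
    unfold Err. rewrite RtoC_mult, <- E. unfold Xop. ring. }
  assert (BL (source f F1 F2 lam)) as Bsrc.
  { apply (BL_minus (fun w => RtoC (f w)) (Xop lam (fun z => RtoC (F1 z)) (fun z => RtoC (F2 z))));
    [exact (lip_supported_BL M m K f HK Hf)|].
    apply BL_Xop; [exact (lip_supported_BL M m K F1 HK H1) | exact (lip_supported_BL M m K F2 HK H2)]. }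
  assert (BL (fun w => cexp (h w))) as Bexp by (exact (BL_cexp h (proj1 Ch))).
  assert (BL (fun w => cexp (h w) * source f F1 F2 lam w)%C) as BS.
  { apply (BL_mult (fun w => cexp (h w)) (source f F1 F2 lam)); [exact Bexp | exact Bsrc]. }
  assert (BL (fun w => cexp (h w) * Err w)%C) as BE.
  { apply (BL_mult (fun w => cexp (h w)) Err); [exact Bexp|].
    apply (BL_minus (fun w => RtoC (aE w * uE w) + Xop lam q1 q2 w)%C (source f F1 F2 lam)); [|exact Bsrc].
    apply (BL_plus (fun w => RtoC (aE w * uE w)) (Xop lam q1 q2)); [|exact (BL_Xop lam q1 q2 (proj1 (proj2 Cu)) (proj1 (proj2 (proj2 Cu))))].
    replace (fun z => RtoC (aE z * uE z)) with (fun z => RtoC (aE z) * RtoC (uE z))%C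
        by (apply functional_extensionality; intros; rewrite RtoC_mult; reflexivity).
    apply (BL_mult (fun z => RtoC (aE z)) (fun z => RtoC (uE z))); [exact (proj1 Ca) | exact (proj1 Cu)]. }
  (* Lipschitz constant of the right-hand side of the transport equation: 3 K from f, F1 and F2, and
     2 m K from a u. *)
  set (K' := 3 * K + 2 * m * K).
  (* The four errors, in this order: mollifying a and u in their product, replacing theta by lam for
     u_eps, mollifying the derivative along theta, replacing theta by lam for F. *)
  set (c0 := 4 * K * m + 4 * K + 2 * K' + 4 * m).
  assert (0 <= m * K) as HmK by (apply Rmult_le_pos; assumption).
  assert (0 <= c0) as Hc0 by (unfold c0, K'; nra).
  assert (forall w, Cmod (Err w) <= c0 * eps) as BErr.
  { intros w.
    set (D := fun x => f x - (cos phi * F1 x + sin phi * F2 x) - a x * u x) in *.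
    assert (Rabs (cos phi) <= 1) as Bc by apply Rabs_le, COS_bound.
    assert (Rabs (sin phi) <= 1) as Bs by apply Rabs_le, SIN_bound.
    assert (LipCR K' D) as LD.
    { intros x y. unfold D.
      replace (f x - (cos phi * F1 x + sin phi * F2 x) - a x * u x - (f y - (cos phi * F1 y + sin phi * F2 y) - a y * u y))
       with ((f x - f y) + - (cos phi * (F1 x - F1 y)) + - (sin phi * (F2 x - F2 y)) + - ((a x - a y) * u x + a y * (u x - u y))) by ring.
      pose proof (proj1 Hf x y) as Lf. pose proof (proj1 H1 x y) as L1. pose proof (proj1 H2 x y) as L2.
      pose proof (proj1 Ha x y) as La. pose proof (proj1 Hu x y) as Lu.
      pose proof (proj1 (proj2 Ha) y) as Ma. pose proof (proj1 (proj2 Hu) x) as Mu.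
      eapply Rle_trans; [apply Rabs_triang|]. eapply Rle_trans; [apply Rplus_le_compat_r, Rabs_triang|].
      eapply Rle_trans; [apply Rplus_le_compat_r, Rplus_le_compat_r, Rabs_triang|]. rewrite !Rabs_Ropp.
      assert (Rabs (cos phi * (F1 x - F1 y)) <= 1 * (K * Cmod (x - y))) as T1.
      { rewrite Rabs_mult. apply Rmult_le_compat; auto using Rabs_pos. }
      assert (Rabs (sin phi * (F2 x - F2 y)) <= 1 * (K * Cmod (x - y))) as T2.
      { rewrite Rabs_mult. apply Rmult_le_compat; auto using Rabs_pos. }
      assert (Rabs ((a x - a y) * u x + a y * (u x - u y)) <= K * Cmod (x - y) * m + m * (K * Cmod (x - y))) as T3.
      { eapply Rle_trans; [apply Rabs_triang|]. rewrite !Rabs_mult.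
        apply Rplus_le_compat; apply Rmult_le_compat; auto using Rabs_pos. }
      unfold K'. lra. }
    pose proof (moll_directional eps u D m K K' phi w (proj1 He) HK ltac:(unfold K'; nra)
      (proj1 Hu) (proj1 (proj2 Hu)) LD Htr) as T3.
    pose proof (moll_close eps M m K a w (proj1 He) HK Ha) as Ta. fold aE in Ta.
    pose proof (moll_close eps M m K u w (proj1 He) HK Hu) as Tu. fold uE in Tu.
    assert (Rabs (aE w * uE w - a w * u w) <= 4 * K * m * eps) as T1.
    { replace (aE w * uE w - a w * u w) with ((aE w - a w) * uE w + a w * (uE w - u w)) by ring.
      eapply Rle_trans; [apply Rabs_triang|]. rewrite !Rabs_mult.
      assert (Rabs (aE w - a w) * Rabs (uE w) <= 2 * K * eps * m).
      { apply Rmult_le_compat; auto using Rabs_pos. apply (moll_abs_bound eps M m K); auto; lra. }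
      assert (Rabs (a w) * Rabs (uE w - u w) <= m * (2 * K * eps)).
      { apply Rmult_le_compat; auto using Rabs_pos. apply Ha. } lra. }
    assert (Cmod (Xop lam q1 q2 w - d_rad q1 q2 phi w) <= 2 * (1 - r) * (K + K)) as T2.
    { apply Xop_near_circle; auto.
      - unfold q1. rewrite Cmod_R. apply dq1_bound; [lra|]. apply av2_LipCR; [lra | exact HK | apply Hu].
      - unfold q2. rewrite Cmod_R. rewrite <- (Rminus_0_r (av1 _ _ w)).
        assert (0 <= K / eps) by (apply Rmult_le_pos; [exact HK | left; apply Rinv_0_lt_compat; lra]).
        apply (av1_bound _ _ _ _ _ (K / eps)); auto; try lra.
        + apply dq2_LipCR; [lra | exact HK | apply Hu].
        + intros. rewrite Rminus_0_r. apply dq2_bound; [lra | apply Hu]. }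
    assert (Cmod (Xop lam (fun z => RtoC (F1 z)) (fun z => RtoC (F2 z)) w - d_rad (fun z => RtoC (F1 z)) (fun z => RtoC (F2 z)) phi w)
       <= 2 * (1 - r) * (m + m)) as T4.
    { apply Xop_near_circle; auto; rewrite Cmod_R; [apply H1 | apply H2]. }
    fold eps in T2, T4.
    replace (Err w) with (RtoC (aE w * uE w - a w * u w) + (Xop lam q1 q2 w - d_rad q1 q2 phi w)
      + RtoC (cos phi * dq1 eps (av2 eps u) w + sin phi * av1 eps (dq2 eps u) w - D w)
      + (Xop lam (fun z => RtoC (F1 z)) (fun z => RtoC (F2 z)) w - d_rad (fun z => RtoC (F1 z)) (fun z => RtoC (F2 z)) phi w))%C.
    2: { unfold Err, source, D, d_rad, q1, q2. rewrite !RtoC_minus, !RtoC_plus, !RtoC_mult. ring. }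
    eapply Rle_trans; [apply Cmod_triangle|]. eapply Rle_trans; [apply Rplus_le_compat_r, Cmod_triangle|].
    eapply Rle_trans; [apply Rplus_le_compat_r, Rplus_le_compat_r, Cmod_triangle|].
    rewrite !Cmod_R. unfold c0. lra. }
  (* V has compact support, so it is recovered from X_lam V, which splits into the part that is
     holomorphic in lam and the error. *)
  assert (V z = Top L lam (fun w => cexp (h w) * source f F1 F2 lam w) z + Top L lam (fun w => cexp (h w) * Err w) z)%C as EV.
  { rewrite <- (Top_plus L lam _ _ z HL Hl1 (proj2 BS) (proj2 BE)).
    rewrite <- (Top_Xop L lam V _ _ z HL Hl0 Hl1 CV).
    - f_equal. apply functional_extensionality. exact XV.
    - intros t. unfold V, uE. rewrite (moll_support eps M m K u); auto; [ring|]. apply Far. lra. }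
  destruct (Cmod_cexp_bounds (h z) H (Bh z)) as [_ Bm].
  assert (Cmod (Top L lam (fun w => cexp (h w) * Err w)%C z) <= 8 * L * (exp H * (c0 * eps)) / sqrt (1 - Cmod lam)) as BT.
  { apply (Top_bound L lam _ z _ HL Hl1 (proj2 BE)). intros w. rewrite Cmod_mult.
    apply Rmult_le_compat; auto using Cmod_ge_0. exact (proj1 (Cmod_cexp_bounds (h w) H (Bh w))). }
  rewrite Hlam in BT. fold eps in BT.
  (* eps / sqrt eps = sqrt eps: the gain 1 - r outweighs the loss of the inversion. *)
  assert (eps = sqrt eps * sqrt eps) as Es by (symmetry; apply sqrt_sqrt; lra).
  assert (0 < sqrt eps) as Sp by (apply sqrt_lt_R0; lra).
  replace (8 * L * (exp H * (c0 * eps)) / sqrt eps) with (8 * L * (exp H * c0) * sqrt eps) in BT.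
  2: { rewrite Es at 2. field. lra. }
  unfold psi. fold h.
  assert (cexp (- h z) * Top L lam (fun w => cexp (h w) * source f F1 F2 lam w) z - RtoC (u z)
    = - (cexp (- h z) * Top L lam (fun w => cexp (h w) * Err w) z) + RtoC (uE z - u z))%C as ->.
  { assert (RtoC (uE z) = cexp (- h z) * V z)%C as EU.
    { unfold V. rewrite Cmult_assoc, cexp_opp_mult. ring. }
    rewrite RtoC_minus, EU, EV. ring. }
  eapply Rle_trans; [apply Cmod_triangle|]. rewrite Cmod_opp, Cmod_mult, Cmod_R.
  pose proof (moll_close eps M m K u z (proj1 He) HK Hu) as Tu. fold uE in Tu.
  assert (Cmod (cexp (- h z)) * Cmod (Top L lam (fun w => cexp (h w) * Err w)%C z)
     <= exp H * (8 * L * (exp H * c0) * sqrt eps)) as F by (apply Rmult_le_compat; auto using Cmod_ge_0).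
  assert (eps <= sqrt eps) as Ele.
  { rewrite Es at 1. rewrite <- (Rmult_1_r (sqrt eps)) at 3. apply Rmult_le_compat_l; [lra|].
    rewrite <- sqrt_1. apply sqrt_le_1; lra. }
  assert (2 * K * eps <= 2 * K * sqrt eps) by (apply Rmult_le_compat_l; lra).
  rewrite Rmult_plus_distr_r, Rmult_assoc. lra.
Qed.

(** * Dependence on lam: [psi] is a limit of polynomials *)

Lemma mu_lip lam s t : Cmod lam <= 1 -> Cmod (mu lam s - mu lam t) <= 2 * Rabs (s - t).
Proof.
  intros Hl. unfold mu.
  replace (lam * expi (- s) - lam * expi (- t))%C with (lam * (expi (- s) - expi (- t)))%C by ring.
  rewrite Cmod_mult. pose proof (expi_lip (- s) (- t)) as E.
  replace (- s - - t) with (- (s - t)) in E by ring. rewrite Rabs_Ropp in E.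
  pose proof (Cmod_ge_0 lam). pose proof (Cmod_ge_0 (expi (- s) - expi (- t))). nra.
Qed.

(** [ker] without its factor lam. In lam it is a geometric series, and the factor set free is spent
    on the pole of the integrand. *)
Definition ker' (lam : C) (w : R) : C := (expi (- w) * / (1 - mu lam w * mu lam w))%C.

Lemma ker_ker' lam w : ker lam w = (lam * ker' lam w)%C.
Proof. unfold ker, ker', Cdiv. unfold mu at 1. ring. Qed.

Lemma ker'_bound lam w r : Cmod lam = r -> r < 1 -> Cmod (ker' lam w) <= / (1 - r).
Proof.
  intros Hl Hr. unfold ker'. rewrite Cmod_mult, Cmod_expi, Rmult_1_l, Cmod_inv by (apply mu_denom_neq_0; lra).
  apply Rinv_le_contravar; [lra|]. rewrite <- Hl. apply mu_denom_ge. lra.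
Qed.

(** The constant may depend badly on r: r is fixed while the integral over the angle is approximated
    by Riemann sums. *)
Lemma ker'_lip lam s t r : Cmod lam = r -> r < 1 ->
  Cmod (ker' lam s - ker' lam t) <= (2 * / (1 - r) + 4 * / (1 - r) ^ 2) * Rabs (s - t).
Proof.
  intros Hl Hr. assert (Cmod lam < 1) as Hl1 by lra. unfold ker'.
  eapply Rle_trans; [apply Cmod_mult_diff|]. rewrite Cmod_expi, Rmult_1_l, Rmult_plus_distr_r.
  pose proof (mu_denom_neq_0 lam s Hl1) as Ns. pose proof (mu_denom_neq_0 lam t Hl1) as Nt.
  pose proof (mu_denom_ge lam s Hl1) as Ds. pose proof (mu_denom_ge lam t Hl1) as Dt. rewrite Hl in Ds, Dt.
  pose proof (Rabs_pos (s - t)).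
  assert (/ Cmod (1 - mu lam s * mu lam s) <= / (1 - r)) as Is by (apply Rinv_le_contravar; lra).
  assert (/ Cmod (1 - mu lam t * mu lam t) <= / (1 - r)) as It by (apply Rinv_le_contravar; lra).
  assert (0 < / Cmod (1 - mu lam s * mu lam s)) by (apply Rinv_0_lt_compat; lra).
  assert (0 < / Cmod (1 - mu lam t * mu lam t)) by (apply Rinv_0_lt_compat; lra).
  apply Rplus_le_compat.
  - rewrite Cmod_inv by assumption.
    replace (2 * / (1 - r) * Rabs (s - t)) with ((2 * Rabs (s - t)) * / (1 - r)) by ring.
    apply Rmult_le_compat; try lra; auto using Cmod_ge_0.
    pose proof (expi_lip (- s) (- t)) as E. replace (- s - - t) with (- (s - t)) in E by ring.
    rewrite Rabs_Ropp in E. exact E.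
  - replace (/ (1 - mu lam s * mu lam s) - / (1 - mu lam t * mu lam t))%C
      with ((mu lam s * mu lam s - mu lam t * mu lam t) * (/ (1 - mu lam s * mu lam s) * / (1 - mu lam t * mu lam t)))%C
      by (field; split; assumption).
    rewrite !Cmod_mult, !Cmod_inv by assumption.
    assert (Cmod (mu lam s * mu lam s - mu lam t * mu lam t) <= 4 * Rabs (s - t)) as Q.
    { eapply Rle_trans; [apply Cmod_mult_diff|]. rewrite !Cmod_mu.
      pose proof (mu_lip lam s t ltac:(lra)). pose proof (Cmod_ge_0 lam). pose proof (Cmod_ge_0 (mu lam s - mu lam t)). nra. }
    replace (4 * / (1 - r) ^ 2 * Rabs (s - t)) with ((4 * Rabs (s - t)) * (/ (1 - r) * / (1 - r))) by (field; lra).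
    apply Rmult_le_compat; auto using Cmod_ge_0.
    + apply Rmult_le_pos; lra.
    + apply Rmult_le_compat; lra.
Qed.

Definition circ (r t : R) : C := (RtoC r * expi t)%C.

Lemma Cmod_circ r t : 0 <= r -> Cmod (circ r t) = r.
Proof. intros. unfold circ. rewrite Cmod_mult, Cmod_expi, Cmod_R, Rabs_pos_eq; lra. Qed.

Lemma mean_base_circ r : 0 <= r -> mean_base (circ r) r.
Proof.
  intros Hr. pose proof (mean_base_circle (RtoC r) 1 (or_introl eq_refl)) as Hb.
  rewrite Cmod_R, Rabs_pos_eq in Hb by assumption.
  replace (circ r) with (fun t => (RtoC r * expi (1 * t))%C); [exact Hb|].
  apply functional_extensionality. intros t. unfold circ. rewrite Rmult_1_l. reflexivity.
Qed.

(* the pole of [B t = B' t / circ r t] at the origin is absorbed by the zero of the kernel *)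
Lemma An_Top L r (B' : R -> C -> C) K m z : 0 <= L -> 0 < r < 1 -> 0 <= K ->
  (forall w, An (circ r) (fun t => B' t w)) ->
  (forall t w w', Cmod (B' t w - B' t w') <= K * Cmod (w - w')) ->
  (forall t w, Cmod (B' t w) <= m) ->
  An (circ r) (fun t => Top L (circ r t) (fun w => / circ r t * B' t w)%C z).
Proof.
  intros HL Hr HK HA HLip Hm. pose proof PI_RGT_0.
  pose proof (mean_base_circ r ltac:(lra)) as [Hc [Hb _]].
  assert (forall t, LipC (B' t)) as HLB by (intros t; exists K; auto).
  assert (0 <= m) as Hm0 by (eapply Rle_trans; [apply Cmod_ge_0 | apply (Hm 0 0%C)]).
  assert (0 < / (1 - r)) as I1 by (apply Rinv_0_lt_compat; lra).
  assert (0 < / (1 - r) ^ 2) as I2 by (apply Rinv_0_lt_compat, pow_lt; lra).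
  set (Kk := 2 * / (1 - r) + 4 * / (1 - r) ^ 2).
  (* Once lam has been cancelled, kernel and ray integral are limits of polynomials in lam for each
     angle, and hence so is the integral over the angle. *)
  apply An_eq with (fun t => RtoC (/ PI) * Cint (fun w => ker' (circ r t) w * ray L (B' t) z w) 0 (2 * PI))%C.
  - apply An_scal with r; [exact Hb|].
    apply (An_int (circ r) r (fun w t => ker' (circ r t) w * ray L (B' t) z w)%C
       (Kk * (2 * (L * m)) + / (1 - r) * (4 * K * L ^ 2))); try assumption; try lra.
    + assert (0 <= Kk) by (unfold Kk; lra).
      assert (0 <= 4 * K * L ^ 2) by (pose proof (pow2_ge_0 L); nra).
      assert (0 <= 2 * (L * m)) by nra.
      apply Rplus_le_le_0_compat; apply Rmult_le_pos; lra.
    + intros w. apply (An_mult (circ r) r (fun t => ker' (circ r t) w) (fun t => ray L (B' t) z w) Hb).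
      * unfold ker'. apply An_scal with r; [exact Hb|].
        assert (An (circ r) (fun t => mu (circ r t) w)) as Am.
        { apply (An_eq _ (fun t => expi (- w) * circ r t)%C);
          [apply An_scal with r; [exact Hb | apply An_base] | intros t; unfold mu; ring]. }
        apply (An_inv (circ r) r (fun t => mu (circ r t) w * mu (circ r t) w)%C (r * r)); try assumption.
        -- exact (An_mult (circ r) r (fun t => mu (circ r t) w) _ Hb Am Am).
        -- intros t. rewrite Cmod_mult, Cmod_mu, Cmod_circ; lra.
        -- nra.
      * unfold ray. apply (An_int (circ r) r (fun rho t => B' t (z - RtoC rho * expi w)%C) K); try assumption.
        -- intros rho. apply HA.
        -- intros y y' t. eapply Rle_trans; [apply HLip|]. apply Rmult_le_compat_l; [exact HK|].
           replace (z - y * expi w - (z - y' * expi w))%C with (RtoC (- (y - y')) * expi w)%C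
             by (rewrite RtoC_opp, RtoC_minus; ring).
           rewrite Cmod_mult, Cmod_expi, Cmod_R, Rabs_Ropp. lra.
    + intros y y' t. eapply Rle_trans; [apply Cmod_mult_diff|]. rewrite Rmult_plus_distr_r.
      pose proof (Rabs_pos (y - y')). assert (Cmod (circ r t) = r) as Ec by (apply Cmod_circ; lra).
      apply Rplus_le_compat.
      * replace (Kk * (2 * (L * m)) * Rabs (y - y')) with ((Kk * Rabs (y - y')) * (2 * (L * m))) by ring.
        apply Rmult_le_compat; auto using Cmod_ge_0.
        -- apply ker'_lip; lra.
        -- apply ray_bound; auto.
      * rewrite Rmult_assoc. apply Rmult_le_compat; auto using Cmod_ge_0.
        -- apply ker'_bound; lra.
        -- apply ray_lip; auto.
  - intros t. unfold Top. f_equal. apply Cint_ext; [lra|]. intros w _.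
    assert (Cmod (circ r t) = r) as Ec by (apply Cmod_circ; lra).
    assert (circ r t <> 0)%C as N0 by (apply Cmod_gt_0; lra).
    assert (ray L (fun w => / circ r t * B' t w)%C z w = (/ circ r t * ray L (B' t) z w)%C) as ->.
    { unfold ray. apply Cint_scal, ray_integrand_contC, HLB. }
    rewrite ker_ker'. field. exact N0.
Qed.

Lemma An_int_factor L eps a r m M K z : 0 <= L -> 0 < r < 1 -> 0 <= K -> 0 < eps -> lip_supported M m K a ->
  An (circ r) (fun t => int_factor L eps a (circ r t) z).
Proof.
  intros HL Hr HK He Ha.
  pose proof (mean_base_circ r ltac:(lra)) as [_ [Hb _]].
  assert (0 <= m) as Hm0 by (eapply Rle_trans; [apply Rabs_pos | apply (proj1 (proj2 Ha) 0%C)]).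
  (* [An_Top] expects an integrand divided by lam, so a_eps is written as lam a_eps over lam. *)
  pose proof (An_Top L r (fun t w => circ r t * RtoC (moll eps a w))%C K m z HL Hr HK) as T.
  eapply An_eq; [apply T|].
  - intros w. apply (An_mult (circ r) r (circ r) (fun _ => RtoC (moll eps a w)) Hb); [apply An_base | apply An_const].
  - intros t w w'.
    replace (circ r t * RtoC (moll eps a w) - circ r t * RtoC (moll eps a w'))%C
      with (circ r t * RtoC (moll eps a w - moll eps a w'))%C by (rewrite RtoC_minus; ring).
    rewrite Cmod_mult, Cmod_R, Cmod_circ by lra.
    assert (Rabs (moll eps a w - moll eps a w') <= K * Cmod (w - w')) as Lm.
    { apply (av1_LipCR eps K _ He HK). apply (av2_LipCR eps K _ He HK). exact (proj1 Ha). }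
    pose proof (Rabs_pos (moll eps a w - moll eps a w')). nra.
  - intros t w. rewrite Cmod_mult, Cmod_R, Cmod_circ by lra.
    pose proof (moll_abs_bound eps M m K a w He HK Ha). pose proof (Rabs_pos (moll eps a w)). nra.
  - intros t. unfold int_factor. f_equal. apply functional_extensionality. intros w.
    assert (circ r t <> 0)%C as N0 by (apply Cmod_gt_0; rewrite Cmod_circ; lra). field. exact N0.
Qed.

(** This is lam times [source]: the factor 1/lam is cleared, leaving a polynomial of degree two in
    lam. *)
Definition source' (f F1 F2 : C -> R) (lam : C) (w : C) : C :=
  (lam * RtoC (f w) - / 2 * (lam * lam * (RtoC (F1 w) - Ci * RtoC (F2 w)) + (RtoC (F1 w) + Ci * RtoC (F2 w))))%C.

Lemma source_source' f F1 F2 (lam : C) w : lam <> 0%C -> source f F1 F2 lam w = (/ lam * source' f F1 F2 lam w)%C.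
Proof. intros H. unfold source, source', Xop. field. exact H. Qed.

(** Stated for arbitrary entries because it serves twice, for the values of the fields and for their
    differences between two points. *)
Lemma source'_combination_bound (lam x y1 y2 : C) d : Cmod lam <= 1 -> Cmod x <= d -> Cmod y1 <= d -> Cmod y2 <= d ->
  Cmod (lam * x - / 2 * (lam * lam * (y1 - Ci * y2) + (y1 + Ci * y2))) <= 3 * d.
Proof.
  intros Hl Hx H1 H2. assert (0 <= d) by (eapply Rle_trans; [apply Cmod_ge_0 | exact Hx]).
  assert (Cmod (y1 - Ci * y2) <= 2 * d) as B1.
  { eapply Rle_trans; [apply Cmod_triangle_minus|]. rewrite Cmod_mult, Cmod_Ci. lra. }
  assert (Cmod (y1 + Ci * y2) <= 2 * d) as B2.
  { eapply Rle_trans; [apply Cmod_triangle|]. rewrite Cmod_mult, Cmod_Ci. lra. }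
  pose proof (Cmod_ge_0 lam). pose proof (Cmod_ge_0 x).
  eapply Rle_trans; [apply Cmod_triangle_minus|]. rewrite !Cmod_mult, Cmod_inv, Cmod_R, Rabs_pos_eq by (lra || exact C2_neq_0).
  pose proof (Cmod_triangle (lam * lam * (y1 - Ci * y2)) (y1 + Ci * y2)) as T.
  rewrite !Cmod_mult in T. pose proof (Cmod_ge_0 (y1 - Ci * y2)).
  assert (Cmod lam * Cmod lam <= 1) by nra.
  assert (Cmod lam * Cmod lam * Cmod (y1 - Ci * y2) <= 1 * (2 * d)) by (apply Rmult_le_compat; nra).
  nra.
Qed.

(** Some constants below blow up as r tends to 1. This is harmless: r is fixed here and [An] is
    qualitative; the uniform estimates are those of [psi_close]. *)
Lemma An_psi M m K a f F1 F2 L eps r z : 0 <= L -> 0 < r < 1 -> 0 <= K -> 0 < eps ->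
  lip_supported M m K a -> lip_supported M m K f -> lip_supported M m K F1 -> lip_supported M m K F2 ->
  An (circ r) (fun t => psi L eps a f F1 F2 (circ r t) z).
Proof.
  intros HL Hr HK He Ha Hf H1 H2.
  pose proof (mean_base_circ r ltac:(lra)) as [_ [Hb _]].
  assert (0 <= m) as Hm0 by (eapply Rle_trans; [apply Rabs_pos | apply (proj1 (proj2 Ha) 0%C)]).
  assert (0 < sqrt (1 - r)) as Sp by (apply sqrt_lt_R0; lra).
  assert (forall w, An (circ r) (fun t => int_factor L eps a (circ r t) w)) as Ah
    by (intros w; exact (An_int_factor L eps a r m M K w HL Hr HK He Ha)).
  set (m1 := 8 * L * m / sqrt (1 - r)). set (K1 := 8 * L * K / sqrt (1 - r)).
  assert (forall t, Cmod (circ r t) = r) as Ec by (intros; apply Cmod_circ; lra).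
  assert (LipCR K (moll eps a)) as Lm.
  { apply (av1_LipCR eps K _ He HK). apply (av2_LipCR eps K _ He HK). exact (proj1 Ha). }
  assert (forall z, Rabs (moll eps a z) <= m) as Bm by (intros; exact (moll_abs_bound eps M m K a _ He HK Ha)).
  assert (LipC (fun z => RtoC (moll eps a z))) as LmC by exact (proj2 (LipCR_bounded_LipC K _ m HK Lm Bm)).
  assert (forall t w, Cmod (int_factor L eps a (circ r t) w) <= m1) as Bh.
  { intros t w. unfold int_factor, m1. replace (sqrt (1 - r)) with (sqrt (1 - Cmod (circ r t))) by (rewrite Ec; reflexivity).
    apply Top_bound; auto; [rewrite Ec; lra|].
    intros x. rewrite Cmod_R. apply Bm. }
  assert (forall t w w', Cmod (int_factor L eps a (circ r t) w - int_factor L eps a (circ r t) w') <= K1 * Cmod (w - w')) as Lh.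
  { intros t w w'. unfold int_factor, K1. replace (sqrt (1 - r)) with (sqrt (1 - Cmod (circ r t))) by (rewrite Ec; reflexivity).
    apply Top_LipC; auto; [rewrite Ec; lra|].
    intros x y. rewrite <- RtoC_minus, Cmod_R. apply Lm. }
  assert (0 <= m1) as Hm1 by (eapply Rle_trans; [apply Cmod_ge_0 | apply (Bh 0 0%C)]).
  assert (0 <= K1) as HK1.
  { unfold K1. apply Rmult_le_pos; [nra|]. left. apply Rinv_0_lt_compat. exact Sp. }
  set (c1 := exp m1 * ((1 + 10 * m1 * exp (2 * m1)) * K1)).
  pose proof (exp_pos m1) as E1. pose proof (exp_pos (2 * m1)) as E2.
  assert (0 <= 1 + 10 * m1 * exp (2 * m1)) as Hx.
  { assert (0 <= 10 * m1 * exp (2 * m1)) by (apply Rmult_le_pos; lra). lra. }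
  assert (0 <= c1) as Hc1 by (unfold c1; apply Rmult_le_pos; [lra | apply Rmult_le_pos; lra]).
  assert (forall t w w', Cmod (cexp (int_factor L eps a (circ r t) w) - cexp (int_factor L eps a (circ r t) w')) <= c1 * Cmod (w - w')) as Le.
  { intros t w w'. eapply Rle_trans; [exact (cexp_diff_bound _ _ m1 (Bh t w) (Bh t w'))|].
    unfold c1. set (X := 1 + 10 * m1 * exp (2 * m1)) in *.
    replace (exp m1 * (X * K1) * Cmod (w - w')) with (exp m1 * (X * (K1 * Cmod (w - w')))) by ring.
    apply Rmult_le_compat_l; [lra|]. apply Rmult_le_compat_l; [lra | apply Lh]. }
  assert (forall t w, Cmod (cexp (int_factor L eps a (circ r t) w)) <= exp m1) as Be.
  { intros t w. eapply Rle_trans; [apply Cmod_cexp_le | apply exp_le, Bh]. }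
  pose (B' := fun t w => (cexp (int_factor L eps a (circ r t) w) * source' f F1 F2 (circ r t) w)%C).
  apply An_eq with (fun t => cexp ((-1) * int_factor L eps a (circ r t) z) * Top L (circ r t) (fun w => / circ r t * B' t w)%C z)%C.
  - apply (An_mult (circ r) r (fun t => cexp ((-1) * int_factor L eps a (circ r t) z)) (fun t => Top L (circ r t) (fun w => / circ r t * B' t w)%C z) Hb).
    + apply (An_exp (circ r) r (fun t => (-1) * int_factor L eps a (circ r t) z)%C Hb).
      exact (An_scal (circ r) r (-1) _ Hb (Ah z)).
    + apply (An_Top L r B' (c1 * (3 * m) + exp m1 * (3 * K)) (exp m1 * (3 * m)) z HL Hr).
      * assert (0 <= c1 * (3 * m)) by (apply Rmult_le_pos; lra).
        assert (0 <= exp m1 * (3 * K)) by (apply Rmult_le_pos; lra). lra.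
      * intros w. unfold B'.
        apply (An_mult (circ r) r (fun t => cexp (int_factor L eps a (circ r t) w)) (fun t => source' f F1 F2 (circ r t) w) Hb).
        -- exact (An_exp (circ r) r (fun t => int_factor L eps a (circ r t) w) Hb (Ah w)).
        -- pose proof (An_base (circ r)) as A1.
           pose proof (An_mult (circ r) r _ _ Hb A1 A1) as A2.
           pose proof (An_scal (circ r) r (RtoC (f w)) _ Hb A1) as T1.
           pose proof (An_scal (circ r) r (- / 2 * (RtoC (F1 w) - Ci * RtoC (F2 w)))%C _ Hb A2) as T2.
           pose proof (An_const (circ r) (- / 2 * (RtoC (F1 w) + Ci * RtoC (F2 w)))%C) as T3.
           apply (An_eq _ _ _ (An_plus _ _ _ (An_plus _ _ _ T1 T2) T3)).
           intros t. unfold source'. ring.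
      * intros t w w'. unfold B'. eapply Rle_trans; [apply Cmod_mult_diff|]. rewrite Rmult_plus_distr_r.
        apply Rplus_le_compat.
        -- replace (c1 * (3 * m) * Cmod (w - w')) with ((c1 * Cmod (w - w')) * (3 * m)) by ring.
           apply Rmult_le_compat; auto using Cmod_ge_0. unfold source'.
           apply source'_combination_bound; [rewrite Ec; lra | | |]; rewrite Cmod_R;
             [exact (proj1 (proj2 Hf) w) | exact (proj1 (proj2 H1) w) | exact (proj1 (proj2 H2) w)].
        -- rewrite Rmult_assoc. apply Rmult_le_compat; auto using Cmod_ge_0. unfold source'.
           match goal with |- Cmod ?e <= _ =>
             replace e with (circ r t * RtoC (f w - f w') - / 2 * (circ r t * circ r t * (RtoC (F1 w - F1 w') - Ci * RtoC (F2 w - F2 w'))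
               + (RtoC (F1 w - F1 w') + Ci * RtoC (F2 w - F2 w'))))%C by (rewrite !RtoC_minus; ring) end.
           rewrite Rmult_assoc.
           apply source'_combination_bound; [rewrite Ec; lra | | |]; rewrite Cmod_R;
             [exact (proj1 Hf w w') | exact (proj1 H1 w w') | exact (proj1 H2 w w')].
      * intros t w. unfold B'. rewrite Cmod_mult. apply Rmult_le_compat; auto using Cmod_ge_0. unfold source'.
        apply source'_combination_bound; [rewrite Ec; lra | | |]; rewrite Cmod_R;
          [exact (proj1 (proj2 Hf) w) | exact (proj1 (proj2 H1) w) | exact (proj1 (proj2 H2) w)].
  - intros t. unfold psi. replace (- int_factor L eps a (circ r t) z)%C with ((-1) * int_factor L eps a (circ r t) z)%C by ring.
    f_equal. f_equal. apply functional_extensionality. intros w. unfold B'.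
    rewrite source_source' by (apply Cmod_gt_0; rewrite Ec; lra). ring.
Qed.

(** * Real functions approximated by holomorphic ones *)

Lemma RInt_nonneg_eq_0 (g : R -> R) b x : (forall t, continuous g t) -> (forall t, 0 <= g t) ->
  RInt g 0 b = 0 -> 0 <= x < b -> g x = 0.
Proof.
  intros Hc Hp H0 Hx. destruct (Rle_lt_or_eq_dec 0 (g x) (Hp x)) as [Hg|E]; [|auto]. exfalso.
  destruct (continuous_eps_inv g x (g x / 2) (Hc x)) as [d [Hd Hs]]; [lra|].
  set (e := Rmin (d / 2) (b - x)).
  assert (0 < e) by (apply Rmin_glb_lt; lra). assert (e <= d / 2) by apply Rmin_l. assert (e <= b - x) by apply Rmin_r.
  assert (RInt g 0 x + RInt g x b = RInt g 0 b) as C1 by (apply (RInt_Chasles (V := R_CompleteNormedModule)); auto with cint).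
  assert (RInt g x (x + e) + RInt g (x + e) b = RInt g x b) as C2 by (apply (RInt_Chasles (V := R_CompleteNormedModule)); auto with cint).
  assert (0 <= RInt g 0 x) by (apply RInt_ge_0; auto with cint; lra).
  assert (0 <= RInt g (x + e) b) by (apply RInt_ge_0; auto with cint; lra).
  assert (RInt (fun _ => g x / 2) x (x + e) <= RInt g x (x + e)) as C3.
  { apply RInt_le; auto with cint; [lra | apply ex_RInt_const |]. intros y Hy.
    specialize (Hs y ltac:(rewrite Rabs_pos_eq; lra)). apply Rabs_def2 in Hs. lra. }
  rewrite RInt_const in C3. unfold scal in C3; simpl in C3; unfold mult in C3; simpl in C3.
  assert (0 < (x + e - x) * (g x / 2)) by (apply Rmult_lt_0_compat; lra). lra.
Qed.

(** With c the mean of U, the hypothesis says that the continuous nonnegative function (U - c)^2 has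
    integral zero. *)
Lemma variance_0_const (U : R -> R) p x y : 0 < p -> (forall t, continuous U t) ->
  p * RInt (fun t => U t * U t) 0 p = RInt U 0 p * RInt U 0 p ->
  0 <= x < p -> 0 <= y < p -> U x = U y.
Proof.
  intros Hp Hc HV Hx Hy. set (I := RInt U 0 p) in *. set (c := I / p).
  assert (forall t, continuous (fun t => U t - c) t) as C1.
  { intros t. apply (continuous_minus (V := R_NormedModule)); [apply Hc | apply continuous_const]. }
  assert (forall t, continuous (fun t => U t * U t) t) as C2.
  { intros t. apply (continuous_mult (K := R_AbsRing)); apply Hc. }
  assert (forall t, continuous (fun t => (2 * c) * U t) t) as C3.
  { intros t. apply (continuous_mult (K := R_AbsRing)); [apply continuous_const | apply Hc]. }
  assert (forall t, continuous (fun t => (2 * c) * U t - c * c) t) as C4.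
  { intros t. apply (continuous_minus (V := R_NormedModule)); [apply C3 | apply continuous_const]. }
  assert (RInt (fun t => U t * U t - ((2 * c) * U t - c * c)) 0 p = 0) as Z.
  { assert (RInt (fun t => U t * U t - ((2 * c) * U t - c * c)) 0 p
      = RInt (fun t => U t * U t) 0 p - RInt (fun t => (2 * c) * U t - c * c) 0 p) as ->
      by (apply (RInt_minus (V := R_CompleteNormedModule)); auto with cint).
    assert (RInt (fun t => (2 * c) * U t - c * c) 0 p
      = RInt (fun t => (2 * c) * U t) 0 p - RInt (fun _ => c * c) 0 p) as ->
      by (apply (RInt_minus (V := R_CompleteNormedModule)); [auto with cint | apply ex_RInt_const]).
    assert (RInt (fun t => (2 * c) * U t) 0 p = (2 * c) * RInt U 0 p) as ->
      by (apply (RInt_scal (V := R_CompleteNormedModule)); auto with cint).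
    assert (RInt (fun _ => c * c) 0 p = p * (c * c)) as -> by (rewrite RInt_const; unfold scal; simpl; unfold mult; simpl; ring).
    assert (forall J I c : R, p * J = I * I -> c = I / p -> J - (2 * c * I - p * (c * c)) = 0) as Alg.
    { intros J I0 c0 E ->. assert (J = I0 * I0 / p) as -> by (rewrite <- E; field; lra). field. lra. }
    apply Alg; [exact HV | reflexivity]. }
  assert (forall t, 0 <= t < p -> U t = c) as Hcst; [|rewrite (Hcst x Hx), (Hcst y Hy); reflexivity].
  intros t Ht.
  assert (U t * U t - ((2 * c) * U t - c * c) = 0) as E.
  { apply (RInt_nonneg_eq_0 (fun t => U t * U t - ((2 * c) * U t - c * c)) p t); auto.
    - intros s. apply (continuous_minus (V := R_NormedModule)); auto.
    - intros s. pose proof (pow2_ge_0 (U s - c)). simpl in H. nra. }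
  assert (U t - c = 0) by (apply Rsqr_0_uniq; unfold Rsqr; lra). lra.
Qed.

(* A real function that is a uniform limit of boundary values of holomorphic functions on discs
   satisfies mean (U^2) = (mean U)^2. *)
Lemma approx_An_const (U : R -> R) m x y : (forall t, continuous U t) -> (forall t, Rabs (U t) <= m) ->
  (forall eps, 0 < eps -> exists r P, 0 < r < 1 /\ An (circ r) P /\ forall t, Cmod (P t - RtoC (U t)) <= eps) ->
  0 <= x < 2 * PI -> 0 <= y < 2 * PI -> U x = U y.
Proof.
  intros Hc Hm HP Hx Hy. pose proof PI_RGT_0.
  assert (0 <= m) as Hm0 by (eapply Rle_trans; [apply Rabs_pos | apply (Hm 0)]).
  apply (variance_0_const U (2 * PI)); auto; [lra|].
  set (p := 2 * PI). assert (0 < p) by (unfold p; lra).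
  set (UC := fun t => RtoC (U t)).
  assert (contC UC) as cU by (apply contC_RtoC, Hc).
  assert (forall t, Cmod (UC t) <= m) as BU by (intros; unfold UC; rewrite Cmod_R; apply Hm).
  (* The expression vanishes exactly for the approximants, so for U it is bounded by a multiple of
     e. *)
  assert (RtoC p * Cint (fun t => UC t * UC t) 0 p - Cint UC 0 p * Cint UC 0 p = 0)%C as E.
  { apply (Czero_of_small _ (p * (2 * (p * (2 * m + 1))) + 2 * p * (2 * (p * (2 * m + 1))))). intros e0 He0.
    set (e := Rmin e0 1). assert (0 < e) by (apply Rmin_glb_lt; lra).
    assert (e <= e0) as Hee by apply Rmin_l. assert (e <= 1) by apply Rmin_r.
    destruct (HP e) as [r [P [Hr [AP HPU]]]]; [assumption|].
    pose proof (mean_base_circ r ltac:(lra)) as Hb. pose proof Hb as [Hcb _].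
    pose proof (An_contC _ _ Hcb AP) as cP.
    pose proof (An_mean_mult _ _ _ _ Hb AP AP) as EP. fold p in EP.
    assert (forall t, Cmod (P t) <= m + 1) as BP.
    { intros t. replace (P t) with ((P t - UC t) + UC t)%C by ring.
      eapply Rle_trans; [apply Cmod_triangle|]. specialize (HPU t). specialize (BU t). unfold UC in *. lra. }
    assert (Cmod (Cint (fun t => UC t * UC t)%C 0 p - Cint (fun t => P t * P t)%C 0 p) <= 2 * ((p - 0) * ((2 * m + 1) * e))) as D1.
    { apply Cint_close; [lra | apply contC_mult; assumption | apply contC_mult; assumption|].
      intros t. rewrite Cmod_minus_sym. eapply Rle_trans; [apply Cmod_mult_diff|].
      specialize (HPU t). change (Cmod (P t - UC t) <= e) in HPU.
      assert (Cmod (P t - UC t) * Cmod (P t) <= e * (m + 1)) by (apply Rmult_le_compat; auto using Cmod_ge_0).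
      assert (Cmod (UC t) * Cmod (P t - UC t) <= m * e) by (apply Rmult_le_compat; auto using Cmod_ge_0). lra. }
    assert (Cmod (Cint UC 0 p - Cint P 0 p) <= 2 * ((p - 0) * e)) as D2.
    { apply Cint_close; auto; [lra|]. intros t. rewrite Cmod_minus_sym. apply HPU. }
    assert (Cmod (Cint UC 0 p) <= 2 * ((p - 0) * m)) as D3 by (apply Cint_bound_const; auto; lra).
    assert (Cmod (Cint P 0 p) <= 2 * ((p - 0) * (m + 1))) as D4 by (apply Cint_bound_const; auto; lra).
    rewrite Rminus_0_r in *.
    replace (RtoC p * Cint (fun t => UC t * UC t) 0 p - Cint UC 0 p * Cint UC 0 p)%C
      with (RtoC p * (Cint (fun t => UC t * UC t) 0 p - Cint (fun t => P t * P t) 0 p)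
       - (Cint UC 0 p * Cint UC 0 p - Cint P 0 p * Cint P 0 p))%C by (rewrite <- EP; ring).
    eapply Rle_trans; [apply Cmod_triangle_minus|].
    pose proof (Cmod_mult_diff (Cint UC 0 p) (Cint UC 0 p) (Cint P 0 p) (Cint P 0 p)) as D5.
    rewrite Cmod_mult, Cmod_R, (Rabs_pos_eq p) by lra.
    assert (Cmod (Cint UC 0 p - Cint P 0 p) * Cmod (Cint UC 0 p) <= (2 * (p * e)) * (2 * (p * m)))
      by (apply Rmult_le_compat; auto using Cmod_ge_0).
    assert (Cmod (Cint P 0 p) * Cmod (Cint UC 0 p - Cint P 0 p) <= (2 * (p * (m + 1))) * (2 * (p * e)))
      by (apply Rmult_le_compat; auto using Cmod_ge_0).
    apply Rmult_le_compat_l with (r := p) in D1; [|lra].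
    set (k := p * (2 * (p * (2 * m + 1))) + 2 * p * (2 * (p * (2 * m + 1)))).
    assert (0 <= k) by (unfold k; nra).
    apply Rle_trans with (k * e); [unfold k; lra | apply Rmult_le_compat_l; lra]. }
  unfold UC in E. rewrite Cint_RtoC in E.
  assert (Cint (fun t => RtoC (U t) * RtoC (U t))%C 0 p = RtoC (RInt (fun t => U t * U t) 0 p)) as E2.
  { rewrite <- Cint_RtoC. f_equal. apply functional_extensionality. intros; rewrite RtoC_mult; reflexivity. }
  rewrite E2, <- !RtoC_mult, <- RtoC_minus in E. apply RtoC_inj in E. unfold p in *. lra.
Qed.

(** The constant in [psi_close] does not involve phi, so the approximation is uniform on the whole
    circle of directions. *)
Lemma transport_solution_isotropic M m K a f F1 F2 (u : R -> C -> R) z x y :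
  0 < M -> 0 <= K -> lip_supported M m K a -> lip_supported M m K f -> lip_supported M m K F1 -> lip_supported M m K F2 ->
  (forall phi, lip_supported M m K (u phi)) ->
  (forall phi x, derivable_pt_lim (fun t => u phi (x + RtoC t * expi phi)%C) 0
      (f x - (cos phi * F1 x + sin phi * F2 x) - a x * u phi x)) ->
  (forall t, continuous (fun phi => u phi z) t) -> Cmod z <= M ->
  0 <= x < 2 * PI -> 0 <= y < 2 * PI -> u x z = u y z.
Proof.
  intros HM HK Ha Hf H1 H2 Hu Htr Hcont Hz Hx Hy.
  apply (approx_An_const (fun phi => u phi z) m); auto.
  { intros t. exact (proj1 (proj2 (Hu t)) z). }
  intros e0 He0.
  assert (0 <= m) as Hm0 by (eapply Rle_trans; [apply Rabs_pos | apply (proj1 (proj2 Ha) 0%C)]).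
  pose proof (fun r phi Hr => psi_close M m K a f F1 F2 (u phi) r phi z HM HK Ha Hf H1 H2 (Hu phi) (Htr phi) Hr Hz) as PC.
  match type of PC with forall r phi, _ -> _ <= ?c * _ => set (C0 := c) in PC end.
  (* With r = 1 - d^2 the quantity sqrt (1 - r) is d; the cap 1/2 ensures r >= 1/2. *)
  set (d := Rmin e0 (/ 2) / (Rabs C0 + 1)). pose proof (Rabs_pos C0).
  assert (0 < Rmin e0 (/ 2)) by (apply Rmin_glb_lt; lra).
  assert (Rmin e0 (/ 2) <= e0) by apply Rmin_l. assert (Rmin e0 (/ 2) <= / 2) by apply Rmin_r.
  assert (0 < d) by (apply Rdiv_lt_0_compat; lra).
  assert (d * (Rabs C0 + 1) = Rmin e0 (/ 2)) as Ed by (unfold d; field; lra).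
  assert (d <= / 2) by nra.
  assert (0 < d ^ 2 <= / 2) as Hd2 by (simpl; nra).
  exists (1 - d ^ 2), (fun t => psi (2 * M + 5) (1 - (1 - d ^ 2)) a f F1 F2 (circ (1 - d ^ 2) t) z).
  split; [lra|]. split.
  - apply (An_psi M m K); auto; lra.
  - intros t. specialize (PC (1 - d ^ 2) t ltac:(lra)).
    replace (sqrt (1 - (1 - d ^ 2))) with d in PC.
    2: { replace (1 - (1 - d ^ 2)) with (d * d) by ring. rewrite sqrt_square; lra. }
    eapply Rle_trans; [exact PC|]. pose proof (Rle_abs C0). nra.
Qed.

(** * The transport equation along lines *)

(** Attenuation accumulated from -N. On a given line it differs from -Da by a constant, which drops
    out of every vanishing condition. *)
Definition att (N : R) (al : R -> R) (s : R) : R := RInt al (- N) s.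
(** Variation of constants for y' + al y = be with y = 0 at -N. *)
Definition line_sol (N : R) (al be : R -> R) (s : R) : R :=
  exp (- att N al s) * RInt (fun t => be t * exp (att N al t)) (- N) s.

Lemma derivable_continuous_at (h : R -> R) t l : derivable_pt_lim h t l -> continuous h t.
Proof.
  intros H. apply continuity_pt_filterlim. apply derivable_continuous_pt. exists l. exact H.
Qed.

Lemma att_derive N (al : R -> R) s : (forall t, continuous al t) -> derivable_pt_lim (att N al) s (al s).
Proof. intros H. apply RInt_upper_derive. exact H. Qed.

Lemma line_sol_integrand_continuous N (al be : R -> R) : (forall t, continuous al t) -> (forall t, continuous be t) ->
  forall t, continuous (fun t => be t * exp (att N al t)) t.
Proof.
  intros Ha Hb t. apply (continuous_mult (K := R_AbsRing)); [apply Hb|].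
  apply (derivable_continuous_at _ _ (exp (att N al t) * al t)).
  apply (derivable_pt_lim_comp (att N al) exp); [apply att_derive, Ha | apply derivable_pt_lim_exp].
Qed.

Lemma line_sol_derive N (al be : R -> R) s : (forall t, continuous al t) -> (forall t, continuous be t) ->
  derivable_pt_lim (line_sol N al be) s (be s - al s * line_sol N al be s).
Proof.
  intros Ha Hb. unfold line_sol.
  assert (derivable_pt_lim (fun s => exp (- att N al s)) s (exp (- att N al s) * (- al s))) as D1.
  { apply (derivable_pt_lim_comp (fun s => - att N al s) exp); [|apply derivable_pt_lim_exp].
    apply (derivable_pt_lim_opp (att N al)). apply att_derive, Ha. }
  pose proof (RInt_upper_derive _ (- N) s (line_sol_integrand_continuous N al be Ha Hb)) as D2.
  pose proof (derivable_pt_lim_mult _ _ s _ _ D1 D2) as D. cbv beta in D.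
  match type of D with derivable_pt_lim _ _ ?l => replace (be s - al s * _) with l; [exact D|] end.
  assert (forall X Y I b c : R, X * Y = 1 -> X * - c * I + X * (b * Y) = b - c * (X * I)) as Alg.
  { intros X Y I b c E. replace (X * (b * Y)) with (b * (X * Y)) by ring. rewrite E. ring. }
  apply Alg. rewrite <- exp_plus, Rplus_opp_l. apply exp_0.
Qed.

Lemma exp_lip B x y : Rabs x <= B -> Rabs y <= B -> Rabs (exp x - exp y) <= exp B * Rabs (x - y).
Proof.
  intros Hx Hy. destruct (MVT_gen exp y x exp) as [c [Hc E]].
  - intros. apply is_derive_Reals, derivable_pt_lim_exp.
  - intros. apply derivable_continuous_pt, derivable_pt_exp.
  - rewrite E, Rabs_mult, (Rabs_pos_eq (exp c)) by (left; apply exp_pos).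
    apply Rmult_le_compat_r; [apply Rabs_pos|]. apply exp_le.
    apply Rabs_le_between in Hx. apply Rabs_le_between in Hy.
    destruct Hc as [_ Hc]. eapply Rle_trans; [exact Hc|]. apply Rmax_lub; lra.
Qed.

Lemma RInt_abs_bound_sub (h : R -> R) N s B : - N <= s <= N -> 0 <= B -> (forall t, continuous h t) ->
  (forall t, - N <= t <= N -> Rabs (h t) <= B) -> Rabs (RInt h (- N) s) <= 2 * N * B.
Proof.
  intros Hs HB Hc H. eapply Rle_trans; [apply (RInt_abs_bound h B); [lra | exact Hc |]|].
  - intros t Ht. apply H. lra.
  - apply Rmult_le_compat_r; lra.
Qed.

Lemma RInt_close_sub (g h : R -> R) N s d : - N <= s <= N -> 0 <= d ->
  (forall t, continuous g t) -> (forall t, continuous h t) ->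
  (forall t, - N <= t <= N -> Rabs (g t - h t) <= d) ->
  Rabs (RInt g (- N) s - RInt h (- N) s) <= 2 * N * d.
Proof.
  intros Hs Hd Hg Hh H.
  assert (RInt (fun t => g t - h t) (- N) s = RInt g (- N) s - RInt h (- N) s) as <-
    by (apply (RInt_minus (V := R_CompleteNormedModule)); auto with cint).
  apply RInt_abs_bound_sub; auto. intros t. apply (continuous_minus (V := R_NormedModule)); auto.
Qed.

Lemma Rabs_mult_diff a b c d A0 D : Rabs b <= A0 -> Rabs c <= D ->
  Rabs (a * b - c * d) <= Rabs (a - c) * A0 + D * Rabs (b - d).
Proof.
  intros Hb Hc. replace (a * b - c * d) with ((a - c) * b + c * (b - d)) by ring.
  eapply Rle_trans; [apply Rabs_triang|]. rewrite !Rabs_mult.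
  apply Rplus_le_compat; apply Rmult_le_compat; auto using Rabs_pos; lra.
Qed.

Definition line_sol_bd (N B : R) : R := exp (2 * N * B) * (2 * N * (B * exp (2 * N * B))).
Definition line_sol_lip (N B : R) : R :=
  exp (2 * N * B) * (2 * N) * (2 * N * (B * exp (2 * N * B)))
  + exp (2 * N * B) * (2 * N * (exp (2 * N * B) + B * (exp (2 * N * B) * (2 * N)))).

(** Continuous dependence on coefficient and source. Changing the line, by offset or by angle,
    changes just these two, so this gives the regularity of the transport solution in the directions
    where no equation holds. *)
Lemma line_sol_compare N B (al be al' be' : R -> R) s d : 0 <= N -> 0 <= B -> 0 <= d -> - N <= s <= N ->
  (forall t, continuous al t) -> (forall t, continuous be t) ->
  (forall t, continuous al' t) -> (forall t, continuous be' t) ->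
  (forall t, Rabs (al t) <= B) -> (forall t, Rabs (be t) <= B) ->
  (forall t, Rabs (al' t) <= B) -> (forall t, Rabs (be' t) <= B) ->
  (forall t, - N <= t <= N -> Rabs (al t - al' t) <= d) ->
  (forall t, - N <= t <= N -> Rabs (be t - be' t) <= d) ->
  Rabs (line_sol N al be s) <= line_sol_bd N B /\
  Rabs (line_sol N al be s - line_sol N al' be' s) <= line_sol_lip N B * d.
Proof.
  intros HN HB Hd Hs Ca Cb Ca' Cb' Ba Bb Ba' Bb' Da Db.
  set (E := exp (2 * N * B)). assert (0 < E) as HE by apply exp_pos.
  assert (forall t, - N <= t <= N -> Rabs (att N al t) <= 2 * N * B) as Be
    by (intros; apply RInt_abs_bound_sub; auto).
  assert (forall t, - N <= t <= N -> Rabs (att N al' t) <= 2 * N * B) as Be'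
    by (intros; apply RInt_abs_bound_sub; auto).
  assert (forall t, - N <= t <= N -> Rabs (att N al t - att N al' t) <= 2 * N * d) as De
    by (intros; apply RInt_close_sub; auto).
  assert (forall x, Rabs x <= 2 * N * B -> Rabs (exp x) <= E) as Bexp.
  { intros x Hx. rewrite Rabs_pos_eq by (left; apply exp_pos). apply exp_le.
    eapply Rle_trans; [apply Rle_abs | exact Hx]. }
  assert (Rabs (RInt (fun t => be t * exp (att N al t)) (- N) s) <= 2 * N * (B * E)) as BI.
  { apply RInt_abs_bound_sub; auto.
    - apply Rmult_le_pos; lra.
    - apply line_sol_integrand_continuous; assumption.
    - intros t Ht. rewrite Rabs_mult. apply Rmult_le_compat; auto using Rabs_pos. }
  assert (Rabs (RInt (fun t => be t * exp (att N al t)) (- N) s - RInt (fun t => be' t * exp (att N al' t)) (- N) s)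
     <= 2 * N * (d * E + B * (E * (2 * N * d)))) as DI.
  { apply RInt_close_sub; auto.
    - assert (0 <= E * (2 * N * d)) by (repeat apply Rmult_le_pos; lra).
      apply Rplus_le_le_0_compat; apply Rmult_le_pos; lra.
    - apply line_sol_integrand_continuous; assumption.
    - apply line_sol_integrand_continuous; assumption.
    - intros t Ht. eapply Rle_trans; [apply (Rabs_mult_diff _ _ _ _ E B); auto|].
      apply Rplus_le_compat; [apply Rmult_le_compat_r; auto; lra|].
      apply Rmult_le_compat_l; [exact HB|].
      eapply Rle_trans; [apply (exp_lip (2 * N * B)); auto|]. apply Rmult_le_compat_l; [lra | auto]. }
  split.
  - unfold line_sol. rewrite Rabs_mult. apply Rmult_le_compat; auto using Rabs_pos.
    apply Bexp. rewrite Rabs_Ropp. auto.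
  - unfold line_sol. eapply Rle_trans; [apply (Rabs_mult_diff _ _ _ _ (2 * N * (B * E)) E); auto|].
    + apply Bexp. rewrite Rabs_Ropp. auto.
    + unfold line_sol_lip. fold E.
      assert (Rabs (exp (- att N al s) - exp (- att N al' s)) <= E * (2 * N * d)) as T.
      { eapply Rle_trans; [apply (exp_lip (2 * N * B)); rewrite Rabs_Ropp; auto|].
        apply Rmult_le_compat_l; [lra|].
        replace (- att N al s - - att N al' s) with (- (att N al s - att N al' s)) by ring.
        rewrite Rabs_Ropp. auto. }
      assert (Rabs (exp (- att N al s) - exp (- att N al' s)) * (2 * N * (B * E)) <= E * (2 * N * d) * (2 * N * (B * E))).
      { apply Rmult_le_compat_r; [|exact T]. apply Rmult_le_pos; [lra|]. apply Rmult_le_pos; lra. }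
      assert (E * Rabs (RInt (fun t => be t * exp (att N al t)) (- N) s - RInt (fun t => be' t * exp (att N al' t)) (- N) s)
        <= E * (2 * N * (d * E + B * (E * (2 * N * d))))) by (apply Rmult_le_compat_l; lra).
      lra.
Qed.

(* arc length parameter s on the line e^{i phi} (s + i p) *)
Definition line_pt (phi p s : R) : C := (expi phi * (s, p))%C.

Lemma Cmod_line_pt phi p s : Cmod (line_pt phi p s) = Cmod (s, p).
Proof. unfold line_pt. rewrite Cmod_mult, Cmod_expi. ring. Qed.

(** Inverse of [line_pt]: the real part is the arc length on the line through z, the imaginary part
    is the offset of that line. *)
Definition line_coord (phi : R) (z : C) : C := (expi (- phi) * z)%C.

Lemma line_pt_coord phi z : line_pt phi (snd (line_coord phi z)) (fst (line_coord phi z)) = z.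
Proof.
  unfold line_pt. rewrite <- surjective_pairing. unfold line_coord.
  rewrite Cmult_assoc, <- expi_plus, Rplus_opp_r, expi_0. ring.
Qed.

Lemma Cmod_line_coord phi z : Cmod (line_coord phi z) = Cmod z.
Proof. unfold line_coord. rewrite Cmod_mult, Cmod_expi. ring. Qed.

Definition src (f F1 F2 : C -> R) (phi : R) (z : C) : R := f z - (cos phi * F1 z + sin phi * F2 z).

Definition transport_sol (N : R) (a f F1 F2 : C -> R) (phi : R) (z : C) : R :=
  line_sol N (fun s => a (line_pt phi (snd (line_coord phi z)) s))
         (fun s => src f F1 F2 phi (line_pt phi (snd (line_coord phi z)) s)) (fst (line_coord phi z)).

Lemma src_compare M m K f F1 F2 phi psi z w : 0 <= K -> lip_supported M m K f -> lip_supported M m K F1 -> lip_supported M m K F2 ->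
  Rabs (src f F1 F2 phi z) <= 3 * m /\
  Rabs (src f F1 F2 phi z - src f F1 F2 psi w) <= 3 * K * Cmod (z - w) + 2 * m * Rabs (phi - psi).
Proof.
  intros HK [Lf [Bf _]] [L1 [B1 _]] [L2 [B2 _]].
  assert (0 <= m) by (eapply Rle_trans; [apply Rabs_pos | apply (Bf 0%C)]).
  assert (forall x, Rabs (cos x) <= 1) as Bc by (intros; apply Rabs_le, COS_bound).
  assert (forall x, Rabs (sin x) <= 1) as Bs by (intros; apply Rabs_le, SIN_bound).
  unfold src. split.
  - assert (Rabs (cos phi * F1 z) <= 1 * m) by (rewrite Rabs_mult; apply Rmult_le_compat; auto using Rabs_pos).
    assert (Rabs (sin phi * F2 z) <= 1 * m) by (rewrite Rabs_mult; apply Rmult_le_compat; auto using Rabs_pos).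
    unfold Rminus. eapply Rle_trans; [apply Rabs_triang|]. rewrite Rabs_Ropp.
    pose proof (Rabs_triang (cos phi * F1 z) (sin phi * F2 z)). specialize (Bf z). lra.
  - pose proof (Rabs_mult_diff (cos phi) (F1 z) (cos psi) (F1 w) m 1 (B1 z) (Bc psi)) as T1.
    pose proof (Rabs_mult_diff (sin phi) (F2 z) (sin psi) (F2 w) m 1 (B2 z) (Bs psi)) as T2.
    pose proof (Rabs_cos_diff phi psi). pose proof (Rabs_sin_diff phi psi).
    specialize (Lf z w). specialize (L1 z w). specialize (L2 z w).
    replace (f z - (cos phi * F1 z + sin phi * F2 z) - (f w - (cos psi * F1 w + sin psi * F2 w)))
     with ((f z - f w) + (- (cos phi * F1 z - cos psi * F1 w) + - (sin phi * F2 z - sin psi * F2 w))) by ring.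
    eapply Rle_trans; [apply Rabs_triang|]. eapply Rle_trans; [apply Rplus_le_compat_l, Rabs_triang|].
    rewrite !Rabs_Ropp.
    assert (Rabs (cos phi - cos psi) * m <= Rabs (phi - psi) * m) by (apply Rmult_le_compat_r; assumption).
    assert (Rabs (sin phi - sin psi) * m <= Rabs (phi - psi) * m) by (apply Rmult_le_compat_r; assumption).
    lra.
Qed.

Lemma line_pt_lip_s phi p s t : Cmod (line_pt phi p s - line_pt phi p t) = Rabs (s - t).
Proof.
  unfold line_pt. replace (expi phi * (s, p) - expi phi * (t, p))%C with (expi phi * (s - t, 0)%R)%C
    by (apply injective_projections; simpl; ring).
  rewrite Cmod_mult, Cmod_expi, Cmod_real. ring.
Qed.
Lemma line_pt_lip_p phi p q s : Cmod (line_pt phi p s - line_pt phi q s) = Rabs (p - q).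
Proof.
  unfold line_pt. replace (expi phi * (s, p) - expi phi * (s, q))%C with (expi phi * (0, p - q)%R)%C
    by (apply injective_projections; simpl; ring).
  rewrite Cmod_mult, Cmod_expi, Cmod_imag. ring.
Qed.
Lemma line_pt_lip_phi phi psi p s : Cmod (line_pt phi p s - line_pt psi p s) <= 2 * (Rabs s + Rabs p) * Rabs (phi - psi).
Proof.
  unfold line_pt. replace (expi phi * (s, p) - expi psi * (s, p))%C with ((expi phi - expi psi) * (s, p))%C by ring.
  rewrite Cmod_mult. pose proof (Cmod_le_sum (s, p)) as T. simpl in T.
  replace (2 * (Rabs s + Rabs p) * Rabs (phi - psi)) with ((2 * Rabs (phi - psi)) * (Rabs s + Rabs p)) by ring.
  apply Rmult_le_compat; auto using Cmod_ge_0, expi_lip.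
Qed.

Lemma line_pt_continuous M m K a phi p : 0 <= K -> lip_supported M m K a -> forall t, continuous (fun s => a (line_pt phi p s)) t.
Proof.
  intros HK [L _]. apply (continuous_lip _ K HK). intros s t. rewrite <- (line_pt_lip_s phi p s t). apply L.
Qed.
Lemma line_src_continuous M m K f F1 F2 phi p : 0 <= K -> lip_supported M m K f -> lip_supported M m K F1 -> lip_supported M m K F2 ->
  forall t, continuous (fun s => src f F1 F2 phi (line_pt phi p s)) t.
Proof.
  intros HK Hf H1 H2. apply (continuous_lip _ (3 * K)); [lra|]. intros s t.
  rewrite <- (line_pt_lip_s phi p s t).
  destruct (src_compare M m K f F1 F2 phi phi (line_pt phi p s) (line_pt phi p t) HK Hf H1 H2) as [_ T].
  rewrite Rminus_diag, Rabs_R0 in T. lra.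
Qed.

Lemma Cmod_pair_lt s t p : Rabs s <= Rabs t -> Cmod (s, p) <= Cmod (t, p).
Proof.
  intros H. unfold Cmod; simpl fst; simpl snd. apply sqrt_le_1_alt.
  assert (s ^ 2 <= t ^ 2); [|lra]. rewrite <- (pow2_abs s), <- (pow2_abs t).
  apply pow_incr. split; [apply Rabs_pos | exact H].
Qed.

Lemma RInt_zero_fun (h : R -> R) u v : (forall t, Rmin u v <= t <= Rmax u v -> h t = 0) -> RInt h u v = 0.
Proof.
  intros H. rewrite (RInt_ext (V := R_CompleteNormedModule) h (fun _ => 0)).
  - rewrite RInt_const. apply Rmult_0_r.
  - intros t Ht. apply H. lra.
Qed.

(** Outside the disc, moving further away from the foot point s = 0 stays outside. For s <= 0 the
    integral from -N to s meets no source. For s > 0 the vanishing total turns it into minus the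
    integral from s to N, which meets none either. This is where the data give compact support on
    both sides. *)
Lemma line_sol_support M m K N a f F1 F2 phi p s : 0 <= K -> M < N ->
  lip_supported M m K a -> lip_supported M m K f -> lip_supported M m K F1 -> lip_supported M m K F2 ->
  RInt (fun s => src f F1 F2 phi (line_pt phi p s) * exp (att N (fun s => a (line_pt phi p s)) s)) (- N) N = 0 ->
  M < Cmod (s, p) ->
  line_sol N (fun s => a (line_pt phi p s)) (fun s => src f F1 F2 phi (line_pt phi p s)) s = 0.
Proof.
  intros HK HMN Ha Hf H1 H2 HD Hs. unfold line_sol.
  set (h := fun s => src f F1 F2 phi (line_pt phi p s) * exp (att N (fun s => a (line_pt phi p s)) s)) in *.
  assert (forall t, continuous h t) as Hc.
  { apply line_sol_integrand_continuous; [apply (line_pt_continuous M m K) | apply (line_src_continuous M m K)]; assumption. }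
  assert (forall t, M < Cmod (t, p) -> h t = 0) as Z.
  { intros t Ht. unfold h, src. destruct Hf as [_ [_ Zf]], H1 as [_ [_ Z1]], H2 as [_ [_ Z2]].
    rewrite Zf, Z1, Z2 by (rewrite Cmod_line_pt; exact Ht). ring. }
  assert (forall t, N <= Rabs t -> M < Cmod (t, p)) as Far.
  { intros t Ht. pose proof (fst_le_Cmod (t, p)) as T. simpl in T. lra. }
  enough (RInt h (- N) s = 0) as -> by ring.
  destruct (Rle_lt_dec s 0) as [H0|H0].
  - apply RInt_zero_fun. intros t Ht. apply Z.
    destruct (Rle_lt_dec t (- N)) as [Hl|Hl].
    + apply Far. rewrite <- Rabs_Ropp. eapply Rle_trans; [|apply Rle_abs]. lra.
    + eapply Rlt_le_trans; [exact Hs|]. apply Cmod_pair_lt.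
      assert (t <= s) by (unfold Rmax, Rmin in Ht; destruct (Rle_dec (- N) s); lra).
      rewrite !Rabs_left1 by lra. lra.
  - assert (RInt h (- N) s + RInt h s N = RInt h (- N) N) as C1
      by (apply (RInt_Chasles (V := R_CompleteNormedModule)); auto with cint).
    rewrite HD in C1. enough (RInt h s N = 0) by lra.
    apply RInt_zero_fun. intros t Ht. apply Z.
    destruct (Rle_lt_dec N t) as [Hl|Hl].
    + apply Far. eapply Rle_trans; [|apply Rle_abs]. exact Hl.
    + eapply Rlt_le_trans; [exact Hs|]. apply Cmod_pair_lt.
      assert (s <= t) by (unfold Rmax, Rmin in Ht; destruct (Rle_dec s N); lra).
      rewrite !Rabs_pos_eq by lra. lra.
Qed.

Definition lines_vanish (N : R) (a f F1 F2 : C -> R) : Prop :=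
  forall phi p,
  RInt (fun s => src f F1 F2 phi (line_pt phi p s) * exp (att N (fun s => a (line_pt phi p s)) s)) (- N) N = 0.

Lemma lip_supported_weaken M m K m' K' g : m <= m' -> K <= K' -> lip_supported M m K g -> lip_supported M m' K' g.
Proof.
  intros Hm HK [L [B Z]]. split; [|split; [|exact Z]].
  - intros z w. eapply Rle_trans; [apply L|]. apply Rmult_le_compat_r; [apply Cmod_ge_0 | exact HK].
  - intros z. eapply Rle_trans; [apply B | exact Hm].
Qed.

Lemma Rabs_fst_line_coord phi z w : Rabs (fst (line_coord phi z) - fst (line_coord phi w)) <= Cmod (z - w).
Proof.
  rewrite <- (Cmod_line_coord phi (z - w)). eapply Rle_trans; [|apply fst_le_Cmod].
  apply Req_le. f_equal. unfold line_coord. simpl. ring.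
Qed.
Lemma Rabs_snd_line_coord phi z w : Rabs (snd (line_coord phi z) - snd (line_coord phi w)) <= Cmod (z - w).
Proof.
  rewrite <- (Cmod_line_coord phi (z - w)). eapply Rle_trans; [|apply snd_le_Cmod].
  apply Req_le. f_equal. unfold line_coord. simpl. ring.
Qed.
Lemma line_coord_lip_phi phi psi z : Cmod (line_coord phi z - line_coord psi z) <= 2 * Cmod z * Rabs (phi - psi).
Proof.
  unfold line_coord. replace (expi (- phi) * z - expi (- psi) * z)%C with ((expi (- phi) - expi (- psi)) * z)%C by ring.
  rewrite Cmod_mult. pose proof (expi_lip (- phi) (- psi)) as E.
  replace (- phi - - psi) with (- (phi - psi)) in E by ring. rewrite Rabs_Ropp in E.
  replace (2 * Cmod z * Rabs (phi - psi)) with ((2 * Rabs (phi - psi)) * Cmod z) by ring.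
  apply Rmult_le_compat_r; [apply Cmod_ge_0 | exact E].
Qed.

Lemma continuous_of_local_lip (h : R -> R) t L : 0 <= L ->
  (forall s, Rabs (s - t) <= 1 -> Rabs (h s - h t) <= L * Rabs (s - t)) -> continuous h t.
Proof.
  intros HL H. apply continuous_eps. intros e He. exists (Rmin 1 (e / (L + 1))).
  assert (0 < e / (L + 1)) by (apply Rdiv_lt_0_compat; lra).
  split; [apply Rmin_glb_lt; lra|]. intros s Hs.
  assert (Rabs (s - t) < 1) by (eapply Rlt_le_trans; [exact Hs | apply Rmin_l]).
  assert (Rabs (s - t) < e / (L + 1)) as H2 by (eapply Rlt_le_trans; [exact Hs | apply Rmin_r]).
  eapply Rle_lt_trans; [apply H; lra|].
  apply Rmult_lt_compat_l with (r := L + 1) in H2; [|lra].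
  replace ((L + 1) * (e / (L + 1))) with e in H2 by (field; lra).
  pose proof (Rabs_pos (s - t)). nra.
Qed.

(** A step along theta changes the arc length and keeps the line, so this is the differential
    equation of [line_sol]. *)
Lemma transport_sol_derive M m K N a f F1 F2 phi z : 0 <= K ->
  lip_supported M m K a -> lip_supported M m K f -> lip_supported M m K F1 -> lip_supported M m K F2 ->
  derivable_pt_lim (fun t => transport_sol N a f F1 F2 phi (z + RtoC t * expi phi)%C) 0
    (src f F1 F2 phi z - a z * transport_sol N a f F1 F2 phi z).
Proof.
  intros HK Ha Hf H1 H2. set (p := snd (line_coord phi z)). set (s := fst (line_coord phi z)).
  pose proof (line_sol_derive N (fun s => a (line_pt phi p s)) (fun s => src f F1 F2 phi (line_pt phi p s)) s
    (line_pt_continuous M m K a phi p HK Ha) (line_src_continuous M m K f F1 F2 phi p HK Hf H1 H2)) as D.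
  cbv beta in D. unfold p, s in D. rewrite !line_pt_coord in D. fold p s in D.
  change (line_sol N (fun s0 => a (line_pt phi p s0)) (fun s0 => src f F1 F2 phi (line_pt phi p s0)) s)
    with (transport_sol N a f F1 F2 phi z) in D.
  assert (derivable_pt_lim (fun t => s + t) 0 1) as Ds.
  { replace 1 with (0 + 1) by ring. apply derivable_pt_lim_plus; [apply derivable_pt_lim_const | apply derivable_pt_lim_id]. }
  replace s with (s + 0) in D by ring.
  pose proof (derivable_pt_lim_comp _ _ _ _ _ Ds D) as Dc. rewrite Rmult_1_r in Dc.
  eapply derivable_pt_lim_ext; [|exact Dc]. intros t. unfold comp, transport_sol.
  assert (line_coord phi (z + RtoC t * expi phi) = line_coord phi z + RtoC t)%C as ->.
  { unfold line_coord. replace (expi (- phi) * (z + RtoC t * expi phi))%C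
      with (expi (- phi) * z + RtoC t * (expi (- phi) * expi phi))%C by ring. rewrite expi_opp_mult. ring. }
  replace (fst (line_coord phi z + RtoC t)%C) with (s + t) by reflexivity.
  replace (snd (line_coord phi z + RtoC t)%C) with p by (symmetry; exact (Rplus_0_r _)). reflexivity.
Qed.

Lemma transport_sol_estimates M m K N a f F1 F2 : 0 < M -> M < N -> 0 <= K ->
  lip_supported M m K a -> lip_supported M m K f -> lip_supported M m K F1 -> lip_supported M m K F2 -> lines_vanish N a f F1 F2 ->
  exists m' K', m <= m' /\ K <= K' /\ (forall phi, lip_supported M m' K' (transport_sol N a f F1 F2 phi)) /\
    (forall z phi, continuous (fun phi => transport_sol N a f F1 F2 phi z) phi).
Proof.
  intros HM HN HK Ha Hf H1 H2 HD.
  assert (0 <= m) as Hm by (eapply Rle_trans; [apply Rabs_pos | apply (proj1 (proj2 Ha) 0%C)]).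
  (* [B] bounds both the attenuation and the source, to which f, F1 and F2 contribute m each. *)
  set (B := 3 * m). assert (0 <= B) as HB by (unfold B; lra). assert (0 <= N) as HN0 by lra.
  set (W := fun phi p s => line_sol N (fun s => a (line_pt phi p s)) (fun s => src f F1 F2 phi (line_pt phi p s)) s).
  pose proof (fun phi p => line_pt_continuous M m K a phi p HK Ha) as Ca.
  pose proof (fun phi p => line_src_continuous M m K f F1 F2 phi p HK Hf H1 H2) as Cs.
  assert (forall z, Rabs (a z) <= B) as Ba.
  { intros z. pose proof (proj1 (proj2 Ha) z). unfold B. lra. }
  assert (forall phi z, Rabs (src f F1 F2 phi z) <= B) as Bs.
  { intros phi z. exact (proj1 (src_compare M m K f F1 F2 phi phi z z HK Hf H1 H2)). }
  assert (forall phi p s, M < Cmod (s, p) -> W phi p s = 0) as Supp.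
  { intros phi p s. exact (line_sol_support M m K N a f F1 F2 phi p s HK HN Ha Hf H1 H2 (HD phi p)). }
  assert (forall phi p s, N < Rabs s -> W phi p s = 0) as Supp'.
  { intros phi p s Hs. apply Supp. pose proof (fst_le_Cmod (s, p)) as T. simpl in T. lra. }
  assert (0 <= line_sol_bd N B) as Hbd.
  { unfold line_sol_bd. pose proof (exp_pos (2 * N * B)). apply Rmult_le_pos; [lra|].
    apply Rmult_le_pos; [lra|]. apply Rmult_le_pos; lra. }
  assert (0 <= line_sol_lip N B) as Hlip.
  { unfold line_sol_lip. pose proof (exp_pos (2 * N * B)). set (E := exp (2 * N * B)) in *.
    assert (0 <= B * E) by (apply Rmult_le_pos; lra). assert (0 <= B * (E * (2 * N))) by (apply Rmult_le_pos; nra).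
    apply Rplus_le_le_0_compat; repeat apply Rmult_le_pos; lra. }
  assert (forall phi p psi q s d, 0 <= d -> - N <= s <= N ->
     (forall t, - N <= t <= N -> Rabs (a (line_pt phi p t) - a (line_pt psi q t)) <= d) ->
     (forall t, - N <= t <= N -> Rabs (src f F1 F2 phi (line_pt phi p t) - src f F1 F2 psi (line_pt psi q t)) <= d) ->
     Rabs (W phi p s) <= line_sol_bd N B /\ Rabs (W phi p s - W psi q s) <= line_sol_lip N B * d) as Cmp.
  { intros phi p psi q s d Hd Hs Da Ds.
    exact (line_sol_compare N B _ _ _ _ s d HN0 HB Hd Hs (Ca phi p) (Cs phi p) (Ca psi q) (Cs psi q)
      (fun t => Ba _) (fun t => Bs _ _) (fun t => Ba _) (fun t => Bs _ _) Da Ds). }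
  assert (forall phi p s, Rabs (W phi p s) <= line_sol_bd N B) as BW.
  { intros phi p s. destruct (Rle_lt_dec (Rabs s) N) as [Hs|Hs].
    - apply (Cmp phi p phi p s 0); [lra | apply Rabs_le_between; exact Hs | |];
      intros; rewrite Rminus_diag, Rabs_R0; lra.
    - rewrite Supp', Rabs_R0 by exact Hs. exact Hbd. }
  (* Along the line the equation itself bounds the derivative. *)
  assert (forall phi p s t, Rabs (W phi p s - W phi p t) <= (B + B * line_sol_bd N B) * Rabs (s - t)) as Ls.
  { intros phi p s t.
    destruct (MVT_gen (W phi p) t s (fun x => src f F1 F2 phi (line_pt phi p x) - a (line_pt phi p x) * W phi p x)) as [c [_ E]].
    - intros x _. apply is_derive_Reals. exact (line_sol_derive N _ _ x (Ca phi p) (Cs phi p)).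
    - intros x _. apply derivable_continuous_pt. eexists. exact (line_sol_derive N _ _ x (Ca phi p) (Cs phi p)).
    - rewrite E, Rabs_mult. apply Rmult_le_compat_r; [apply Rabs_pos|].
      unfold Rminus. eapply Rle_trans; [apply Rabs_triang|]. rewrite Rabs_Ropp, Rabs_mult.
      apply Rplus_le_compat; [apply Bs|]. apply Rmult_le_compat; auto using Rabs_pos. }
  assert (forall phi p psi q s d, 0 <= d ->
     (forall t, - N <= t <= N -> Rabs (a (line_pt phi p t) - a (line_pt psi q t)) <= d) ->
     (forall t, - N <= t <= N -> Rabs (src f F1 F2 phi (line_pt phi p t) - src f F1 F2 psi (line_pt psi q t)) <= d) ->
     Rabs (W phi p s - W psi q s) <= line_sol_lip N B * d) as Cmp'.
  (* Outside the window |s| <= N both solutions vanish, so the comparison extends to every s. *)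
  { intros phi p psi q s d Hd Da Ds. destruct (Rle_lt_dec (Rabs s) N) as [Hs|Hs].
    - apply (Cmp phi p psi q s d Hd); auto. apply Rabs_le_between; exact Hs.
    - rewrite !Supp', Rminus_diag, Rabs_R0 by exact Hs. apply Rmult_le_pos; assumption. }
  assert (forall phi p q s, Rabs (W phi p s - W phi q s) <= line_sol_lip N B * (3 * K * Rabs (p - q))) as Lp.
  { intros phi p q s. pose proof (Rabs_pos (p - q)). assert (0 <= K * Rabs (p - q)) by (apply Rmult_le_pos; assumption).
    apply Cmp'; [lra | |].
    - intros t _. eapply Rle_trans; [apply Ha|]. rewrite line_pt_lip_p. lra.
    - intros t _. eapply Rle_trans; [exact (proj2 (src_compare M m K f F1 F2 phi phi _ _ HK Hf H1 H2))|].
      rewrite line_pt_lip_p, Rminus_diag, Rabs_R0. lra. }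
  assert (0 <= B * line_sol_bd N B) by (apply Rmult_le_pos; assumption).
  assert (0 <= line_sol_lip N B * (3 * K)) by (apply Rmult_le_pos; lra).
  exists (m + line_sol_bd N B), (K + (B + B * line_sol_bd N B) + line_sol_lip N B * (3 * K)).
  split; [lra|]. split; [lra|]. split.
  - intros phi. split; [|split].
    + intros z w. change (transport_sol N a f F1 F2 phi z) with (W phi (snd (line_coord phi z)) (fst (line_coord phi z))).
      change (transport_sol N a f F1 F2 phi w) with (W phi (snd (line_coord phi w)) (fst (line_coord phi w))).
      pose proof (Rabs_fst_line_coord phi z w) as T1. pose proof (Rabs_snd_line_coord phi z w) as T2.
      set (p := snd (line_coord phi z)) in *. set (q := snd (line_coord phi w)) in *.
      set (s := fst (line_coord phi z)) in *. set (t := fst (line_coord phi w)) in *.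
      pose proof (Ls phi p s t) as E1. pose proof (Lp phi p q t) as E2.
      replace (W phi p s - W phi q t) with ((W phi p s - W phi p t) + (W phi p t - W phi q t)) by ring.
      eapply Rle_trans; [apply Rabs_triang|]. pose proof (Cmod_ge_0 (z - w)).
      assert ((B + B * line_sol_bd N B) * Rabs (s - t) <= (B + B * line_sol_bd N B) * Cmod (z - w)) by (apply Rmult_le_compat_l; lra).
      assert (line_sol_lip N B * (3 * K) * Rabs (p - q) <= line_sol_lip N B * (3 * K) * Cmod (z - w)) by (apply Rmult_le_compat_l; lra).
      assert (0 <= K * Cmod (z - w)) by (apply Rmult_le_pos; assumption). lra.
    + intros z. eapply Rle_trans; [apply (BW phi)|]. lra.
    + intros z Hz. apply (Supp phi). rewrite <- surjective_pairing, Cmod_line_coord. exact Hz.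
  - intros z phi. set (X := Cmod z).
    assert (0 <= X) as HX by apply Cmod_ge_0.
    (* Turning the line moves its points in the window by at most 2 (N + X) per unit of angle; the
       source has Lipschitz constant 3 K in the point and 2 m in the angle. *)
    set (d0 := 3 * K * (2 * (N + X)) + 2 * m).
    assert (0 <= d0) as Hd0 by (unfold d0; assert (0 <= K * (N + X)) by (apply Rmult_le_pos; lra); lra).
    apply (continuous_of_local_lip _ _ ((B + B * line_sol_bd N B) * (2 * X) + line_sol_lip N B * (3 * K) * (2 * X) + line_sol_lip N B * d0)).
    { assert (0 <= line_sol_lip N B * d0) by (apply Rmult_le_pos; assumption).
      assert (0 <= (B + B * line_sol_bd N B) * (2 * X)) by (apply Rmult_le_pos; lra).
      assert (0 <= line_sol_lip N B * (3 * K) * (2 * X)) by (apply Rmult_le_pos; lra). lra. }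
    intros psi _.
    change (transport_sol N a f F1 F2 psi z) with (W psi (snd (line_coord psi z)) (fst (line_coord psi z))).
    change (transport_sol N a f F1 F2 phi z) with (W phi (snd (line_coord phi z)) (fst (line_coord phi z))).
    pose proof (line_coord_lip_phi psi phi z) as T. fold X in T.
    pose proof (fst_le_Cmod (line_coord psi z - line_coord phi z)) as T1.
    pose proof (snd_le_Cmod (line_coord psi z - line_coord phi z)) as T2.
    change (fst (line_coord psi z - line_coord phi z)%C) with (fst (line_coord psi z) - fst (line_coord phi z)) in T1.
    change (snd (line_coord psi z - line_coord phi z)%C) with (snd (line_coord psi z) - snd (line_coord phi z)) in T2.
    pose proof (snd_le_Cmod (line_coord phi z)) as T3. rewrite Cmod_line_coord in T3. fold X in T3.
    set (p := snd (line_coord psi z)) in *. set (q := snd (line_coord phi z)) in *.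
    set (s := fst (line_coord psi z)) in *. set (t := fst (line_coord phi z)) in *.
    (* Arc length, offset and direction are changed one at a time. *)
    replace (W psi p s - W phi q t) with ((W psi p s - W psi p t) + (W psi p t - W psi q t) + (W psi q t - W phi q t)) by ring.
    eapply Rle_trans; [apply Rabs_triang|]. eapply Rle_trans; [apply Rplus_le_compat_r, Rabs_triang|].
    pose proof (Ls psi p s t) as E1. pose proof (Lp psi p q t) as E2.
    pose proof (Rabs_pos (psi - phi)) as Hpp.
    assert (Rabs (W psi q t - W phi q t) <= line_sol_lip N B * (d0 * Rabs (psi - phi))) as E3.
    { assert (forall x, - N <= x <= N -> Cmod (line_pt psi q x - line_pt phi q x) <= 2 * (N + X) * Rabs (psi - phi)) as Dl.
      { intros x Hx. eapply Rle_trans; [apply line_pt_lip_phi|]. apply Rmult_le_compat_r; [exact Hpp|].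
        assert (Rabs x <= N) by (apply Rabs_le; lra). lra. }
      assert (0 <= m * Rabs (psi - phi)) by (apply Rmult_le_pos; assumption).
      assert (0 <= K * (2 * (N + X) * Rabs (psi - phi))) by (repeat apply Rmult_le_pos; lra).
      apply Cmp'.
      - apply Rmult_le_pos; assumption.
      - intros x Hx. eapply Rle_trans; [apply Ha|]. specialize (Dl x Hx).
        apply Rle_trans with (K * (2 * (N + X) * Rabs (psi - phi))); [apply Rmult_le_compat_l; assumption|].
        unfold d0. lra.
      - intros x Hx. eapply Rle_trans; [exact (proj2 (src_compare M m K f F1 F2 psi phi _ _ HK Hf H1 H2))|].
        specialize (Dl x Hx).
        assert (K * Cmod (line_pt psi q x - line_pt phi q x) <= K * (2 * (N + X) * Rabs (psi - phi))) by (apply Rmult_le_compat_l; assumption).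
        unfold d0. lra. }
    assert ((B + B * line_sol_bd N B) * Rabs (s - t) <= (B + B * line_sol_bd N B) * (2 * X * Rabs (psi - phi))) by (apply Rmult_le_compat_l; lra).
    assert (line_sol_lip N B * (3 * K) * Rabs (p - q) <= line_sol_lip N B * (3 * K) * (2 * X * Rabs (psi - phi))) by (apply Rmult_le_compat_l; lra).
    lra.
Qed.

Lemma isotropic_potential M m K N a f F1 F2 : 0 < M -> M < N -> 0 <= K ->
  lip_supported M m K a -> lip_supported M m K f -> lip_supported M m K F1 -> lip_supported M m K F2 -> lines_vanish N a f F1 F2 ->
  exists u0 : C -> R, forall z, Cmod z < M ->
    f z = a z * u0 z /\
    derivable_pt_lim (fun t => u0 (z + (t, 0%R))%C) 0 (- F1 z) /\
    derivable_pt_lim (fun t => u0 (z + (0%R, t))%C) 0 (- F2 z).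
Proof.
  intros HM HN HK Ha Hf H1 H2 HD.
  destruct (transport_sol_estimates M m K N a f F1 F2 HM HN HK Ha Hf H1 H2 HD) as [m' [K' [Hm' [HK' [Hu Hc]]]]].
  set (u := transport_sol N a f F1 F2) in *. pose proof PI_RGT_0 as HPI.
  assert (forall phi x, derivable_pt_lim (fun t => u phi (x + RtoC t * expi phi)%C) 0
      (src f F1 F2 phi x - a x * u phi x)) as Htr by (intros; apply (transport_sol_derive M m K); assumption).
  assert (forall phi z, 0 <= phi < 2 * PI -> Cmod z <= M -> u phi z = u 0 z) as Iso.
  { intros phi z Hphi Hz.
    apply (transport_solution_isotropic M m' K' a f F1 F2 u); try (apply (lip_supported_weaken M m K)); auto; lra. }
  exists (u 0). intros z Hz.
  assert (forall phi, 0 <= phi < 2 * PI -> derivable_pt_lim (fun t => u 0 (z + RtoC t * expi phi)%C) 0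
      (src f F1 F2 phi z - a z * u 0 z)) as D.
  { intros phi Hphi. rewrite <- (Iso phi z Hphi) by lra.
    intros e He. destruct (Htr phi z e He) as [d Hd].
    (* A segment shorter than M - |z| stays in the disc where independence of the direction is
       known. *)
    assert (0 < Rmin d (M - Cmod z)) as Hmin by (apply Rmin_glb_lt; [apply cond_pos | lra]).
    exists (mkposreal _ Hmin). intros t Ht0 Ht. simpl in Ht.
    assert (Rabs t < d) by (eapply Rlt_le_trans; [exact Ht | apply Rmin_l]).
    assert (Rabs t < M - Cmod z) by (eapply Rlt_le_trans; [exact Ht | apply Rmin_r]).
    specialize (Hd t Ht0 H).
    assert (forall s, Rabs s <= Rabs t -> Cmod (z + RtoC s * expi phi) <= M) as Bz.
    { intros s Hs. eapply Rle_trans; [apply Cmod_triangle|]. rewrite Cmod_mult, Cmod_expi, Cmod_R. lra. }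
    rewrite <- !(Iso phi) by (try exact Hphi; apply Bz; try rewrite Rplus_0_l; try rewrite Rabs_R0; try apply Rabs_pos; lra).
    exact Hd. }
  pose proof (D 0 ltac:(lra)) as D0. pose proof (D PI ltac:(lra)) as DP. pose proof (D (PI / 2) ltac:(lra)) as D2.
  unfold src in D0, DP, D2. rewrite cos_0, sin_0 in D0. rewrite cos_PI, sin_PI in DP. rewrite cos_PI2, sin_PI2 in D2.
  (* Derivatives of one function in the directions 0 and PI are opposite; comparing the two
     equations eliminates F1. *)
  assert (f z - (-1 * F1 z + 0 * F2 z) - a z * u 0 z = - (f z - (1 * F1 z + 0 * F2 z) - a z * u 0 z)) as E.
  { apply (uniqueness_limite (fun t => u 0 (z + RtoC t * expi PI)%C) 0); [exact DP|].
    assert (derivable_pt_lim (fun t => u 0 (z + RtoC t * expi 0)%C) (- 0)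
      (f z - (1 * F1 z + 0 * F2 z) - a z * u 0 z)) as D0' by (rewrite Ropp_0; exact D0).
    pose proof (derivable_pt_lim_comp (fun t => - t) (fun t => u 0 (z + RtoC t * expi 0)%C) 0 (-1) _
      (derivable_pt_lim_opp id 0 1 (derivable_pt_lim_id 0)) D0') as Dc.
    match type of Dc with derivable_pt_lim _ _ ?l => match goal with |- derivable_pt_lim _ _ ?l' =>
      replace l' with l by ring end end.
    eapply derivable_pt_lim_ext; [|exact Dc]. intros t. unfold comp. f_equal. f_equal.
    unfold expi. rewrite cos_PI, sin_PI, cos_0, sin_0. apply injective_projections; simpl; ring. }
  assert (f z = a z * u 0 z) as Ef by lra.
  split; [exact Ef|]. split.
  - replace (- F1 z) with (f z - (1 * F1 z + 0 * F2 z) - a z * u 0 z) by lra.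
    eapply derivable_pt_lim_ext; [|exact D0]. intros t. apply (f_equal (u 0)).
    rewrite expi_0. apply injective_projections; simpl; ring.
  - replace (- F2 z) with (f z - (0 * F1 z + 1 * F2 z) - a z * u 0 z) by lra.
    eapply derivable_pt_lim_ext; [|exact D2]. intros t. apply (f_equal (u 0)).
    unfold expi. rewrite cos_PI2, sin_PI2. apply injective_projections; simpl; ring.
Qed.

(** * Extension by zero and the boundary data *)

Lemma pnorm_Cmod (p : pt) : pnorm p = Cmod p.
Proof. reflexivity. Qed.

Lemma pdist_Cmod (p q : pt) : pdist p q = Cmod (Cminus p q).
Proof. reflexivity. Qed.

Definition openP (Om : pt -> Prop) : Prop :=
  forall p, Om p -> exists d, 0 < d /\ forall q : pt, Cmod (Cminus q p) < d -> Om q.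

Lemma sublevel_open Om (rho : pt -> R) : cont2 rho -> (forall p, Om p <-> rho p < 0) -> openP Om.
Proof.
  intros Hc Hr p Hp. apply Hr in Hp. destruct (Hc p (- rho p)) as [d [Hd H]]; [lra|].
  exists d. split; [exact Hd|]. intros q Hq. apply Hr.
  rewrite Cmod_minus_sym, <- pdist_Cmod in Hq. specialize (H q Hq). apply Rabs_def2 in H. lra.
Qed.

Lemma incl_closure Om p : Om p -> Defs.closure Om p.
Proof.
  intros H eps He. exists p. split; [exact H|]. rewrite pdist_Cmod.
  replace (Cminus p p) with (RtoC 0) by (apply injective_projections; simpl; ring).
  rewrite Cmod_0. exact He.
Qed.

Lemma closure_bound Om M p : (forall p, Om p -> Cmod p <= M) -> Defs.closure Om p -> Cmod p <= M.
Proof.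
  intros HM Hp. apply le_epsilon. intros e He. destruct (Hp e He) as [q [Hq Hd]].
  specialize (HM q Hq). rewrite pdist_Cmod in Hd. pose proof (Cmod_sub_ge p q). lra.
Qed.

(** * Lipschitz bounds for functions extended by zero *)

(** The mean value theorem applies up to the point where [O] is left. There and at t the function
    vanishes, so nothing is added beyond the exit. *)
Lemma interval_exit (h : R -> R) (O : R -> Prop) G s t : s < t -> 0 <= G ->
  (forall x, continuity_pt h x) ->
  (forall x, O x -> exists d, 0 < d /\ forall y, Rabs (y - x) < d -> O y) ->
  (forall x y z, O x -> O z -> x < y < z -> O y) ->
  (forall x, ~ O x -> h x = 0) ->
  (forall x, O x -> exists l, derivable_pt_lim h x l /\ Rabs l <= G) ->
  O s -> Rabs (h s - h t) <= G * (t - s).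
Proof.
  intros Hst HG Hc Ho Hconv H0 Hd Os.
  assert (forall c, s < c -> (forall x, s < x < c -> O x) -> Rabs (h s - h c) <= G * (c - s)) as MV.
  { intros c Hsc Hin.
    (* The default 0 off [O] keeps the bound by [G] valid at whichever point the mean value theorem
       returns. *)
    pose (df := fun x => match excluded_middle_informative (O x) with
      | left o => proj1_sig (constructive_indefinite_description _ (Hd x o)) | right _ => 0 end).
    assert (forall x, O x -> derivable_pt_lim h x (df x)) as Hdf.
    { intros x o. unfold df. destruct (excluded_middle_informative (O x)) as [o'|n]; [|contradiction].
      destruct (constructive_indefinite_description _ (Hd x o')) as [l [Hl Bl]]. exact Hl. }
    assert (forall x, Rabs (df x) <= G) as Bdf.
    { intros x. unfold df. destruct (excluded_middle_informative (O x)) as [o'|n].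
      - destruct (constructive_indefinite_description _ (Hd x o')) as [l [Hl Bl]]. exact Bl.
      - rewrite Rabs_R0. exact HG. }
    destruct (MVT_gen h s c df) as [x [_ E]].
    - intros x Hx. rewrite Rmin_left, Rmax_right in Hx by lra. apply is_derive_Reals, Hdf, Hin, Hx.
    - intros; apply Hc.
    - rewrite Rabs_minus_sym, E, Rabs_mult, (Rabs_pos_eq (c - s)) by lra.
      apply Rmult_le_compat_r; [lra | apply Bdf]. }
  destruct (classic (O t)) as [Ot|Nt].
  - apply MV; [exact Hst|]. intros x Hx. exact (Hconv s x t Os Ot Hx).
  (* c is the supremum of [O] in [s, t]. It is not in [O]: otherwise c < t, and openness would give
     larger points. *)
  - destruct (completeness (fun x => s <= x <= t /\ O x)) as [c [Hub Hlub]].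
    { exists t. intros x [Hx _]. lra. }
    { exists s. split; [lra | exact Os]. }
    assert (s <= c) by (apply Hub; split; [lra | exact Os]).
    assert (c <= t) by (apply Hlub; intros x [Hx _]; lra).
    assert (forall x, s < x < c -> O x) as Hin.
    { intros x Hx. destruct (classic (exists y, x < y /\ s <= y <= t /\ O y)) as [[y [Hxy [Hy Oy]]]|N].
      - apply (Hconv s x y); auto. lra.
      - exfalso. assert (c <= x); [|lra]. apply Hlub. intros y [Hy Oy].
        apply Rnot_lt_le. intros L. apply N. exists y. auto. }
    assert (~ O c) as Nc.
    { intros Oc. destruct (Ho c Oc) as [d [Hdp Hball]].
      assert (c < t) by (destruct (Rle_lt_or_eq_dec c t H1) as [L|e]; [exact L | subst; contradiction]).
      set (y := Rmin (c + d / 2) t). assert (c < y) by (apply Rmin_glb_lt; lra).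
      assert (y <= c + d / 2) by apply Rmin_l. assert (y <= t) by apply Rmin_r.
      assert (y <= c); [|lra]. apply Hub. split; [lra|]. apply Hball. rewrite Rabs_pos_eq; lra. }
    assert (s < c) by (destruct (Rle_lt_or_eq_dec s c H) as [L|e]; [exact L | subst; contradiction]).
    specialize (MV c H2 Hin). rewrite (H0 t Nt). rewrite (H0 c Nc) in MV.
    eapply Rle_trans; [exact MV|]. apply Rmult_le_compat_l; lra.
Qed.

Lemma interval_lip (h : R -> R) (O : R -> Prop) G s t : 0 <= G ->
  (forall x, continuity_pt h x) ->
  (forall x, O x -> exists d, 0 < d /\ forall y, Rabs (y - x) < d -> O y) ->
  (forall x y z, O x -> O z -> x < y < z -> O y) ->
  (forall x, ~ O x -> h x = 0) ->
  (forall x, O x -> exists l, derivable_pt_lim h x l /\ Rabs l <= G) ->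
  Rabs (h s - h t) <= G * Rabs (s - t).
Proof.
  intros HG Hc Ho Hconv H0 Hd.
  assert (forall s t, s < t -> Rabs (h s - h t) <= G * (t - s)) as W.
  { clear s t. intros s t Hst. destruct (classic (O s)) as [Os|Ns].
    - apply (interval_exit h O); assumption.
    - destruct (classic (O t)) as [Ot|Nt].
      (* Leaving [O] to the left becomes leaving it to the right after reflection. *)
      + pose proof (interval_exit (fun x => h (- x)) (fun x => O (- x)) G (- t) (- s)) as R0.
        cbv beta in R0. rewrite !Ropp_involutive in R0. rewrite Rabs_minus_sym.
        replace (t - s) with (- s - - t) by ring. apply R0; auto; try lra.
        * intros x. apply (continuity_pt_comp (fun x => - x) h); [|apply Hc].
          apply derivable_continuous_pt. exists (- (1)). apply (derivable_pt_lim_opp id). apply derivable_pt_lim_id.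
        * intros x Ox. destruct (Ho _ Ox) as [d [Hdp Hb]]. exists d. split; [exact Hdp|].
          intros y Hy. apply Hb. replace (- y - - x) with (- (y - x)) by ring. rewrite Rabs_Ropp. exact Hy.
        * intros x y z Ox Oz Hxyz. apply (Hconv (- z) (- y) (- x)); auto. lra.
        * intros x Ox. destruct (Hd _ Ox) as [l [Hl Bl]]. exists (l * - (1)). split.
          -- apply (derivable_pt_lim_comp (fun x => - x) h); [|exact Hl].
             apply (derivable_pt_lim_opp id). apply derivable_pt_lim_id.
          -- rewrite Rabs_mult, Rabs_Ropp, Rabs_R1. lra.
      + rewrite (H0 s Ns), (H0 t Nt), Rminus_diag, Rabs_R0. apply Rmult_le_pos; lra. }
  destruct (Rtotal_order s t) as [L|[e|L]].
  - rewrite (Rabs_minus_sym s t), (Rabs_pos_eq (t - s)) by lra. apply W; exact L.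
  - subst. rewrite !Rminus_diag, Rabs_R0. lra.
  - rewrite (Rabs_minus_sym (h s)), (Rabs_pos_eq (s - t)) by lra. apply W; exact L.
Qed.

(** [C1a0] compares points of the closure only; the other cases are settled by the zero values
    outside [Om]. *)
Lemma C1a0_continuous alpha Om (u : pt -> R) : openP Om -> C1a0 alpha Om u ->
  forall (p : pt) eps, 0 < eps -> exists d, 0 < d /\ forall q : pt, Cmod (Cminus q p) < d -> Rabs (u q - u p) < eps.
Proof.
  intros Ho [H0 [Hc _]] p eps He.
  destruct (classic (Defs.closure Om p)) as [Cp|Np].
  - destruct (Hc p Cp eps He) as [d [Hd H]].
    destruct (classic (Om p)) as [Op|Nop].
    + destruct (Ho p Op) as [d' [Hd' H']]. exists (Rmin d d'). split; [apply Rmin_glb_lt; assumption|].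
      intros q Hq. apply H.
      * apply incl_closure, H'. eapply Rlt_le_trans; [exact Hq | apply Rmin_r].
      * rewrite pdist_Cmod, Cmod_minus_sym. eapply Rlt_le_trans; [exact Hq | apply Rmin_l].
    + exists d. split; [exact Hd|]. intros q Hq. destruct (classic (Defs.closure Om q)) as [Cq|Nq].
      * apply H; [exact Cq|]. rewrite pdist_Cmod, Cmod_minus_sym. exact Hq.
      * rewrite (H0 p Nop), (H0 q), Rminus_diag, Rabs_R0; [exact He|]. intros Oq. apply Nq, incl_closure, Oq.
  - apply not_all_ex_not in Np. destruct Np as [e Ne]. apply imply_to_and in Ne. destruct Ne as [Hep Ne].
    exists e. split; [exact Hep|]. intros q Hq.
    rewrite (H0 p), (H0 q), Rminus_diag, Rabs_R0; [exact He | |].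
    + intros Oq. apply Ne. exists q. split; [exact Oq|]. rewrite pdist_Cmod, Cmod_minus_sym. exact Hq.
    + intros Op. apply Ne. exists p. split; [exact Op|]. rewrite pdist_Cmod.
      replace (Cminus p p) with (RtoC 0) by (apply injective_projections; simpl; ring). rewrite Cmod_0. exact Hep.
Qed.

Lemma hpow_bound x al M : 0 < al -> 0 < M -> x <= M -> 0 <= hpow x al <= Rpower M al.
Proof.
  intros Hal HM Hx. unfold hpow. assert (0 < Rpower M al) by apply exp_pos.
  destruct (Rle_dec x 0); [lra|]. split; [left; apply exp_pos|]. apply Rle_Rpower_l; lra.
Qed.

Lemma Cmod_diff_row (x x' y : R) : Cmod (Cminus (x, y) (x', y)) = Rabs (x - x').
Proof.
  rewrite <- Cmod_real. f_equal. apply injective_projections; simpl; ring.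
Qed.
Lemma Cmod_diff_col (x y y' : R) : Cmod (Cminus (x, y) (x, y')) = Rabs (y - y').
Proof.
  rewrite <- Cmod_imag. f_equal. apply injective_projections; simpl; ring.
Qed.

(** On a bounded set the Hoelder condition bounds the gradient. By convexity each coordinate line
    meets [Om] in an interval, so [interval_lip] applies on it, and a path of two coordinate
    segments costs the factor 2. *)
Lemma C1a0_lip_supported alpha Om M (u : pt -> R) : 0 < alpha -> 0 < M -> openP Om ->
  (exists p, Om p) -> (forall p, Om p -> Cmod p <= M) ->
  (forall p q, Om p -> Om q -> forall s, 0 < s < 1 -> Om (padd (pscal (1 - s) p) (pscal s q))) ->
  C1a0 alpha Om u -> exists m K, 0 <= m /\ 0 <= K /\ lip_supported M m K u.
Proof.
  intros Hal HM Ho [p0 Hp0] Hb Hconv Hu.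
  pose proof (C1a0_continuous alpha Om u Ho Hu) as Hcont.
  destruct Hu as [H0 [_ [d1 [d2 [C0 [D1 [D2 HH]]]]]]].
  set (G := Rabs (d1 p0) + Rabs (d2 p0) + Rabs C0 * Rpower (2 * M) alpha).
  assert (0 < Rpower (2 * M) alpha) as HR by apply exp_pos.
  assert (0 <= Rabs C0 * Rpower (2 * M) alpha) by (apply Rmult_le_pos; [apply Rabs_pos | lra]).
  pose proof (Rabs_pos (d1 p0)). pose proof (Rabs_pos (d2 p0)).
  assert (0 <= G) as HG by (unfold G; lra).
  assert (forall p, Om p -> Rabs (d1 p) <= G /\ Rabs (d2 p) <= G) as BG.
  { intros p Hp. destruct (HH p p0 Hp Hp0) as [E1 E2].
    assert (pdist p p0 <= 2 * M) as Hdist.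
    { rewrite pdist_Cmod. eapply Rle_trans; [apply Cmod_triangle_minus|]. pose proof (Hb p Hp). pose proof (Hb p0 Hp0). lra. }
    destruct (hpow_bound _ alpha (2 * M) Hal ltac:(lra) Hdist) as [h0 h1].
    assert (C0 * hpow (pdist p p0) alpha <= Rabs C0 * Rpower (2 * M) alpha) as Hh.
    { eapply Rle_trans; [apply Rmult_le_compat_r; [exact h0 | apply Rle_abs]|].
      apply Rmult_le_compat_l; [apply Rabs_pos | exact h1]. }
    unfold G. split.
    - replace (d1 p) with (d1 p0 + (d1 p - d1 p0)) by ring. eapply Rle_trans; [apply Rabs_triang|]. lra.
    - replace (d2 p) with (d2 p0 + (d2 p - d2 p0)) by ring. eapply Rle_trans; [apply Rabs_triang|]. lra. }
  assert (forall x x' y, Rabs (u (x, y) - u (x', y)) <= G * Rabs (x - x')) as Row.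
  { intros x x' y. apply (interval_lip (fun t => u (t, y)) (fun t => Om (t, y))); auto.
    - intros t. apply continuity_pt_filterlim, continuous_eps. intros e He.
      destruct (Hcont (t, y) e He) as [d [Hd Hc]]. exists d. split; [exact Hd|].
      intros s Hs. apply Hc. rewrite Cmod_diff_row. exact Hs.
    - intros t Ot. destruct (Ho _ Ot) as [d [Hd Hball]]. exists d. split; [exact Hd|].
      intros s Hs. apply Hball. rewrite Cmod_diff_row. exact Hs.
    - intros r s t Or Ot Hrst.
      pose proof (Hconv _ _ Or Ot ((s - r) / (t - r))) as Hc.
      replace ((s, y)) with (padd (pscal (1 - (s - r) / (t - r)) (r, y)) (pscal ((s - r) / (t - r)) (t, y)))
        by (unfold padd, pscal; simpl; f_equal; field; lra).
      apply Hc. split; [apply Rdiv_lt_0_compat; lra|].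
      apply Rmult_lt_reg_r with (t - r); [lra|]. unfold Rdiv. rewrite Rmult_assoc, Rinv_l by lra. lra.
    - intros t Ot. exists (d1 (t, y)). split; [apply (D1 (t, y) Ot) | apply (BG _ Ot)]. }
  assert (forall x y y', Rabs (u (x, y) - u (x, y')) <= G * Rabs (y - y')) as Col.
  { intros x y y'. apply (interval_lip (fun t => u (x, t)) (fun t => Om (x, t))); auto.
    - intros t. apply continuity_pt_filterlim, continuous_eps. intros e He.
      destruct (Hcont (x, t) e He) as [d [Hd Hc]]. exists d. split; [exact Hd|].
      intros s Hs. apply Hc. rewrite Cmod_diff_col. exact Hs.
    - intros t Ot. destruct (Ho _ Ot) as [d [Hd Hball]]. exists d. split; [exact Hd|].
      intros s Hs. apply Hball. rewrite Cmod_diff_col. exact Hs.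
    - intros r s t Or Ot Hrst.
      pose proof (Hconv _ _ Or Ot ((s - r) / (t - r))) as Hc.
      replace ((x, s)) with (padd (pscal (1 - (s - r) / (t - r)) (x, r)) (pscal ((s - r) / (t - r)) (x, t)))
        by (unfold padd, pscal; simpl; f_equal; field; lra).
      apply Hc. split; [apply Rdiv_lt_0_compat; lra|].
      apply Rmult_lt_reg_r with (t - r); [lra|]. unfold Rdiv. rewrite Rmult_assoc, Rinv_l by lra. lra.
    - intros t Ot. exists (d2 (x, t)). split; [apply (D2 (x, t) Ot) | apply (BG _ Ot)]. }
  assert (forall z, M < Cmod z -> u z = 0) as Z.
  { intros z Hz. apply H0. intros Oz. pose proof (Hb z Oz). lra. }
  assert (LipCR (2 * G) u) as HL.
  { intros [x y] [x' y'].
    replace (u (x, y) - u (x', y')) with ((u (x, y) - u (x', y)) + (u (x', y) - u (x', y'))) by ring.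
    eapply Rle_trans; [apply Rabs_triang|].
    pose proof (Row x x' y). pose proof (Col x' y y').
    pose proof (fst_le_Cmod ((x, y) - (x', y'))%C) as T1. pose proof (snd_le_Cmod ((x, y) - (x', y'))%C) as T2.
    simpl in T1, T2. fold (x - x') in T1. fold (y - y') in T2.
    assert (G * Rabs (x - x') <= G * Cmod ((x, y) - (x', y'))) by (apply Rmult_le_compat_l; assumption).
    assert (G * Rabs (y - y') <= G * Cmod ((x, y) - (x', y'))) by (apply Rmult_le_compat_l; assumption).
    lra. }
  exists (2 * G * (3 * M)), (2 * G). split; [nra|]. split; [lra|]. split; [exact HL|]. split; [|exact Z].
  intros z. destruct (Rle_lt_dec (Cmod z) M) as [Hz|Hz].
  (* The point 2 M lies off the support and within 3 M of z, so the Lipschitz bound yields a sup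
     bound. *)
  - assert (u (RtoC (2 * M)) = 0) as Zw by (apply Z; rewrite Cmod_R, Rabs_pos_eq; lra).
    rewrite <- (Rminus_0_r (u z)), <- Zw. eapply Rle_trans; [apply HL|].
    apply Rmult_le_compat_l; [lra|]. eapply Rle_trans; [apply Cmod_triangle_minus|].
    rewrite Cmod_R, Rabs_pos_eq; lra.
  - rewrite (Z z Hz), Rabs_R0. nra.
Qed.

(** * From the boundary data to vanishing line integrals *)

(** [tau] is chosen by [epsilon], so a largest admissible time must be exhibited: the supremum,
    finite because [Om] is bounded and attained because the closure is closed. *)
Lemma tau_spec Om M (x v : pt) : (forall p, Om p -> Cmod p <= M) -> Defs.closure Om x -> Cmod v = 1 ->
  0 <= tau Om x v /\ Defs.closure Om (padd x (pscal (tau Om x v) v)) /\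
  forall s, 0 <= s -> Defs.closure Om (padd x (pscal s v)) -> s <= tau Om x v.
Proof.
  intros HM Hx Hv. unfold tau. apply epsilon_spec.
  assert (forall s, padd x (pscal s v) = (x + RtoC s * v)%C) as E.
  { intros s. apply injective_projections; simpl; ring. }
  assert (padd x (pscal 0 v) = x) as E0 by (apply injective_projections; simpl; ring).
  destruct (completeness (fun t => 0 <= t /\ Defs.closure Om (padd x (pscal t v)))) as [T [Hub Hlub]].
  - exists (2 * M). intros t [Ht Ct]. apply (closure_bound Om M _ HM) in Ct. rewrite E in Ct.
    pose proof (closure_bound Om M _ HM Hx) as Bx.
    pose proof (Cmod_sub_ge (RtoC t * v) (- x)) as S0. rewrite Cmod_opp in S0.
    replace (RtoC t * v - - x)%C with (x + RtoC t * v)%C in S0 by ring.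
    rewrite Cmod_mult, Hv, Cmod_R, Rabs_pos_eq in S0 by exact Ht. lra.
  - exists 0. split; [lra | rewrite E0; exact Hx].
  - exists T. assert (0 <= T) as HT by (apply Hub; split; [lra | rewrite E0; exact Hx]).
    split; [exact HT|]. split; [|intros s Hs Cs; apply Hub; split; assumption].
    intros e He.
    destruct (classic (exists t, T - e / 2 < t /\ 0 <= t /\ Defs.closure Om (padd x (pscal t v)))) as [[t [Ht [Ht0 Ct]]]|N].
    + assert (t <= T) by (apply Hub; split; assumption).
      destruct (Ct (e / 2)) as [q [Oq Hq]]; [lra|]. exists q. split; [exact Oq|].
      rewrite pdist_Cmod in *. eapply Rle_lt_trans; [apply (Cmod_dist_triangle _ (padd x (pscal t v)))|].
      assert (Cmod (Cminus (padd x (pscal T v)) (padd x (pscal t v))) = T - t) as ->; [|lra].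
      rewrite !E. replace (x + RtoC T * v - (x + RtoC t * v))%C with (RtoC (T - t) * v)%C by (rewrite RtoC_minus; ring).
      rewrite Cmod_mult, Hv, Cmod_R, Rabs_pos_eq; lra.
    + exfalso. assert (T <= T - e / 2); [|lra]. apply Hlub. intros t [Ht Ct]. apply Rnot_lt_le. intros L.
      apply N. exists t. auto.
Qed.

Lemma Rint_RInt (h : R -> R) u v : (forall t, continuous h t) -> Rint h u v = RInt h u v.
Proof.
  intros Hc. unfold Rint. destruct (excluded_middle_informative _) as [H|H].
  - symmetry. apply RInt_Reals.
  - exfalso. apply H. constructor. apply ex_RInt_Reals_0. apply ex_RInt_cont, Hc.
Qed.

(** For integrands of compact support the partial integrals become stationary, and the limit
    selected by [epsilon] can be read off by uniqueness. *)
Lemma Rint0inf_eq (h : R -> R) N L : (forall T, N <= T -> Rint h 0 T = L) -> Rint0inf h = L.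
Proof.
  intros H. unfold Rint0inf.
  set (P := fun L => forall eps, 0 < eps -> exists T0, forall T, T0 <= T -> Rabs (Rint h 0 T - L) < eps).
  assert (P L) as HP.
  { intros e He. exists N. intros T HT. rewrite H, Rminus_diag, Rabs_R0 by exact HT. exact He. }
  pose proof (epsilon_spec (inhabits 0) P (ex_intro _ L HP)) as Q. set (l := epsilon (inhabits 0) P) in *.
  apply cond_eq. intros e He. destruct (Q e He) as [T0 HT].
  rewrite Rabs_minus_sym, <- (H (Rmax N T0)) by apply Rmax_l. apply HT, Rmax_r.
Qed.

Lemma line_pt_shift phi p s t : padd (line_pt phi p s) (pscal t (dir phi)) = line_pt phi p (s + t).
Proof. unfold line_pt, expi. apply injective_projections; simpl; ring. Qed.

Lemma RInt_shift (h : R -> R) s u v : (forall t, continuous h t) ->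
  RInt (fun t => h (s + t)) u v = RInt h (s + u) (s + v).
Proof.
  intros Hc. pose proof (RInt_comp_lin (V := R_CompleteNormedModule) h 1 s u v) as E.
  rewrite !Rmult_1_l, (Rplus_comm u), (Rplus_comm v) in E. rewrite <- E by auto with cint.
  apply RInt_ext. intros t _. change (h (s + t) = 1 * h (1 * t + s)). rewrite !Rmult_1_l, Rplus_comm. reflexivity.
Qed.

Lemma continuous_shift (h : R -> R) s : (forall t, continuous h t) -> forall t, continuous (fun t => h (s + t)) t.
Proof.
  intros Hc t. apply (continuous_comp (fun t => s + t) h); [|apply Hc].
  apply (continuous_plus (V := R_NormedModule)); [apply continuous_const | apply continuous_id].
Qed.

(** Beyond arc length N the attenuation vanishes, so the integral to infinity is a difference of two
    values of [att]. *)
Lemma Dtr_line_pt M m K N a phi p s : 0 <= K -> M < N -> lip_supported M m K a ->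
  Dtr a (line_pt phi p s) phi = att N (fun s => a (line_pt phi p s)) N - att N (fun s => a (line_pt phi p s)) s.
Proof.
  intros HK HN Ha. set (al := fun s => a (line_pt phi p s)).
  pose proof (line_pt_continuous M m K a phi p HK Ha) as Hc. fold al in Hc.
  unfold Dtr. apply (Rint0inf_eq _ (N - s)). intros T HT.
  replace (fun t => a (padd (line_pt phi p s) (pscal t (dir phi)))) with (fun t => al (s + t))
    by (apply functional_extensionality; intros t; unfold al; rewrite line_pt_shift; reflexivity).
  rewrite Rint_RInt by (apply continuous_shift, Hc).
  rewrite RInt_shift, Rplus_0_r by exact Hc.
  assert (forall u v w, RInt al u v + RInt al v w = RInt al u w) as Ch
    by (intros; apply (RInt_Chasles (V := R_CompleteNormedModule)); auto with cint).
  unfold att. pose proof (Ch (- N) s (s + T)). pose proof (Ch (- N) N (s + T)).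
  assert (RInt al N (s + T) = 0); [|lra]. apply RInt_zero_fun. intros t Ht.
  rewrite Rmin_left in Ht by lra. apply (proj2 (proj2 Ha)). rewrite Cmod_line_pt.
  pose proof (fst_le_Cmod (t, p)) as F. simpl in F. pose proof (Rle_abs t). lra.
Qed.

(** Both identities have the same left-hand side, so [g] drops out. The weight e^{-Da} is exp of
    [att] times a positive constant of the line, which cancels. *)
Lemma data_lines_vanish Om M m K N a f F1 F2 g : 0 <= K -> M < N ->
  (forall p, Om p -> Cmod p <= M) ->
  (forall p, ~ Om p -> f p = 0) -> (forall p, ~ Om p -> F1 p = 0) -> (forall p, ~ Om p -> F2 p = 0) ->
  lip_supported M m K a -> lip_supported M m K f -> lip_supported M m K F1 -> lip_supported M m K F2 ->
  in_Da Om a F1 F2 g -> in_Ra Om a f g -> lines_vanish N a f F1 F2.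
Proof.
  intros HK HN Hb Zf Z1 Z2 Ha Hf H1 H2 HD HR phi p.
  assert (forall z, ~ Om z -> src f F1 F2 phi z = 0) as Zs.
  { intros z Hz. unfold src. rewrite Zf, Z1, Z2 by exact Hz. ring. }
  (* The data are used at a point of [Om] on the line; a line that misses [Om] carries no source. *)
  destruct (classic (exists s, Om (line_pt phi p s))) as [[s0 Os]|No].
  2: { apply RInt_zero_fun. intros t _. rewrite Zs; [ring|]. intros Ot. apply No. exists t. exact Ot. }
  set (al := fun s => a (line_pt phi p s)).
  set (h := fun s => src f F1 F2 phi (line_pt phi p s) * exp (att N al s)).
  pose proof (line_pt_continuous M m K a phi p HK Ha) as Ca. fold al in Ca.
  assert (forall (q : C -> R), (forall t, continuous (fun s => q (line_pt phi p s)) t) -> forall t,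
     continuous (fun s => q (line_pt phi p s) * exp (att N al s)) t) as Cq.
  { intros q Hq. exact (line_sol_integrand_continuous N al (fun s => q (line_pt phi p s)) Ca Hq). }
  assert (forall t, continuous h t) as Ch by (apply Cq, (line_src_continuous M m K); assumption).
  assert (Defs.closure Om (line_pt phi p s0)) as Cx by (apply incl_closure; exact Os).
  set (tp := tau_plus Om (line_pt phi p s0) phi). set (tm := tau_minus Om (line_pt phi p s0) phi).
  assert (Cmod (dir phi) = 1) as Ed by exact (Cmod_expi phi).
  assert (Cmod (pscal (-1) (dir phi)) = 1) as Ed'.
  { replace (pscal (-1) (dir phi)) with (- expi phi)%C by (apply injective_projections; simpl; ring).
    rewrite Cmod_opp. apply Cmod_expi. }
  destruct (tau_spec Om M _ _ Hb Cx Ed) as [Tp0 [_ Tp]]. fold (tau_plus Om (line_pt phi p s0) phi) in Tp0, Tp. fold tp in Tp0, Tp.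
  destruct (tau_spec Om M _ _ Hb Cx Ed') as [Tm0 [_ Tm]]. fold (tau_minus Om (line_pt phi p s0) phi) in Tm0, Tm. fold tm in Tm0, Tm.
  assert (forall s, s0 + tp < s -> h s = 0) as Zp.
  { intros s Hs. unfold h. rewrite Zs; [ring|]. intros Oz.
    specialize (Tp (s - s0)). rewrite line_pt_shift in Tp. replace (s0 + (s - s0)) with s in Tp by ring.
    assert (s - s0 <= tp); [|lra]. apply Tp; [lra | apply incl_closure; exact Oz]. }
  assert (forall s, s < s0 - tm -> h s = 0) as Zm.
  { intros s Hs. unfold h. rewrite Zs; [ring|]. intros Oz.
    specialize (Tm (s0 - s)).
    replace (padd (line_pt phi p s0) (pscal (s0 - s) (pscal (-1) (dir phi)))) with (line_pt phi p s) in Tm.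
    - assert (s0 - s <= tm); [|lra]. apply Tm; [lra | apply incl_closure; exact Oz].
    - replace s with (s0 + (s - s0)) at 1 by ring. rewrite <- line_pt_shift.
      apply injective_projections; simpl; ring. }
  assert (forall q : C -> R, (forall t, continuous (fun s => q (line_pt phi p s)) t) ->
    Rint (fun t => q (padd (line_pt phi p s0) (pscal t (dir phi))) * exp (- Dtr a (padd (line_pt phi p s0) (pscal t (dir phi))) phi)) (- tm) tp
    = exp (- att N al N) * RInt (fun s => q (line_pt phi p s) * exp (att N al s)) (s0 - tm) (s0 + tp)) as EQ.
  { intros q Hq. set (k := fun s => exp (- att N al N) * (q (line_pt phi p s) * exp (att N al s))).
    assert (forall t, continuous k t) as Ck0.
    { intros t. apply (continuous_mult (K := R_AbsRing)); [apply continuous_const | apply Cq, Hq]. }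
    replace (fun t => q (padd (line_pt phi p s0) (pscal t (dir phi))) * exp (- Dtr a (padd (line_pt phi p s0) (pscal t (dir phi))) phi))
      with (fun t => k (s0 + t)).
    - rewrite Rint_RInt by (apply continuous_shift, Ck0). rewrite RInt_shift by exact Ck0.
      apply (RInt_scal (V := R_CompleteNormedModule) (fun s => q (line_pt phi p s) * exp (att N al s))).
      apply ex_RInt_cont, Cq, Hq.
    - apply functional_extensionality. intros t. rewrite line_pt_shift, (Dtr_line_pt M m K N a phi p (s0 + t) HK HN Ha).
      fold al. unfold k. replace (- (att N al N - att N al (s0 + t))) with (- att N al N + att N al (s0 + t)) by ring.
      rewrite exp_plus. ring. }
  pose proof (HD _ phi Cx) as E1. pose proof (HR _ phi Cx) as E2.
  rewrite E1 in E2. fold tp tm in E2.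
  assert (forall t, continuous (fun s => f (line_pt phi p s)) t) as Cf by exact (line_pt_continuous M m K f phi p HK Hf).
  assert (forall t, continuous (fun s => cos phi * F1 (line_pt phi p s) + sin phi * F2 (line_pt phi p s)) t) as CF.
  { intros t. apply (continuous_plus (V := R_NormedModule)); apply (continuous_mult (K := R_AbsRing));
    try apply continuous_const; [exact (line_pt_continuous M m K F1 phi p HK H1 t) | exact (line_pt_continuous M m K F2 phi p HK H2 t)]. }
  pose proof (EQ f Cf) as Ef. pose proof (EQ (fun z => cos phi * F1 z + sin phi * F2 z) CF) as EF.
  cbv beta in EF. rewrite EF, Ef in E2. apply Rmult_eq_reg_l in E2; [|apply Rgt_not_eq, exp_pos].
  assert (RInt h (s0 - tm) (s0 + tp) = 0) as I0.
  { replace h with (fun s => f (line_pt phi p s) * exp (att N al s)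
       - (cos phi * F1 (line_pt phi p s) + sin phi * F2 (line_pt phi p s)) * exp (att N al s))
      by (apply functional_extensionality; intros t; unfold h, src; ring).
    pose proof (RInt_minus (V := R_CompleteNormedModule) (fun s => f (line_pt phi p s) * exp (att N al s))
       (fun s => (cos phi * F1 (line_pt phi p s) + sin phi * F2 (line_pt phi p s)) * exp (att N al s)) (s0 - tm) (s0 + tp)) as Em.
    eapply eq_trans; [apply Em|].
    - apply ex_RInt_cont, (Cq f Cf).
    - apply ex_RInt_cont, (Cq (fun z => cos phi * F1 z + sin phi * F2 z) CF).
    - rewrite E2. apply (minus_eq_zero (G := R_AbelianGroup)). }
  assert (forall u v w, RInt h u v + RInt h v w = RInt h u w) as Chas
    by (intros; apply (RInt_Chasles (V := R_CompleteNormedModule)); auto with cint).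
  assert (forall t, N <= Rabs t -> h t = 0) as Far.
  { intros t Ht. unfold h. rewrite Zs; [ring|]. intros Ot. apply Hb in Ot. rewrite Cmod_line_pt in Ot.
    pose proof (fst_le_Cmod (t, p)) as T. simpl in T. lra. }
  assert (forall t, t <= - N -> h t = 0) as FarL.
  { intros t Ht. apply Far. rewrite <- Rabs_Ropp. eapply Rle_trans; [|apply Rle_abs]. lra. }
  assert (forall t, N <= t -> h t = 0) as FarR.
  { intros t Ht. apply Far. eapply Rle_trans; [exact Ht | apply Rle_abs]. }
  (* Outside the chord the source is zero, so the integral extends to [-N, N]; the two cases avoid
     locating the ends of the chord relative to -N and N. *)
  assert (RInt h (- N) (s0 - tm) = 0) as IL.
  { rewrite (RInt_ext (V := R_CompleteNormedModule) h (fun _ => 0)); [rewrite RInt_const; apply Rmult_0_r|].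
    intros t Ht. unfold Rmin, Rmax in Ht. destruct (Rle_dec (- N) (s0 - tm)); [apply Zm | apply FarL]; lra. }
  assert (RInt h (s0 + tp) N = 0) as IR.
  { rewrite (RInt_ext (V := R_CompleteNormedModule) h (fun _ => 0)); [rewrite RInt_const; apply Rmult_0_r|].
    intros t Ht. unfold Rmin, Rmax in Ht. destruct (Rle_dec (s0 + tp) N); [apply Zp | apply FarR]; lra. }
  change (RInt h (- N) N = 0).
  assert (forall x y z v w : R, x + y = z -> v + w = y -> x = 0 -> v = 0 -> w = 0 -> z = 0) as Sum by (intros; lra).
  exact (Sum _ _ _ _ _ (Chas (- N) (s0 - tm) N) (Chas (s0 - tm) (s0 + tp) N) IL I0 IR).
Qed.

Theorem mainTheorem8 (Om : pt -> Prop) (alpha : R) (a f F1 F2 : pt -> R)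
  (g : pt -> R -> R) :
  smooth_strictly_convex_domain Om ->
  1 / 2 < alpha < 1 ->
  C1a0 alpha Om a -> (forall p, Om p -> 0 < a p) ->
  C1a0 alpha Om F1 -> C1a0 alpha Om F2 -> C1a0 alpha Om f ->
  Ca_C1a alpha Om g ->
  in_Da Om a F1 F2 g -> in_Ra Om a f g ->
  forall p, Om p ->
    derivable_pt_lim (fun t => f (t, snd p) / a (t, snd p)) (fst p) (- F1 p) /\
    derivable_pt_lim (fun t => f (fst p, t) / a (fst p, t)) (snd p) (- F2 p).
Proof.
  intros [Hne [[M0 HM0] [[rho [Hrho [Hsub _]]] Hconv]]] Hal Ha Hpos HF1 HF2 Hf _ HD HR.
  pose proof (sublevel_open Om rho (Hrho O) Hsub) as Ho.
  (* The added 1 makes the inclusion of [Om] in the disc strict, which leaves room for derivatives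
     at every point of [Om]. *)
  set (M := Rabs M0 + 1). assert (0 < M) as HM by (unfold M; pose proof (Rabs_pos M0); lra).
  assert (forall p, Om p -> Cmod p < M) as Hlt.
  { intros p Hp. specialize (HM0 p Hp). rewrite pnorm_Cmod in HM0. pose proof (Rle_abs M0). unfold M. lra. }
  assert (forall p, Om p -> Cmod p <= M) as Hb by (intros p Hp; left; apply Hlt, Hp).
  assert (forall p q, Om p -> Om q -> forall s, 0 < s < 1 -> Om (padd (pscal (1 - s) p) (pscal s q))) as Hcv.
  { intros p q Hp Hq s Hs. destruct (classic (p = q)) as [->|Hpq].
    - replace (padd (pscal (1 - s) q) (pscal s q)) with q; [exact Hq|].
      destruct q. unfold padd, pscal; simpl. f_equal; ring.
    - apply Hconv; auto using incl_closure. }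
  assert (0 < alpha) as Ha0 by lra.
  destruct (C1a0_lip_supported alpha Om M a Ha0 HM Ho Hne Hb Hcv Ha) as [ma [Ka [ma0 [Ka0 Da]]]].
  destruct (C1a0_lip_supported alpha Om M f Ha0 HM Ho Hne Hb Hcv Hf) as [mf [Kf [mf0 [Kf0 Df]]]].
  destruct (C1a0_lip_supported alpha Om M F1 Ha0 HM Ho Hne Hb Hcv HF1) as [m1 [K1 [m10 [K10 D1]]]].
  destruct (C1a0_lip_supported alpha Om M F2 Ha0 HM Ho Hne Hb Hcv HF2) as [m2 [K2 [m20 [K20 D2]]]].
  set (m := ma + mf + m1 + m2). set (K := Ka + Kf + K1 + K2).
  assert (0 <= K) as HK by (unfold K; lra).
  apply (lip_supported_weaken M _ _ m K) in Da; [|unfold m; lra | unfold K; lra].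
  apply (lip_supported_weaken M _ _ m K) in Df; [|unfold m; lra | unfold K; lra].
  apply (lip_supported_weaken M _ _ m K) in D1; [|unfold m; lra | unfold K; lra].
  apply (lip_supported_weaken M _ _ m K) in D2; [|unfold m; lra | unfold K; lra].
  pose proof (data_lines_vanish Om M m K (M + 1) a f F1 F2 g HK ltac:(lra) Hb
    (proj1 Hf) (proj1 HF1) (proj1 HF2) Da Df D1 D2 HD HR) as HL.
  destruct (isotropic_potential M m K (M + 1) a f F1 F2 HM ltac:(lra) HK Da Df D1 D2 HL) as [u0 Hu0].
  assert (forall q, Om q -> f q / a q = u0 q) as Eu.
  { intros q Hq. destruct (Hu0 q (Hlt q Hq)) as [E _]. specialize (Hpos q Hq). rewrite E. field. lra. }
  intros p Hp. destruct (Hu0 p (Hlt p Hp)) as [_ [Dx Dy]].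
  destruct (Ho p Hp) as [d [Hd Hball]]. destruct p as [x y]. simpl fst; simpl snd.
  (* f / a = u0 is known on [Om] only, so the derivative is transferred inside a ball contained in
     [Om]. Here k runs along a line from the given point, and b is the coordinate of that point. *)
  assert (forall b (l : R) (k : R -> pt), (forall t, Cmod (Cminus (k t) (x, y)) = Rabs t) ->
    derivable_pt_lim (fun t => u0 (k t)) 0 l -> derivable_pt_lim (fun t => f (k (t - b)) / a (k (t - b))) b l) as Tr.
  { intros b l k Hk Dk e He. destruct (Dk e He) as [d' Hd'].
    assert (0 < Rmin d d') as Hm by (apply Rmin_glb_lt; [exact Hd | apply cond_pos]).
    exists (mkposreal _ Hm). intros t Ht0 Ht. simpl in Ht.
    assert (Rabs t < d) by (eapply Rlt_le_trans; [exact Ht | apply Rmin_l]).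
    assert (Rabs t < d') by (eapply Rlt_le_trans; [exact Ht | apply Rmin_r]).
    specialize (Hd' t Ht0 H0). rewrite Rplus_0_l in Hd'.
    replace (b + t - b) with t by ring. rewrite Rminus_diag.
    rewrite !Eu; [exact Hd' | |]; apply Hball; rewrite Hk; [rewrite Rabs_R0; exact Hd | exact H]. }
  split.
  - eapply derivable_pt_lim_ext; [|apply (Tr x _ (fun t => Cplus (x, y) (t, 0))); [|exact Dx]].
    + intros t. cbv beta. replace (Cplus (x, y) (t - x, 0)) with ((t, y) : pt)
        by (apply injective_projections; simpl; ring). reflexivity.
    + intros t. rewrite <- Cmod_real. f_equal. apply injective_projections; simpl; ring.
  - eapply derivable_pt_lim_ext; [|apply (Tr y _ (fun t => Cplus (x, y) (0, t))); [|exact Dy]].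
    + intros t. cbv beta. replace (Cplus (x, y) (0, t - y)) with ((x, t) : pt)
        by (apply injective_projections; simpl; ring). reflexivity.
    + intros t. rewrite <- Cmod_imag. f_equal. apply injective_projections; simpl; ring.
Qed.
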